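(* Let $K$ be an imaginary quadratic field and $\theta_K$ as defined below. If $m\geq3$ is an odd integer all of whose prime factors split in $K$, then $\sqrt{m}\,\varphi(m\theta_K)/\varphi(\theta_K)$ is a unit (of the ring of algebraic integers).
   Context: For $\tau$ in the upper half-plane $\mathfrak{H}$ write $q=e^{2\pi i\tau}$, $q^r=e^{2\pi i r\tau}$. $\varphi(\tau)=\prod_{n=1}^\infty(1+q^{n-\frac12})^2(1-q^n)$ (equivalently $\frac{1}{\sqrt{2\pi}e^{\pi i/4}}\eta((\tau+1)/2)^2/\eta(\tau+1)$ with $\eta(\tau)=\sqrt{2\pi}e^{\pi i/4}q^{1/24}\prod_{n\ge1}(1-q^n)$). With $d_K$ the discriminant of $K$, $\theta_K=\sqrt{d_K}/2$ if $d_K\equiv0\pmod 4$ and $\theta_K=(-1+\sqrt{d_K})/2$ if $d_K\equiv1\pmod4$ (with $\mathrm{Im}(\theta_K)>0$). *)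

(* Defs.v *)
From HB Require Import structures.
From mathcomp Require Import all_boot all_order all_algebra all_field.
From mathcomp Require Import all_classical all_reals all_analysis.
From mathcomp Require Import complex.

Set Implicit Arguments.
Unset Strict Implicit.
Unset Printing Implicit Defensive.

Import Order.TTheory GRing.Theory Num.Theory.
Import numFieldNormedType.Exports.

Local Open Scope classical_set_scope.
Local Open Scope ring_scope.

Section AlgebraicIntegers.
Variable F : fieldType.

Definition algint : {pred F} :=
  [pred x | `[< integralOver (intr : int -> F) x >]].

Fact algint_subring : subring_closed algint.
Proof.
split=> [|x y|x y]; rewrite !inE.
- exact: integral1.
- exact: integral_sub.
- exact: integral_mul.
Qed.

HB.instance Definition _ := GRing.isSubringClosed.Build F algint algint_subring.

(* The integral closure of Z in F, as a ring. *)
Record integers := AlgInt {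
  algint_val :> F;
  algint_valP : algint_val \in algint }.

HB.instance Definition _ := [isSub for algint_val].
HB.instance Definition _ := [Choice of integers by <:].
HB.instance Definition _ := [SubChoice_isSubComNzRing of integers by <:].

Definition algint_unit (z : F) : Prop :=
  exists u v : integers, u * v = 1 /\ algint_val u = z.

End AlgebraicIntegers.

Section NumberField.
Variable K : fieldExtType rat.

Definition field_trace (x : K) : rat :=
  \tr (passmx.mxof (vbasis {:K}) (vbasis {:K}) (amull x)).

Definition integral_basis n (w : 'I_n -> integers K) : Prop :=
  forall x : integers K, exists! c : {ffun 'I_n -> int},
    x = \sum_i w i *~ c i.

Definition is_discriminant (d : int) : Prop :=
  exists2 w : 'I_(\dim {:K}) -> integers K, integral_basis w &
    d%:~R = \det (\matrix_(i, j) field_trace (algint_val (w i * w j))).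

(* is_discriminant holds of exactly one integer, so xget is a description
   operator here and its default value 0 plays no role. *)
Definition discriminant : int := xget 0 [set d | is_discriminant d].

(* idealr_closed includes the condition that the ideal be proper. *)
Definition prime_ideal (P : {pred integers K}) : Prop :=
  idealr_closed P /\ prime_idealr_closed P.

Definition ideal_mul (I J : {pred integers K}) : set (integers K) :=
  [set x | exists n (a b : 'I_n -> integers K),
     [/\ forall i, a i \in I, forall i, b i \in J & x = \sum_i a i * b i]].

Definition principal_ideal (a : integers K) : set (integers K) :=
  [set a * y | y in setT].

(* For K of degree 2: (p) is a product of two distinct prime ideals. *)
Definition splits (p : nat) : Prop :=
  exists P1 P2 : {pred integers K},
    [/\ prime_ideal P1, prime_ideal P2, ~ (P1 =i P2)
      & principal_ideal p%:R = ideal_mul P1 P2].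

Definition imaginary_quadratic (R : realType) : Prop :=
  \dim {:K} = 2%N /\ ({rmorphism K -> R} -> False).

End NumberField.

Section Phi.
Variable R : realType.
Local Notation C := R[i].

Definition cexp (z : C) : C :=
  let: (x +i* y)%C := z in (expR x * cos y +i* (expR x * sin y))%C.

(* q^r = exp(2 pi i r tau) *)
Definition qpow (tau : C) (r : R) : C := cexp ((2 * pi * r)%:C * 'i * tau)%C.

(* The topology of R[i] is the one of R[i]^o, given by the complex modulus. *)
Definition phi (tau : C) : C :=
  lim ((fun N : nat => \prod_(1 <= n < N.+1)
          ((1 + qpow tau (n%:R - 2^-1)) ^+ 2 * (1 - qpow tau n%:R))
        : C^o) @ \oo).

(* d is the discriminant of an imaginary quadratic field, hence d < 0 and
   d = 0 or 1 mod 4; the square root of d is the one with positive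
   imaginary part. *)
Definition theta_of_disc (d : int) : C :=
  let sqrtd := (0 +i* Num.sqrt (- d%:~R))%C in
  if (d == 0 %[mod 4])%Z then sqrtd / 2 else (- 1 + sqrtd) / 2.

Definition theta (K : fieldExtType rat) : C := theta_of_disc (discriminant K).

End Phi.

Arguments theta : clear implicits.

(* Main.v *)
Require Import Defs.
From HB Require Import structures.
From mathcomp Require Import all_boot all_order all_algebra all_field.
From mathcomp Require Import all_classical all_reals all_analysis.
From mathcomp Require Import complex ring lra zify.

(** Write Delta for the discriminant form and s = (theta + 1) / 2.  By the product formulas,
    phi(tau)^24 = Delta((tau + 1) / 2)^2 / Delta(tau + 1), so the 24th power of the number in
    question is d_m(s)^2 / d_m(2 s), where d_m(z) = m^12 Delta(m z) / Delta(z), and it is enough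
    that d_m(z) is a unit at z = s and z = 2 s.

    More generally consider det(X)^12 (Delta|X)(z) / Delta(z) for integer matrices X.  For fixed
    determinant n these functions are permuted by SL2(Z), up to left equivalence, and have
    expansions in q^(1/n) with algebraic integer coefficients.  Their symmetric functions are thus
    polynomials with algebraic integer coefficients in a Hauptmodul J, and so all of them take
    algebraic integer values at quadratic points once J does; the latter follows from the
    modular equation of a matrix fixing the point, whose leading coefficient is a unit when the
    determinant is not a square.

    Let p be an odd prime that splits, so that the discriminant is a nonzero square s^2 mod p.
    Two of the matrices of determinant p, of the form z |-> (z + j) / p with j attached to s and
    to -s, have values a and b for which y = a b / p^12 is integral: the multiples of y by the
    12th powers of some alpha, of its conjugate and of p are integral, and these three numbers
    generate the unit ideal.  The product of all the values of determinant p is p^12 times a root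
    of unity, and d_p(z) is one of them, so that d_p(z) divides a unit.  Multiplicativity gives
    d_m(z).

    The transformation Delta(-1/t) = t^12 Delta(t) comes from comparing both orders of
    multiplication in an absolutely convergent double product over the lattice. *)

Set Implicit Arguments.
Unset Strict Implicit.
Unset Printing Implicit Defensive.

Import Order.TTheory GRing.Theory Num.Theory.
Import numFieldNormedType.Exports.

Local Open Scope ring_scope.

(** * Limits and the exponential function *)

Section Modulus.
Variable R : realType.
Local Notation C := R[i].
Local Notation Re := complex.Re.
Local Notation Im := complex.Im.
Implicit Types (z w : C) (x : R).

(** For a single point a, the product of 1 - (a/w)^2 over the nonzero lattice points w converges
    only conditionally, so the order of multiplication matters. Such products are therefore combined
    over several half periods a, some moved by a period, with exponents for which the terms of order
    w^-2 cancel. The exponents add up to 12, the weight of Delta, and Euler's identity between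
    distinct and odd parts turns the product of the rows into 1 / Delta, up to explicit factors.

    Function theory is reduced to locally uniform limits of polynomials and a maximum principle. A
    modular function vanishing at infinity is zero because its values on Im z >= 1/2 determine all
    others, while the maximum principle on a larger disc contracts any bound found there.

    The Hauptmodul is built from Delta alone, by summing reciprocals of the quotients of determinant
    2.

    Repeated prime factors of m need care: at p z the discriminant acquires a factor p^2 and the
    argument for split primes breaks down, but the product of all values of determinant p carries
    the unit property from z to p z. *)

Definition cmod z : R := ComplexField.Normc.normc z.

Lemma cmod_sqrt z : cmod z = Num.sqrt (Re z ^+ 2 + Im z ^+ 2).
Proof. by case: z. Qed.

Lemma cmod_ge0 z : 0 <= cmod z.
Proof. by rewrite cmod_sqrt sqrtr_ge0. Qed.

Lemma sqr_cmod z : cmod z ^+ 2 = Re z ^+ 2 + Im z ^+ 2.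
Proof. by rewrite cmod_sqrt sqr_sqrtr // addr_ge0 ?sqr_ge0. Qed.

Lemma normC_cmod z : `|z| = (cmod z)%:C%C.
Proof. by rewrite normc_def cmod_sqrt. Qed.

Lemma cmod0 : cmod 0 = 0. Proof. exact: ComplexField.Normc.normc0. Qed.
Lemma cmod1 : cmod 1 = 1. Proof. exact: ComplexField.Normc.normc1. Qed.
Lemma cmodM z w : cmod (z * w) = cmod z * cmod w.
Proof. exact: ComplexField.Normc.normcM. Qed.
Lemma cmodV z : cmod z^-1 = (cmod z)^-1.
Proof. exact: ComplexField.Normc.normcV. Qed.
Lemma cmodN z : cmod (- z) = cmod z.
Proof. by case: z => a b; rewrite !cmod_sqrt /= !sqrrN. Qed.
Lemma cmodB z w : cmod (z - w) = cmod (w - z).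
Proof. by rewrite -cmodN opprB. Qed.
Lemma cmodf_div z w : cmod (z / w) = cmod z / cmod w.
Proof. by rewrite cmodM cmodV. Qed.
Lemma cmodX z n : cmod (z ^+ n) = cmod z ^+ n.
Proof. by elim: n => [|n IH]; rewrite ?expr0 ?cmod1 // !exprS cmodM IH. Qed.

Lemma ler_cmodD z w : cmod (z + w) <= cmod z + cmod w.
Proof. by rewrite -lecR rmorphD /= -!normC_cmod ler_normD. Qed.

Lemma ler_cmodB z w : cmod (z - w) <= cmod z + cmod w.
Proof. by rewrite -(cmodN w) ler_cmodD. Qed.

Lemma lerB_cmod z w : cmod z - cmod w <= cmod (z - w).
Proof. by rewrite lerBlDr -{1}(subrK w z) ler_cmodD. Qed.

Lemma cmod_eq0 z : (cmod z == 0) = (z == 0).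
Proof.
apply/eqP/eqP => [|->]; last exact: cmod0.
exact: ComplexField.Normc.eq0_normc.
Qed.

Lemma cmod_gt0 z : (0 < cmod z) = (z != 0).
Proof. by rewrite lt_def cmod_ge0 andbT cmod_eq0. Qed.

Lemma cmod_real x : cmod x%:C%C = `|x|.
Proof. by rewrite cmod_sqrt /= expr0n /= addr0 sqrtr_sqr. Qed.

Lemma natrC n : (n%:R : C) = (n%:R : R)%:C%C.
Proof. by rewrite rmorph_nat. Qed.

Lemma cmod_nat n : cmod n%:R = n%:R.
Proof. by rewrite natrC cmod_real ger0_norm. Qed.

Lemma cmod_i : cmod 'i%C = 1.
Proof. by rewrite cmod_sqrt /= expr0n /= add0r expr1n sqrtr1. Qed.

Lemma cmod_sum I (r : seq I) (P : pred I) (F : I -> C) :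
  cmod (\sum_(i <- r | P i) F i) <= \sum_(i <- r | P i) cmod (F i).
Proof.
elim/big_rec2: _ => [|i u v _ le]; first by rewrite cmod0.
by apply: (le_trans (ler_cmodD _ _)); rewrite lerD2l.
Qed.

Lemma ler_Re_cmod z : `|Re z| <= cmod z.
Proof. by rewrite -lecR -normC_cmod normc_ge_Re. Qed.

Lemma ler_Im_cmod z : `|Im z| <= cmod z.
Proof.
by rewrite cmod_sqrt -sqrtr_sqr ler_sqrt ?lerDr ?sqr_ge0 // addr_ge0 ?sqr_ge0.
Qed.

Lemma ler_cmod_ReIm z : cmod z <= `|Re z| + `|Im z|.
Proof.
rewrite {1}[z]complexE; apply: (le_trans (ler_cmodD _ _)).
by rewrite cmodM cmod_i mul1r !cmod_real.
Qed.

End Modulus.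

Section Limits.
Variable R : realType.
Local Notation C := R[i].
Local Notation Re := complex.Re.
Local Notation Im := complex.Im.
Implicit Types (u v : nat -> C) (l z : C).

Definition cv u l := forall e : R, 0 < e ->
  exists n0, forall n, (n0 <= n)%N -> cmod (u n - l) < e.

Lemma cv_cst z : cv (fun=> z) z.
Proof. by move=> e e0; exists 0%N => n _; rewrite subrr cmod0. Qed.

Lemma eq_cv u v l : u =1 v -> cv u l -> cv v l.
Proof. by move=> uv cu e /cu[n0 h]; exists n0 => n /h; rewrite uv. Qed.

Lemma eq_cv_near n1 u v l :
  (forall n, (n1 <= n)%N -> u n = v n) -> cv u l -> cv v l.
Proof.
move=> uv cu e /cu[n0 h]; exists (maxn n0 n1) => n.
by rewrite geq_max => /andP[/h hn /uv <-].
Qed.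

Lemma cv_unique u l l' : cv u l -> cv u l' -> l = l'.
Proof.
move=> h h'; apply/eqP; rewrite -subr_eq0 -cmod_eq0 eq_le cmod_ge0 andbT.
rewrite leNgt; apply/negP => d0.
have e0 : 0 < cmod (l - l') / 2 by lra.
have [n1 h1] := h _ e0; have [n2 h2] := h' _ e0.
have := h1 _ (leq_maxl n1 n2); have := h2 _ (leq_maxr n1 n2).
set n := maxn _ _; rewrite (cmodB (u n) l).
have := ler_cmodD (l - u n) (u n - l'); rewrite addrA subrK => t1 t2 t3.
lra.
Qed.

Lemma cv_bounded u l : cv u l -> exists2 B : R, 0 < B & forall n, cmod (u n) <= B.
Proof.
move=> /(_ 1 ltr01)[n0 h].
have S0 : 0 <= \sum_(i < n0) cmod (u i) by apply: sumr_ge0 => i _; exact: cmod_ge0.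
exists (\sum_(i < n0) cmod (u i) + cmod l + 1).
  have := cmod_ge0 l; lra.
move=> n; have [/h hn|lt_n] := leqP n0 n.
  have := ler_cmodD (u n - l) l; rewrite subrK; lra.
rewrite (bigD1 (Ordinal lt_n)) //=.
have : 0 <= \sum_(i < n0 | i != Ordinal lt_n) cmod (u i).
  by apply: sumr_ge0 => i _; exact: cmod_ge0.
have := cmod_ge0 l; lra.
Qed.

Lemma cvD u v l l' : cv u l -> cv v l' -> cv (fun n => u n + v n) (l + l').
Proof.
move=> h h' e e0; have e20 : 0 < e / 2 by lra.
have [n1 h1] := h _ e20; have [n2 h2] := h' _ e20.
exists (maxn n1 n2) => n; rewrite geq_max => /andP[/h1 g1 /h2 g2].
have := ler_cmodD (u n - l) (v n - l'); rewrite addrACA -opprD; lra.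
Qed.

Lemma cvN u l : cv u l -> cv (fun n => - u n) (- l).
Proof. by move=> h e /h[n0 g]; exists n0 => n /g; rewrite -opprD cmodN. Qed.

Lemma cvB u v l l' : cv u l -> cv v l' -> cv (fun n => u n - v n) (l - l').
Proof. by move=> h h'; apply: cvD => //; exact: cvN. Qed.

Lemma cvP0 u l : cv u l <-> cv (fun n => u n - l) 0.
Proof.
by split=> h e /h[n0 g]; exists n0 => n /g; rewrite subr0.
Qed.

Lemma cv_le0 u (B : R) (v : nat -> C) :
  (forall n, cmod (u n) <= B * cmod (v n)) -> cv v 0 -> cv u 0.
Proof.
move=> le h e e0.
have e1 : 0 < e / (`|B| + 1).
  by rewrite divr_gt0 // ltr_wpDl.
have [n0 g] := h _ e1; exists n0 => n /g; rewrite !subr0 => lt.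
apply: (le_lt_trans (le n)); apply: (le_lt_trans (y := (`|B| + 1) * cmod (v n))).
  rewrite ler_wpM2r ?cmod_ge0 //; have := ler_norm B; lra.
by rewrite mulrC -ltr_pdivlMr // ltr_wpDl.
Qed.

Lemma cvM u v l l' : cv u l -> cv v l' -> cv (fun n => u n * v n) (l * l').
Proof.
move=> h h'; have [B B0 hB] := cv_bounded h'; apply/cvP0.
apply: (@eq_cv (fun n => (u n - l) * v n + l * (v n - l'))).
  by move=> n; ring.
rewrite -(addr0 (0 : C)); apply: cvD.
  apply: (@cv_le0 _ B (fun n => u n - l)); last exact: (cvP0 _ _).1 h.
  by move=> n; rewrite cmodM mulrC ler_wpM2r ?cmod_ge0.
apply: (@cv_le0 _ (cmod l) (fun n => v n - l')); last exact: (cvP0 _ _).1 h'.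
by move=> n; rewrite cmodM.
Qed.

Lemma cvX u l k : cv u l -> cv (fun n => u n ^+ k) (l ^+ k).
Proof.
move=> h; elim: k => [|k IH]; first exact: cv_cst.
rewrite exprS; apply: (eq_cv (u := fun n => u n * u n ^+ k)); last exact: cvM.
by move=> n; rewrite exprS.
Qed.

Lemma cv_prod I (r : seq I) (F : I -> nat -> C) (L : I -> C) :
  (forall i, cv (F i) (L i)) ->
  cv (fun n => \prod_(i <- r) F i n) (\prod_(i <- r) L i).
Proof.
move=> h; elim: r => [|i r IH].
  rewrite big_nil; apply: (eq_cv (u := fun=> 1)); last exact: cv_cst.
  by move=> n; rewrite big_nil.
rewrite big_cons; apply: (eq_cv (u := fun n => F i n * \prod_(j <- r) F j n)).
  by move=> n; rewrite big_cons.
exact: cvM.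
Qed.

Lemma cvV u l : l != 0 -> cv u l -> cv (fun n => (u n)^-1) l^-1.
Proof.
move=> l0 h e e0.
have m0 : 0 < cmod l by rewrite cmod_gt0.
have m2 : 0 < cmod l / 2 by lra.
have e1 : 0 < e * (cmod l / 2) * cmod l by rewrite !mulr_gt0.
have [n1 h1] := h _ m2; have [n2 h2] := h _ e1.
exists (maxn n1 n2) => n; rewrite geq_max => /andP[/h1 g1 /h2 g2].
have un : cmod l / 2 < cmod (u n).
  have := lerB_cmod l (u n); rewrite cmodB; lra.
have un0 : u n != 0 by rewrite -cmod_gt0; lra.
have -> : (u n)^-1 - l^-1 = (l - u n) / (u n * l) by field; rewrite un0 l0.
rewrite cmodf_div cmodM cmodB ltr_pdivrMr ?mulr_gt0 //; last lra.
apply: (lt_trans g2); rewrite [ltRHS]mulrA ltr_pM2r // ltr_pM2l //.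
Qed.

Lemma cv_div u v l l' : l' != 0 -> cv u l -> cv v l' -> cv (fun n => u n / v n) (l / l').
Proof. by move=> l0 h h'; apply: cvM => //; exact: cvV. Qed.

Lemma cv_sub (k : nat -> nat) u l :
  (forall n, (n <= k n)%N) -> cv u l -> cv (fun n => u (k n)) l.
Proof.
move=> hk h e /h[n0 g]; exists n0 => n hn; apply: g.
exact: leq_trans hn (hk n).
Qed.

Lemma cv_le u l (B : R) n1 : cv u l -> (forall n, (n1 <= n)%N -> cmod (u n) <= B) ->
  cmod l <= B.
Proof.
move=> h hB; rewrite leNgt; apply/negP => lt.
have e0 : 0 < cmod l - B by lra.
have [n0 g] := h _ e0.
have := g _ (leq_maxl n0 n1); have := hB _ (leq_maxr n0 n1).
set n := maxn _ _; have := lerB_cmod l (u n); rewrite cmodB; lra.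
Qed.

Lemma cv_clim u l : cv u l -> lim ((u : nat -> C^o) @ \oo)%classic = l.
Proof.
move=> h; apply: cvg_lim => //; apply/cvgrPdist_lt => e e0.
have [r re] : exists r : R, e = r%:C%C.
  by exists (Re e); rewrite RRe_real // realE ltW.
rewrite re ltcR in e0.
have [n0 g] := h _ e0; exists n0 => // n /= /g.
by rewrite re normC_cmod ltcR cmodB.
Qed.

Lemma cauchy_cv u :
  (forall e : R, 0 < e -> exists n0, forall m n, (n0 <= m)%N -> (m <= n)%N ->
     cmod (u n - u m) <= e) ->
  exists l, cv u l.
Proof.
move=> h.
have key (f : C -> R) (fB : forall z w, f (z - w) = f z - f w)
    (fl : forall z, `|f z| <= cmod z) :
    exists l : R, forall e : R, 0 < e -> exists n0, forall n, (n0 <= n)%N ->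
      `|f (u n) - l| < e.
  have /cvg_ex[l hl] : cvg ((fun n => f (u n)) @ \oo)%classic.
    apply/cauchy_cvgP/cauchy_exP => e e0.
    have e20 : 0 < e / 2 by lra.
    have [n0 g] := h _ e20.
    exists (f (u n0)), n0 => // n /= hn.
    have g1 := g _ _ (leqnn _) hn; have f1 := fl (u n - u n0).
    rewrite fB in f1; rewrite /ball /= distrC; lra.
  exists l => e e0; move/cvgrPdist_lt: hl => /(_ e e0)[n0 _ g].
  by exists n0 => n /g /=; rewrite distrC.
have [|| a ha] := key (fun z => Re z).
- by move=> [? ?] [? ?].
- exact: ler_Re_cmod.
have [|| b hb] := key (fun z => Im z).
- by move=> [? ?] [? ?].
- exact: ler_Im_cmod.
exists (a +i* b)%C => e e0; have e20 : 0 < e / 2 by lra.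
have [n1 g1] := ha _ e20; have [n2 g2] := hb _ e20.
exists (maxn n1 n2) => n; rewrite geq_max => /andP[/g1 + /g2].
have := ler_cmod_ReIm (u n - (a +i* b)%C).
case: (u n) => x y /=; lra.
Qed.

End Limits.

Section ComplexExponential.
Variable R : realType.
Local Notation C := R[i].
Local Notation Re := complex.Re.
Local Notation Im := complex.Im.
Implicit Types (z w : C) (x y : R).

Lemma cexpE z : cexp z = (expR (Re z) * cos (Im z) +i* (expR (Re z) * sin (Im z)))%C.
Proof. by case: z. Qed.

Lemma cexpD z w : cexp (z + w) = cexp z * cexp w.
Proof.
case: z w => [a b] [c d] /=; rewrite expRD cosD sinD.
by apply/eqP; rewrite eq_complex /=; apply/andP; split; apply/eqP; ring.
Qed.

Lemma cexp0 : cexp (0 : C) = 1.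
Proof. by rewrite cexpE /= expR0 cos0 sin0 mul1r mulr0. Qed.

Lemma cmod_cexp z : cmod (cexp z) = expR (Re z).
Proof.
rewrite cmod_sqrt cexpE /= !exprMn -mulrDr cos2Dsin2 mulr1 sqrtr_sqr.
by rewrite ger0_norm ?expR_ge0.
Qed.

Lemma cexp_neq0 z : cexp z != 0.
Proof. by rewrite -cmod_gt0 cmod_cexp expR_gt0. Qed.

Lemma cexpN z : cexp (- z) = (cexp z)^-1.
Proof.
apply: (mulIf (cexp_neq0 z)).
by rewrite mulVf ?cexp_neq0 // -cexpD addNr cexp0.
Qed.

Lemma cexpMn z n : cexp (z *+ n) = cexp z ^+ n.
Proof. by elim: n => [|n IH]; rewrite ?mulr0n ?cexp0 // mulrS cexpD IH exprS. Qed.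

Lemma cexp_polar z : z != 0 -> exists w, cexp w = z.
Proof.
move=> z0; have m0 : 0 < cmod z by rewrite cmod_gt0.
have msq := sqr_cmod z.
set c := Re z / cmod z; set s := Im z / cmod z.
have cs : c ^+ 2 + s ^+ 2 = 1.
  rewrite /c /s !expr_div_n -mulrDl -msq divff // expf_neq0 //; lra.
have hc : -1 <= c <= 1.
  by have := sqr_ge0 s; move: cs => /=; move: (s ^+ 2) => t cs t0; apply/andP; split; nra.
have [sg hs] : exists t, cos t = c /\ sin t = s.
  have s2 : sin (acos c) ^+ 2 = s ^+ 2.
    by rewrite sin2cos2 acosK //; lra.
  move/eqP: s2; rewrite eqf_sqr => /orP[]/eqP e.
    by exists (acos c); rewrite acosK.
  by exists (- acos c); rewrite cosN sinN acosK // e opprK.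
exists (ln (cmod z) +i* sg)%C; rewrite /= lnK ?posrE //.
case: hs => -> ->; rewrite /c /s.
case: (z) m0 => a b /= m0; apply/eqP; rewrite eq_complex /=.
by apply/andP; split; apply/eqP; field; lra.
Qed.

Lemma derivable_cvn (f : R -> R) (d : R) : is_derive (0 : R) (1 : R) f d ->
  forall e : R, 0 < e -> exists n0, forall n, (n0 <= n)%N ->
    `|n.+1%:R * (f n.+1%:R^-1 - f 0) - d| < e.
Proof.
move=> [df <-] e e0.
move/cvgrPdist_lt: df => /(_ e e0) /=.
rewrite /dnbhs => /nbhs_ballP[r /= r0 h].
have [n0 hn0] : exists n0 : nat, r^-1 < n0%:R.
  by exists (Num.truncn r^-1).+1; rewrite truncnS_gt.
exists n0 => n hn.
have np : (0 : R) < n.+1%:R by [].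
have := h n.+1%:R^-1; rewrite /ball /= sub0r normrN ger0_norm ?invr_ge0 //.
have rn : r^-1 < n.+1%:R.
  by apply: (lt_le_trans hn0); rewrite ler_nat; apply: leq_trans hn _.
rewrite -[X in (X < _) -> _]/(_^-1) invf_plt ?posrE //.
move=> /(_ rn); rewrite invr_eq0 pnatr_eq0 => /(_ isT).
rewrite invrK distrC; congr (`| _ - _| < _).
by rewrite /GRing.scale /= mulr1 addr0.
Qed.

(** The derivative of t |-> cexp (t z) at 0, taken along t = 1 / (n + 1) and split into its real and
    imaginary parts [F] and [G]. *)
Lemma cv_cexp_derive z : cv (fun n => n.+1%:R * (cexp (z / n.+1%:R) - 1)) z.
Proof.
case: z => a b.
pose F (t : R) : R := expR (a * t) * cos (b * t).
pose G (t : R) : R := expR (a * t) * sin (b * t).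
have h1 := @derivable_cvn F a; have h2 := @derivable_cvn G b.
have F0 : F 0 = 1 by rewrite /F !mulr0 expR0 cos0 mulr1.
have G0 : G 0 = 0 by rewrite /G !mulr0 sin0 mulr0.
have dF : is_derive (0 : R) (1 : R) F a.
  rewrite /F; apply: is_derive_eq.
  by rewrite !mulr0 /GRing.scale /= cos0 sin0 expR0; ring.
have dG : is_derive (0 : R) (1 : R) G b.
  rewrite /G; apply: is_derive_eq.
  by rewrite !mulr0 /GRing.scale /= cos0 sin0 expR0; ring.
move=> e e0; have e2 : 0 < e / 2 by lra.
have [n1 g1] := h1 dF _ e2; have [n2 g2] := h2 dG _ e2.
exists (maxn n1 n2) => n; rewrite geq_max => /andP[/g1 + /g2]; rewrite F0 G0.
have -> : n.+1%:R * (cexp ((a +i* b)%C / n.+1%:R) - 1) - (a +i* b)%C =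
  ((n.+1%:R * (F n.+1%:R^-1 - 1) - a) +i* (n.+1%:R * (G n.+1%:R^-1 - 0) - b))%C.
  have -> : (a +i* b)%C / n.+1%:R = ((a / n.+1%:R) +i* (b / n.+1%:R))%C.
    rewrite natrC -fmorphV /=; apply/eqP; rewrite eq_complex /=.
    by apply/andP; split; apply/eqP; ring.
  rewrite natrC /F /G; apply/eqP; rewrite eq_complex /=.
  by apply/andP; split; apply/eqP; ring.
move=> k1 k2; apply: (le_lt_trans (ler_cmod_ReIm _)) => /=; lra.
Qed.

(* Locked, so that mulf_neq0 and the like do not see a product. *)
Definition twopii : C := locked ((2 * pi : R)%:C * 'i)%C.

Lemma twopiiE : twopii = ((2 * pi : R)%:C * 'i)%C.
Proof. by rewrite /twopii -lock. Qed.

Definition ee z : C := cexp (twopii * z).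

Lemma twopii_neq0 : twopii != 0.
Proof.
by rewrite twopiiE mulf_neq0 // -cmod_gt0 ?cmod_i // cmod_real normr_gt0 mulf_neq0 ?gt_eqF ?pi_gt0.
Qed.

Lemma eeD z w : ee (z + w) = ee z * ee w.
Proof. by rewrite /ee mulrDr cexpD. Qed.

Lemma ee0 : ee 0 = 1. Proof. by rewrite /ee mulr0 cexp0. Qed.

Lemma eeN z : ee (- z) = (ee z)^-1.
Proof. by rewrite /ee mulrN cexpN. Qed.

Lemma ee_neq0 z : ee z != 0. Proof. exact: cexp_neq0. Qed.

Lemma eeMn z n : ee (z *+ n) = ee z ^+ n.
Proof. by rewrite /ee mulrnAr cexpMn. Qed.

Lemma ee_natl z n : ee (n%:R * z) = ee z ^+ n.
Proof. by rewrite mulr_natl eeMn. Qed.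

Lemma eeM_int z (k : int) : ee (k%:~R * z) = ee z ^ k.
Proof.
case: k => n; first by rewrite -pmulrn ee_natl.
by rewrite NegzE rmorphN /= mulNr eeN -pmulrn ee_natl.
Qed.

Lemma eeE z : ee z = cexp (- (2 * pi * Im z) +i* (2 * pi * Re z))%C.
Proof.
rewrite /ee twopiiE; congr cexp; case: z => a b; apply/eqP; rewrite eq_complex /=.
by apply/andP; split; apply/eqP; ring.
Qed.

Lemma ee_realE x : ee x%:C%C = (cos (2 * pi * x) +i* sin (2 * pi * x))%C.
Proof.
by rewrite eeE /= !mulr0 oppr0 expR0 !mul1r.
Qed.

Lemma ee1 : ee 1 = 1.
Proof.
have := ee_realE 1; rewrite rmorph1 => ->.
by rewrite mulr1 mulr_natl cos2pi sin2pi.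
Qed.

Lemma ee_half : ee 2^-1 = -1.
Proof.
have := ee_realE 2^-1; rewrite fmorphV rmorph_nat => ->.
rewrite mulrC mulrA mulVf // mul1r cospi sinpi.
by apply/eqP; rewrite eq_complex /= oppr0 !eqxx.
Qed.

Lemma ee_int (k : int) : ee k%:~R = 1.
Proof. by rewrite -[k%:~R]mulr1 eeM_int ee1 exp1rz. Qed.

Lemma cmod_ee z : cmod (ee z) = expR (- (2 * pi * Im z)).
Proof.
by rewrite eeE cmod_cexp.
Qed.

Lemma ee_surj z : z != 0 -> exists w, ee w = z.
Proof.
move=> /cexp_polar[w <-]; exists (w / twopii).
by rewrite /ee mulrC divfK ?twopii_neq0.
Qed.

Lemma cv_ee_derive z : cv (fun n => n.+1%:R * (ee (z / n.+1%:R) - 1)) (twopii * z).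
Proof. by apply: eq_cv (cv_cexp_derive _) => n; rewrite /ee mulrA. Qed.

Lemma cv_invn : cv (fun n => (n.+1%:R : C)^-1) 0.
Proof.
move=> e e0; exists (Num.truncn e^-1) => n hn.
rewrite subr0 cmodV cmod_nat invf_plt ?posrE //.
by apply: (lt_le_trans (truncnS_gt _)); rewrite ler_nat.
Qed.

Lemma cv_ee_div z : cv (fun n => ee (z / n.+1%:R)) 1.
Proof.
rewrite -[X in cv _ X](addr0 (1 : C)).
apply: (@eq_cv _ (fun n => 1 + n.+1%:R^-1 * (n.+1%:R * (ee (z / n.+1%:R) - 1)))).
  by move=> n; rewrite mulrA mulVf ?pnatr_eq0 // mul1r addrC subrK.
apply: cvD; first exact: cv_cst.
by rewrite -(mul0r (twopii * z)); apply: cvM; [exact: cv_invn | exact: cv_ee_derive].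
Qed.

(** The mean value theorem gives sin (x/2) >= cos (x/2) x/2, so sin x = 2 cos (x/2) sin (x/2) is at
    least x cos^2 (x/2) = x (1 + cos x) / 2. *)
Lemma sin_ge_half x : 0 <= x <= pi / 2 -> x / 2 <= sin x.
Proof.
move=> /andP[x0 xpi].
have [->|xn0] := eqVneq x 0; first by rewrite mul0r sin0.
have xp : 0 < x by rewrite lt_def xn0 x0.
have h0 : 0 < x / 2 by lra.
have [c hc] : exists2 c, c \in `]0, (x / 2)[%R & sin (x / 2) - sin 0 = cos c * (x / 2 - 0).
  apply: (@MVT _ (@sin R) (@cos R) _ _ h0).
  by apply: continuous_subspaceT => y; exact: continuous_sin.
rewrite sin0 !subr0 => e.
have hcc : cos (x / 2) <= cos c.
  move: hc; rewrite in_itv /= => /andP[c0 cx].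
  have pp := pi_gt0 R.
  rewrite leNgt ltr_cos ?in_itv /=; first by rewrite -leNgt; lra.
    by apply/andP; split; lra.
  by apply/andP; split; lra.
have cp : 0 <= cos (x / 2).
  by apply: cos_ge0_pihalf; have pp := pi_gt0 R; apply/andP; split; lra.
have cxx : 0 <= cos x by apply: cos_ge0_pihalf; have pp := pi_gt0 R; apply/andP; split; lra.
have xx : x = (x / 2) *+ 2 by rewrite mulr2n; field.
have s2 : sin x = 2 * cos (x / 2) * sin (x / 2).
  by rewrite {1}xx sin_mulr2n mulr2n; ring.
have c2 : cos x = 2 * cos (x / 2) ^+ 2 - 1.
  by rewrite {1}xx cos_mulr2n mulr2n; ring.
rewrite s2 e.
have : cos (x / 2) * cos (x / 2) <= cos (x / 2) * cos c by rewrite ler_wpM2l.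
move: cp hcc cxx; rewrite c2 expr2.
move: (cos (x / 2)) (cos c) => u v cp hcc cxx k.
have : x * (2 * (u * u)) <= x * (2 * (u * v)) by rewrite ler_wpM2l //; lra.
have : x * 1 <= x * (2 * (u * u)) by rewrite ler_wpM2l //; lra.
lra.
Qed.

(** The chord has length 2 sin (pi x). This lower bound yields both the primitivity of [zeta] and
    the dominating series for the sine product. *)
Lemma cmod_1Bee_ge x : 0 <= x <= 2^-1 -> x <= cmod (1 - ee x%:C%C).
Proof.
move=> hx; have pp := pi_gt0 R; have p2 := pi_ge2 R.
have e : cmod (1 - ee x%:C%C) ^+ 2 = (2 * sin (pi * x)) ^+ 2.
  rewrite ee_realE sqr_cmod /=.
  have -> : 2 * pi * x = (pi * x) *+ 2 by rewrite mulr2n; ring.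
  rewrite cos_mulr2n sin_mulr2n !mulr2n.
  have := cos2Dsin2 (pi * x); set c := cos _; set s := sin _ => cs.
  have -> : c ^+ 2 = 1 - s ^+ 2 by lra.
  rewrite -[RHS]mulr1 -[X in _ = _ * X]cs; ring: cs.
have sx : pi * x / 2 <= sin (pi * x) by apply: sin_ge_half; case/andP: hx => *; apply/andP; split; nra.
have px : 2 * x <= pi * x by case/andP: hx => *; nra.
have s0 : 0 <= 2 * sin (pi * x) by case/andP: hx => *; nra.
move/eqP: e; rewrite eqrXn2 ?cmod_ge0 // => /eqP ->.
case/andP: hx => *; nra.
Qed.

End ComplexExponential.

(** * The sine product *)

Section ProductBounds.
Variable R : realType.
Local Notation C := R[i].

Lemma cmod_prod1D I (r : seq I) (P : pred I) (u : I -> C) :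
  cmod (\prod_(i <- r | P i) (1 + u i)) <= expR (\sum_(i <- r | P i) cmod (u i)).
Proof.
elim/big_rec2: _ => [|i x y _ le]; first by rewrite cmod1 expR0.
rewrite cmodM expRD; apply: ler_pM; rewrite ?cmod_ge0 //.
apply: le_trans (expR_ge1Dx _).
by apply: (le_trans (ler_cmodD _ _)); rewrite cmod1.
Qed.

Lemma cmod_prod1D_sub1 I (r : seq I) (P : pred I) (u : I -> C) :
  cmod (\prod_(i <- r | P i) (1 + u i) - 1) <=
  expR (\sum_(i <- r | P i) cmod (u i)) - 1.
Proof.
elim/big_rec2: _ => [|i x y _ le]; first by rewrite subrr cmod0 expR0 subrr.
have -> : (1 + u i) * y - 1 = (1 + u i) * (y - 1) + u i by ring.
apply: (le_trans (ler_cmodD _ _)); rewrite cmodM expRD.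
have h1 : cmod (1 + u i) <= expR (cmod (u i)).
  apply: le_trans (expR_ge1Dx _).
  by apply: (le_trans (ler_cmodD _ _)); rewrite cmod1.
have h2 := expR_ge1Dx (cmod (u i)).
have : cmod (1 + u i) * cmod (y - 1) <= expR (cmod (u i)) * (expR x - 1).
  by apply: ler_pM; rewrite ?cmod_ge0.
lra.
Qed.

Lemma expR_sub1_le (s : R) : 0 <= s -> expR s - 1 <= s * expR s.
Proof.
move=> s0; have := expR_ge1Dx (- s); rewrite expRN => h.
have e0 := expR_gt0 s.
have : (1 - s) * expR s <= (expR s)^-1 * expR s by rewrite ler_wpM2r // ltW.
rewrite mulVf ?gt_eqF //; lra.
Qed.

Lemma cmod_prod1D_sub1_le I (r : seq I) (P : pred I) (u : I -> C) (s : R) :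
  \sum_(i <- r | P i) cmod (u i) <= s ->
  cmod (\prod_(i <- r | P i) (1 + u i) - 1) <= s * expR s.
Proof.
move=> le; apply: (le_trans (cmod_prod1D_sub1 _ _ _)).
have s0 : 0 <= \sum_(i <- r | P i) cmod (u i).
  by apply: sumr_ge0 => i _; exact: cmod_ge0.
apply: (le_trans (expR_sub1_le s0)); apply: ler_pM; rewrite ?expR_ge0 //.
by rewrite ler_expR.
Qed.

(** 1 / (j + 1)^2 <= 1 / j - 1 / (j + 1), and the right-hand side telescopes. *)
Lemma sum_invsq_le (m n : nat) : (0 < m)%N ->
  \sum_(m <= j < n) ((j.+1%:R : R) ^+ 2)^-1 <= m%:R^-1.
Proof.
move=> m0; have [nm|/ltnW mn] := leqP n m.
  by rewrite big_geq // invr_ge0.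
apply: (@le_trans _ _ (\sum_(m <= j < n) ((j%:R)^-1 - (j.+1%:R)^-1))).
  rewrite big_nat [leRHS]big_nat; apply: ler_sum => j /andP[mj _].
  have j0 : (0 : R) < j%:R by rewrite ltr0n; apply: leq_trans mj.
  rewrite -natr1; set x : R := j%:R in j0 *.
  have -> : x^-1 - (x + 1)^-1 = (x * (x + 1))^-1 by field; lra.
  rewrite lef_pV2 ?posrE; nra.
have -> : \sum_(m <= j < n) ((j%:R : R)^-1 - j.+1%:R^-1) =
  - \sum_(m <= j < n) (j.+1%:R^-1 - j%:R^-1).
  by rewrite -sumrN; apply: eq_bigr => j _; rewrite opprB.
by rewrite telescope_sumr // opprB gerBl invr_ge0.
Qed.

Lemma sum_invsq_le2 (n : nat) : \sum_(0 <= j < n) ((j.+1%:R : R) ^+ 2)^-1 <= 2.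
Proof.
case: n => [|n]; first by rewrite big_geq.
rewrite big_ltn // expr1n invr1.
have := @sum_invsq_le 1 n.+1 isT; rewrite invr1; lra.
Qed.

End ProductBounds.

(** For t an N-th root of unity these are two conjugate factors of u^N - 1, written as their value
    at u = 1 times a factor close to 1. *)
Lemma quadratic_pair (F : fieldType) (u t : F) : u != 0 -> t != 0 ->
  (1 - t) * (1 - t^-1) != 0 ->
  (u - t) * (u - t^-1) =
  (1 - t) * (1 - t^-1) * (u * (1 + (1 - u) ^+ 2 / (u * ((1 - t) * (1 - t^-1))))).
Proof.
move=> u0 t0; set c := _ * (1 - _) => c0.
have -> : c * (u * (1 + (1 - u) ^+ 2 / (u * c))) = u * c + (1 - u) ^+ 2.
  by field; rewrite u0 c0.
by rewrite /c; field.
Qed.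

Section SineProduct.
Variable R : realType.
Local Notation C := R[i].

Definition zeta (n : nat) : C := ee n%:R^-1.

Lemma zeta_expn n : (0 < n)%N -> zeta n ^+ n = 1.
Proof. by move=> n0; rewrite -ee_natl mulfV ?ee1 // pnatr_eq0 -lt0n. Qed.

Lemma zetaX_E n j : zeta n ^+ j = ee (j%:R / n%:R : R)%:C%C.
Proof. by rewrite -ee_natl rmorphM fmorphV !rmorph_nat. Qed.

Lemma cmod_1Bzeta n j : (0 < n)%N -> (j.*2 <= n)%N ->
  j%:R / n%:R <= cmod (1 - zeta n ^+ j) :> R.
Proof.
move=> n0 jn; rewrite zetaX_E; apply: cmod_1Bee_ge.
have n0' : (0 : R) < n%:R by rewrite ltr0n.
rewrite divr_ge0 //= ler_pdivrMr // mulrC ler_pdivlMr // -natrM muln2 ler_nat.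
done.
Qed.

Lemma zeta_prim n : (0 < n)%N -> n.-primitive_root (zeta n).
Proof.
move=> n0; apply/andP; split=> //; apply/forallP => i; rewrite unity_rootE.
apply/eqP; apply/eqP/eqP => [h|->]; last exact: zeta_expn.
apply/eqP; rewrite eqn_leq ltn_ord /= leqNgt; apply/negP => lt.
have nR : (0 : R) < n%:R by rewrite ltr0n.
have [le|gt] := leqP i.+1.*2 n.
  have := cmod_1Bzeta n0 le; rewrite h subrr cmod0 leNgt => /negP; apply.
  by rewrite divr_gt0 ?ltr0n.
have le : ((n - i.+1).*2 <= n)%N by lia.
have := cmod_1Bzeta n0 le.
have -> : zeta n ^+ (n - i.+1) = 1.
  by have := zeta_expn n0; rewrite -[X in _ ^+ X](subnK (ltnW lt)) exprD h mulr1.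
rewrite subrr cmod0 leNgt => /negP; apply.
by rewrite divr_gt0 ?ltr0n // subn_gt0.
Qed.

(** N is odd, so the roots of unity other than 1 fall into k pairs of inverses. *)
Lemma prod_zeta k (N := k.*2.+1) :
  \prod_(0 <= j < k) (('X - (zeta N ^+ j.+1)%:P) * ('X - (zeta N ^- j.+1)%:P))
  = \sum_(i < N) 'X^i :> {poly C}.
Proof.
have n0 : (0 < N)%N by [].
have X1 : 'X - 1 != 0 :> {poly C} by rewrite -size_poly_gt0 size_XsubC.
apply: (mulfI X1); apply: etrans (subrX1 _ _).
apply: etrans (factor_Xn_sub_1 (zeta_prim n0)).
rewrite [RHS]big_ltn //= expr0 polyC1; congr (_ * _).
rewrite big_split /= [RHS](@big_cat_nat _ _ _ k.+1) //=; last by rewrite /N; lia.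
congr (_ * _); first by rewrite big_add1.
rewrite big_nat_rev /= (_ : k.+1 = 0 + k.+1)%N // big_addn /N.
rewrite (_ : k.*2.+1 - k.+1 = k)%N; last by lia.
rewrite big_nat [RHS]big_nat; apply: eq_bigr => i /andP[_ ik].
congr ('X - _%:P).
have z0 : zeta N != 0 by exact: ee_neq0.
have e : zeta N ^+ (0 + k - i.+1).+1 * zeta N ^+ (i + k.+1) = 1.
  by rewrite -exprD -(zeta_expn n0); congr (_ ^+ _); rewrite /N; lia.
apply: (mulfI (expf_neq0 (0 + k - i.+1).+1 z0)).
by rewrite e mulfV // expf_neq0.
Qed.

Lemma expN_sub1E k (N := k.*2.+1) (u : C) : u != 0 ->
  let c j := (1 - zeta N ^+ j.+1) * (1 - zeta N ^- j.+1) in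
  (forall j, (j < k)%N -> c j != 0) ->
  u ^+ N - 1 = N%:R * (u - 1) * u ^+ k *
     \prod_(0 <= j < k) (1 + (1 - u) ^+ 2 / (u * c j)).
Proof.
move=> u0 c c0; have H := prod_zeta k; rewrite -/N in H.
(* [prod_zeta] at X = 1, where the right-hand side has N terms equal to 1. *)
have pN : \prod_(0 <= j < k) c j = N%:R.
  move/(congr1 (horner^~ 1)): (H); rewrite horner_prod horner_sum.
  under [in RHS]eq_bigr do rewrite hornerXn expr1n.
  rewrite sumr_const card_ord => <-; apply: eq_bigr => j _.
  by rewrite hornerM !hornerXsubC.
rewrite subrX1 -pN.
move/(congr1 (horner^~ u)): H; rewrite horner_prod horner_sum.
under [in RHS]eq_bigr do rewrite hornerXn.
move=> <-; rewrite [X in _ = X * _ * _]mulrC -!mulrA; congr (_ * _).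
rewrite [u ^+ k](_ : _ = \prod_(0 <= j < k) u); last by rewrite big_const_nat subn0 iter_mulr_1.
rewrite -!big_split /= big_nat [RHS]big_nat; apply: eq_bigr => j /andP[_ jk].
rewrite hornerM !hornerXsubC; move: (c0 j jk); rewrite /c.
have z0 : zeta N ^+ j.+1 != 0 by rewrite expf_neq0 // ee_neq0.
exact: quadratic_pair.
Qed.

End SineProduct.

Section SineProductLimit.
Variable R : realType.
Local Notation C := R[i].
Implicit Types (z : C).

Lemma cv_ee_derive_odd z :
  cv (fun k => k.*2.+1%:R * (ee (z / k.*2.+1%:R) - 1)) (twopii R * z).
Proof.
apply: (@cv_sub _ (fun k => k.*2) (fun n => n.+1%:R * (ee (z / n.+1%:R) - 1))).
  by move=> n; rewrite -addnn leq_addr.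
exact: cv_ee_derive.
Qed.

Lemma cv_ee_div_odd z : cv (fun k => ee (z / k.*2.+1%:R)) 1.
Proof.
apply: (@cv_sub _ (fun k => k.*2) (fun n => ee (z / n.+1%:R))).
  by move=> n; rewrite -addnn leq_addr.
exact: cv_ee_div.
Qed.

Definition zeta_factor (k j : nat) : C :=
  (1 - zeta R k.*2.+1 ^+ j.+1) * (1 - zeta R k.*2.+1 ^- j.+1).

Lemma zeta_factor_ge (k j : nat) : (j < k)%N ->
  (j.+1%:R / k.*2.+1%:R) ^+ 2 <= cmod (zeta_factor k j).
Proof.
move=> jk; rewrite /zeta_factor cmodM.
set N := k.*2.+1; have h := @cmod_1Bzeta R N j.+1 isT.
have le : (j.+1.*2 <= N)%N by rewrite /N; lia.
set t := zeta R N ^+ j.+1 in h *.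
have t1 : cmod t = 1 by rewrite cmodX cmod_ee natrC -fmorphV /= mulr0 oppr0 expR0 expr1n.
have t0 : t != 0 by rewrite -cmod_eq0 t1 oner_eq0.
have -> : 1 - t^-1 = - (1 - t) / t by rewrite opprB mulrBl mulfV // mul1r.
rewrite cmodf_div cmodN t1 divr1 -expr2; apply: lerXn2r; rewrite ?nnegrE ?cmod_ge0 ?divr_ge0 //.
exact: h.
Qed.

Lemma zeta_factor_neq0 (k j : nat) : (j < k)%N -> zeta_factor k j != 0.
Proof.
move=> jk; rewrite -cmod_gt0; apply: lt_le_trans (zeta_factor_ge jk).
by rewrite exprn_gt0 // divr_gt0.
Qed.

Definition sine_factor z (k j : nat) : C :=
  (1 - ee (z / k.*2.+1%:R)) ^+ 2 / (ee (z / k.*2.+1%:R) * zeta_factor k j).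

Lemma sine_finite z k : ee z - 1 =
  k.*2.+1%:R * (ee (z / k.*2.+1%:R) - 1) * ee (z / k.*2.+1%:R) ^+ k *
  \prod_(0 <= j < k) (1 + sine_factor z k j).
Proof.
rewrite -(@expN_sub1E R k (ee (z / k.*2.+1%:R))) ?ee_neq0 //.
  by rewrite -ee_natl mulrCA divff ?mulr1.
by move=> j; exact: zeta_factor_neq0.
Qed.

(** With N = 2k + 1 and u = e(z/N), the factor is (N (u - 1))^2 u^-1 / (N^2 c). The numerator and
    u^-1 converge in k, hence are bounded, and N^2 |c| >= (j + 1)^2 by the chord estimate. *)
Lemma sine_factor_bound z : exists2 B : R, 0 < B &
  forall k j, (j < k)%N -> cmod (sine_factor z k j) <= B / j.+1%:R ^+ 2.
Proof.
have [B1 B10 h1] := cv_bounded (cv_ee_derive_odd z).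
have [B2 B20 h2] := cv_bounded (cv_ee_div_odd (- z)).
exists (B1 ^+ 2 * B2); first by rewrite mulr_gt0 // exprn_gt0.
move=> k j jk; rewrite /sine_factor.
have n0 : (0 : R) < k.*2.+1%:R by [].
have := h1 k; have := h2 k; rewrite mulNr eeN cmodV cmodM cmod_nat => g2 g1.
have := zeta_factor_ge jk.
set N : R := k.*2.+1%:R in n0 g1 *.
rewrite cmodf_div cmodX cmodM cmodB.
have u0 : 0 < cmod (ee (z / k.*2.+1%:R)) by rewrite cmod_gt0 ee_neq0.
move: u0 g1 g2; set u := cmod (ee _); set v := cmod (_ - 1); set c := cmod (zeta_factor _ _).
move=> u0 g1 g2 gc; have j0 : (0 : R) < j.+1%:R by [].
have c0 : 0 < c by apply: lt_le_trans gc; rewrite exprn_gt0 // divr_gt0.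
have v0 : 0 <= v by exact: cmod_ge0.
move: j0 gc; set J : R := j.+1%:R => j0 gc.
have -> : v ^+ 2 / (u * c) = (N * v) ^+ 2 * (u^-1) * (N ^+ 2 * c)^-1.
  by field; apply/and3P; split; lra.
have hc : (N ^+ 2 * c)^-1 <= (J ^+ 2)^-1.
  rewrite lef_pV2 ?posrE ?mulr_gt0 ?exprn_gt0 //.
  by move: gc; rewrite expr_div_n ler_pdivrMr ?exprn_gt0 // mulrC.
have v2 : 0 <= (N * v) ^+ 2 by exact: sqr_ge0.
have ui : 0 <= u^-1 by rewrite invr_ge0 ltW.
apply: ler_pM => //; first exact: mulr_ge0.
  by rewrite invr_ge0 mulr_ge0 ?sqr_ge0 // ltW.
apply: ler_pM => //.
by apply: lerXn2r; rewrite ?nnegrE ?mulr_ge0 // ltW.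
Qed.

Lemma cv_sine_factor z j : cv (fun k => sine_factor z k j) (- (z / j.+1%:R) ^+ 2).
Proof.
have J0 : (j.+1%:R : C) != 0 by rewrite pnatr_eq0.
have T0 := twopii_neq0 R.
(* The limit in the form in which it arises: N (u - 1) tends to T z, and N times the two factors of
   [zeta_factor], up to a common sign, to T (j + 1) and -T (j + 1), where T is [twopii]. *)
have e : - (z / j.+1%:R) ^+ 2 =
  (twopii R * z) ^+ 2 / (1 * ((twopii R * j.+1%:R) * (twopii R * - j.+1%:R))).
  by rewrite mul1r; move: J0 T0; move: (twopii R) (j.+1%:R : C) => t J J0 T0; field; rewrite J0 T0.
rewrite e.
apply: (@eq_cv _ (fun k => (k.*2.+1%:R * (ee (z / k.*2.+1%:R) - 1)) ^+ 2 /
   (ee (z / k.*2.+1%:R) * ((k.*2.+1%:R * (ee (j.+1%:R / k.*2.+1%:R) - 1)) *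
     (k.*2.+1%:R * (ee ((- j.+1%:R) / k.*2.+1%:R) - 1)))))).
  move=> k; rewrite /sine_factor /zeta_factor mulNr eeN.
  have -> : ee (j.+1%:R / k.*2.+1%:R) = zeta R k.*2.+1 ^+ j.+1 by rewrite -ee_natl.
  have N0 : (k.*2.+1%:R : C) != 0 by rewrite pnatr_eq0.
  set t := _ ^+ j.+1; set u := ee (z / _); set N : C := k.*2.+1%:R in N0 *.
  have -> : (N * (u - 1)) ^+ 2 = N ^+ 2 * (1 - u) ^+ 2 by ring.
  have -> : u * (N * (t - 1) * (N * (t^-1 - 1))) = N ^+ 2 * (u * ((1 - t) * (1 - t^-1))) by ring.
  by rewrite -mulf_div divff ?mul1r // expf_neq0.
apply: cv_div.
- by rewrite mul1r; apply: mulf_neq0; apply: mulf_neq0 => //; rewrite oppr_eq0.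
- by apply: cvX; exact: cv_ee_derive_odd.
- apply: cvM; first exact: cv_ee_div_odd.
  by apply: cvM; exact: cv_ee_derive_odd.
Qed.

Lemma cv_sine_prefactor z :
  cv (fun k => k.*2.+1%:R * (ee (z / k.*2.+1%:R) - 1) * ee (z / k.*2.+1%:R) ^+ k)
     (twopii R * z * ee (z / 2)).
Proof.
apply: cvM; first exact: cv_ee_derive_odd.
apply: (@eq_cv _ (fun k => ee (z / 2) * ee (- (z / 2) / k.*2.+1%:R))).
  move=> k; rewrite -eeD -ee_natl; congr ee.
  have N0 : (k.*2.+1%:R : C) != 0 by rewrite pnatr_eq0.
  move: N0; rewrite -addn1 natrD -mul2n natrM; move: (k%:R : C) => K N0.
  by field.
by rewrite -[X in cv _ X]mulr1; apply: cvM; [exact: cv_cst | exact: cv_ee_div_odd].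
Qed.

(* Tannery: the tails of the finite products are bounded uniformly in k. *)
Lemma cv_sine_product z :
  cv (fun K => twopii R * z * ee (z / 2) *
     \prod_(0 <= j < K) (1 - (z / j.+1%:R) ^+ 2)) (ee z - 1).
Proof.
have [B B0 hB] := sine_factor_bound z.
have [A A0 hA] := cv_bounded (cv_sine_prefactor z).
pose M := A * expR (B * 2) * (B * expR B).
have M0 : 0 < M by rewrite !mulr_gt0 ?expR_gt0.
have key K : cmod (ee z - 1 - twopii R * z * ee (z / 2) *
     \prod_(0 <= j < K.+1) (1 - (z / j.+1%:R) ^+ 2)) <= M / K.+1%:R.
  pose Pk k := k.*2.+1%:R * (ee (z / k.*2.+1%:R) - 1) * ee (z / k.*2.+1%:R) ^+ k *
     \prod_(0 <= j < K.+1) (1 + sine_factor z k j).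
  apply: (@cv_le _ (fun k => ee z - 1 - Pk k) _ _ K.+1).
    apply: cvB; first exact: cv_cst.
    apply: cvM; first exact: cv_sine_prefactor.
    apply: cv_prod => j; apply: cvD; first exact: cv_cst.
    exact: cv_sine_factor.
  move=> k Kk; rewrite (sine_finite z k) (@big_cat_nat _ _ _ K.+1) //=.
  rewrite mulrA -/(Pk k) -[X in _ - X]mulr1 -mulrBr cmodM.
  have h1 : cmod (Pk k) <= A * expR (B * 2).
    rewrite /Pk cmodM; apply: ler_pM; rewrite ?cmod_ge0 //.
    apply: (le_trans (cmod_prod1D _ _ _)); rewrite ler_expR.
    apply: (@le_trans _ _ (B * \sum_(0 <= j < K.+1) (j.+1%:R ^+ 2)^-1)).
      rewrite mulr_sumr big_nat [leRHS]big_nat; apply: ler_sum => j /andP[_ jK].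
      by apply: hB; exact: leq_trans jK Kk.
    by rewrite ler_wpM2l ?sum_invsq_le2 // ltW.
  have h2 : \sum_(K.+1 <= j < k) cmod (sine_factor z k j) <= B / K.+1%:R.
    apply: (@le_trans _ _ (B * \sum_(K.+1 <= j < k) (j.+1%:R ^+ 2)^-1)).
      rewrite mulr_sumr big_nat [leRHS]big_nat; apply: ler_sum => j /andP[_ jK].
      exact: hB.
    by rewrite ler_wpM2l ?sum_invsq_le // ltW.
  rewrite /M -[leRHS]mulrA; apply: ler_pM; rewrite ?cmod_ge0 //.
  apply: (le_trans (cmod_prod1D_sub1_le h2)).
  rewrite mulrAC -mulrA mulrC mulrAC; apply: ler_wpM2r; first by rewrite invr_ge0.
  rewrite mulrC; apply: ler_wpM2l; first exact: ltW.
  by rewrite ler_expR ler_pdivrMr // ler_peMr ?ler1n // ltW.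
move=> e e0; exists (Num.truncn (M / e)).+2 => -[//|K] hK.
rewrite cmodB; apply: (le_lt_trans (key K)).
rewrite ltr_pdivrMr // mulrC -ltr_pdivrMr //.
apply: (lt_trans (truncnS_gt _)); rewrite ltr_nat; exact: hK.
Qed.

End SineProductLimit.

(** * Power series with algebraic integer coefficients *)

Section DiscFunctions.
Variable R : realType.
Local Notation C := R[i].
Implicit Types (F G : C -> C) (P Q : {poly C}) (t w : C) (r : R).

Lemma ler_cmod_horner P t r : cmod t <= r ->
  cmod P.[t] <= \sum_(i < size P) cmod P`_i * r ^+ i.
Proof.
move=> tr; rewrite horner_coef; apply: (le_trans (cmod_sum _ _ _)).
apply: ler_sum => i _; rewrite cmodM cmodX ler_wpM2l ?cmod_ge0 //.
by apply: lerXn2r; rewrite ?nnegrE ?cmod_ge0 // (le_trans (cmod_ge0 t)).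
Qed.

(** Plays the part of holomorphy on the open unit disc, as approximability by polynomials uniformly
    on smaller discs. *)
Definition disc_hol F := forall r, r < 1 -> forall e : R, 0 < e ->
  exists P, forall t, cmod t <= r -> cmod (F t - P.[t]) <= e.

Lemma disc_hol_bounded F r : disc_hol F -> r < 1 ->
  exists2 B : R, 0 < B & forall t, cmod t <= r -> cmod (F t) <= B.
Proof.
move=> hF r1; have [P hP] := hF _ r1 _ ltr01.
pose S := \sum_(i < size P) cmod P`_i * `|r| ^+ i.
have S0 : 0 <= S by apply: sumr_ge0 => i _; rewrite mulr_ge0 ?cmod_ge0 ?exprn_ge0.
exists (1 + S) => [|t tr]; first lra.
have tr' : cmod t <= `|r| by apply: le_trans tr (ler_norm _).
have := ler_cmod_horner P tr'; rewrite -/S.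
have := hP _ tr; have := ler_cmodD (F t - P.[t]) P.[t]; rewrite subrK; lra.
Qed.

Lemma disc_hol_uniform F :
  (forall r, r < 1 -> forall e : R, 0 < e -> exists2 G, disc_hol G &
     forall t, cmod t <= r -> cmod (F t - G t) <= e) -> disc_hol F.
Proof.
move=> h r r1 e e0; have e2 : 0 < e / 2 by lra.
have [G hG gF] := h _ r1 _ e2; have [P hP] := hG _ r1 _ e2.
exists P => t tr; have := gF _ tr; have := hP _ tr.
have := ler_cmodD (F t - G t) (G t - P.[t]); rewrite addrA subrK; lra.
Qed.

Lemma eq_disc_hol F G : (forall t, cmod t < 1 -> F t = G t) -> disc_hol F -> disc_hol G.
Proof.
move=> FG hF; apply: disc_hol_uniform => r r1 e e0; exists F => // t tr.
by rewrite FG ?subrr ?cmod0 ?ltW // (le_lt_trans tr).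
Qed.

Lemma disc_hol_poly P : disc_hol (horner P).
Proof. by move=> r _ e e0; exists P => t _; rewrite subrr cmod0 ltW. Qed.

Lemma disc_hol_cst a : disc_hol (fun=> a).
Proof.
by apply: (eq_disc_hol (F := horner a%:P)); [move=> t _; rewrite hornerC | exact: disc_hol_poly].
Qed.

Lemma disc_holX n : disc_hol (fun t => t ^+ n).
Proof.
by apply: (eq_disc_hol (F := horner 'X^n)); [move=> t _; rewrite hornerXn | exact: disc_hol_poly].
Qed.

Lemma disc_holD F G : disc_hol F -> disc_hol G -> disc_hol (fun t => F t + G t).
Proof.
move=> hF hG r r1 e e0; have e2 : 0 < e / 2 by lra.
have [P hP] := hF _ r1 _ e2; have [Q hQ] := hG _ r1 _ e2.
exists (P + Q) => t tr; have := hP _ tr; have := hQ _ tr.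
rewrite hornerD opprD addrACA.
have := ler_cmodD (F t - P.[t]) (G t - Q.[t]); lra.
Qed.

Lemma disc_holM F G : disc_hol F -> disc_hol G -> disc_hol (fun t => F t * G t).
Proof.
move=> hF hG r r1 e e0.
have [A A0 hA] := disc_hol_bounded hF r1.
have [B B0 hB] := disc_hol_bounded hG r1.
have e1 : 0 < Num.min 1 (e / (A + B + 1)) by rewrite lt_min ltr01 divr_gt0 //; lra.
have [P hP] := hF _ r1 _ e1; have [Q hQ] := hG _ r1 _ e1.
exists (P * Q) => t tr; have := hP _ tr; have := hQ _ tr.
set d := Num.min _ _ in e1 *.
have d1 : d <= 1 by rewrite /d ge_min lexx.
have de : d * (A + B + 1) <= e.
  by rewrite -ler_pdivlMr ?/d ?ge_min ?lexx ?orbT //; lra.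
rewrite hornerM.
have -> : F t * G t - P.[t] * Q.[t] = (F t - P.[t]) * G t + P.[t] * (G t - Q.[t]).
  by ring.
have := hA _ tr; have := hB _ tr.
have hPt : cmod P.[t] <= cmod (F t) + cmod (F t - P.[t]).
  by rewrite cmodB -[X in cmod X](subrK (F t)) addrC ler_cmodD.
have := ler_cmodD ((F t - P.[t]) * G t) (P.[t] * (G t - Q.[t])).
rewrite !cmodM.
have := cmod_ge0 (F t - P.[t]); have := cmod_ge0 (G t - Q.[t]).
have := cmod_ge0 P.[t]; have := cmod_ge0 (G t).
move: (cmod (F t - P.[t])) (cmod (G t - Q.[t])) (cmod P.[t]) (cmod (G t)) (cmod (F t)) hPt.
move=> x y p g f hp g0 p0 y0 x0 le gB fA yd xd.
have h1 : x * g <= d * B by apply: ler_pM.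
have h2 : p * y <= (A + 1) * d by apply: ler_pM => //; lra.
lra.
Qed.

Lemma disc_hol_expn F n : disc_hol F -> disc_hol (fun t => F t ^+ n).
Proof.
move=> hF; elim: n => [|n IH].
  by apply: (eq_disc_hol (F := fun=> 1)) => //; exact: disc_hol_cst.
apply: (eq_disc_hol (F := fun t => F t * F t ^+ n)); last exact: disc_holM.
by move=> t _; rewrite exprS.
Qed.

Lemma disc_hol_sum I (s : seq I) (F : I -> C -> C) :
  (forall i, disc_hol (F i)) -> disc_hol (fun t => \sum_(i <- s) F i t).
Proof.
move=> hF; elim: s => [|i s IH].
  apply: (eq_disc_hol (F := fun=> 0)); last exact: disc_hol_cst.
  by move=> t _; rewrite big_nil.
apply: (eq_disc_hol (F := fun t => F i t + \sum_(j <- s) F j t)); last exact: disc_holD.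
by move=> t _; rewrite big_cons.
Qed.

Lemma disc_hol_prod I (s : seq I) (F : I -> C -> C) :
  (forall i, disc_hol (F i)) -> disc_hol (fun t => \prod_(i <- s) F i t).
Proof.
move=> hF; elim: s => [|i s IH].
  apply: (eq_disc_hol (F := fun=> 1)); last exact: disc_hol_cst.
  by move=> t _; rewrite big_nil.
apply: (eq_disc_hol (F := fun t => F i t * \prod_(j <- s) F j t)); last exact: disc_holM.
by move=> t _; rewrite big_cons.
Qed.

Lemma cmod_monomial_le (c t : C) m r : cmod c = 1 -> (0 < m)%N -> r < 1 ->
  cmod t <= r -> cmod (c * t ^+ m) <= r.
Proof.
move=> c1 m0 r1 tr; rewrite cmodM c1 mul1r cmodX.
apply: (le_trans _ tr); rewrite -[leRHS]expr1; apply: ler_wiXn2l => //.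
  exact: cmod_ge0.
exact: ltW (le_lt_trans tr r1).
Qed.

Lemma disc_hol_comp F (c : C) m : cmod c = 1 -> (0 < m)%N ->
  disc_hol F -> disc_hol (fun t => F (c * t ^+ m)).
Proof.
move=> c1 m0 hF r r1 e e0; have [P hP] := hF _ r1 _ e0.
exists (P \Po (c%:P * 'X^m)) => t tr.
rewrite horner_comp hornerM hornerC hornerXn; apply: hP.
exact: cmod_monomial_le.
Qed.

(** Cauchy's estimate with a finite average instead of an integral: samples at rho times the n-th
    roots of unity, with n above both the degree and k, isolate one coefficient exactly. *)
Lemma cmod_coef_le P (rho B : R) k : 0 < rho ->
  (forall w, cmod w = rho -> cmod P.[w] <= B) -> cmod P`_k * rho ^+ k <= B.
Proof.
move=> rho0 hB; pose n := (maxn (size P) k).+1.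
have n0 : (0 < n)%N by [].
have kn : (k < n)%N by rewrite ltnS leq_maxr.
have zp := zeta_prim R n0.
set z := zeta R n in zp.
have z0 : z != 0 by exact: ee_neq0.
have cz : cmod z = 1.
  by rewrite /z /zeta cmod_ee natrC -fmorphV /= mulr0 oppr0 expR0.
pose x := rho%:C%C.
have cx j : cmod (x * z ^+ j) = rho by rewrite cmodM cmodX cz expr1n mulr1 cmod_real ger0_norm ?ltW.
have E : \sum_(j < n) P.[x * z ^+ j] * z ^- (j * k) = n%:R * (P`_k * x ^+ k).
  transitivity (\sum_(j < n) \sum_(i < n) P`_i * x ^+ i * (z ^+ i / z ^+ k) ^+ j).
    apply: eq_bigr => j _; rewrite (@horner_coef_wide _ n) ?mulr_suml; last first.
      by rewrite /n ltnW // ltnS leq_maxl.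
    apply: eq_bigr => i _; rewrite exprMn expr_div_n -!exprM [(j * i)%N]mulnC [(j * k)%N]mulnC.
    by rewrite !mulrA.
  rewrite exchange_big /= (bigD1 (Ordinal kn)) //= [X in _ + X]big1 ?addr0; last first.
    move=> i ik; rewrite -mulr_sumr; set y := _ / _.
    have y1 : y - 1 != 0.
      rewrite subr_eq0; apply: contra ik => /eqP e.
      have : z ^+ i == z ^+ k.
        by rewrite -(divfK (expf_neq0 k z0) (z ^+ i)) -/y e mul1r.
      rewrite (eq_prim_root_expr zp) !modn_small ?ltn_ord // => /eqP ki.
    have : (y - 1) * (\sum_(j < n) y ^+ j) = 0.
      rewrite -subrX1 /y expr_div_n -!exprM ![(_ * n)%N]mulnC !exprM.
      by rewrite (prim_expr_order zp) !expr1n divr1 subrr.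
    by move/eqP; rewrite mulf_eq0 (negbTE y1) => /eqP ->; rewrite mulr0.
  rewrite -mulr_sumr divff ?expf_neq0 // (eq_bigr (fun=> 1)); last by move=> j _; rewrite expr1n.
  by rewrite sumr_const card_ord mulrC.
have := cmod_sum (index_enum 'I_n) predT (fun j : 'I_n => P.[x * z ^+ j] * z ^- (j * k)).
rewrite E !cmodM cmod_nat cmodX cmod_real (ger0_norm (ltW rho0)) => le.
have nR : (0 : R) < n%:R by [].
rewrite -(ler_pM2l nR); apply: (le_trans le).
have -> : n%:R * B = \sum_(j < n) B by rewrite sumr_const card_ord mulr_natl.
apply: ler_sum => j _; rewrite cmodM cmodV cmodX cz expr1n invr1 mulr1.
by apply: hB.
Qed.

(* Maximum principle, from a crude Cauchy estimate applied to all powers of F. *)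
Lemma disc_hol_max F (rho B : R) : disc_hol F -> 0 < rho < 1 ->
  (forall w, cmod w = rho -> cmod (F w) <= B) ->
  forall t, cmod t < rho -> cmod (F t) <= B.
Proof.
move=> hF /andP[rho0 rho1] hB t trho.
pose q := cmod t / rho.
have q0 : 0 <= q by rewrite divr_ge0 ?cmod_ge0 // ltW.
have q1 : q < 1 by rewrite ltr_pdivrMr // mul1r.
pose c := (1 - q)^-1.
have c0 : 0 < c by rewrite invr_gt0; lra.
have crude G b : disc_hol G -> (forall w, cmod w = rho -> cmod (G w) <= b) ->
    cmod (G t) <= b * c.
  move=> hG hb; apply/ler_addgt0Pr => e e0.
  have e1 : 0 < e / (1 + c) by rewrite divr_gt0 //; lra.
  have [P hP] := hG _ rho1 _ e1; set d := e / (1 + c) in e1 hP.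
  have hPc w : cmod w = rho -> cmod P.[w] <= b + d.
    move=> wr; have := hP w; rewrite wr lexx => /(_ isT).
    have := hb _ wr; have := ler_cmodB (G w) (G w - P.[w]).
    by rewrite opprB addrC subrK; lra.
  have b0 : 0 <= b + d.
    have := hPc rho%:C%C; rewrite cmod_real gtr0_norm // => /(_ erefl).
    by apply: le_trans (cmod_ge0 _).
  have hPt : cmod P.[t] <= (b + d) * c.
    apply: (le_trans (ler_cmod_horner P (lexx (cmod t)))).
    apply: (@le_trans _ _ (\sum_(i < size P) (b + d) * q ^+ i)).
      apply: ler_sum => i _; have -> : cmod t = rho * q by rewrite /q mulrCA mulfV ?mulr1 ?gt_eqF.
      rewrite exprMn mulrA ler_wpM2r ?exprn_ge0 //.
      exact: cmod_coef_le.
    rewrite -mulr_sumr ler_wpM2l // /c -[leRHS]mul1r ler_pdivlMr; last lra.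
    rewrite mulrC -opprB mulNr -subrX1 opprB gerBl exprn_ge0 //.
  have := hP t (ltW trho); have := ler_cmodD (G t - P.[t]) P.[t]; rewrite subrK.
  have -> : e = d * (1 + c) by rewrite /d divfK //; lra.
  lra.
rewrite leNgt; apply/negP => lt.
have B0 : 0 <= B.
  have := hB rho%:C%C; rewrite cmod_real gtr0_norm // => /(_ erefl).
  by apply: le_trans (cmod_ge0 _).
have pow k : cmod (F t) ^+ k <= B ^+ k * c.
  rewrite -cmodX; apply: (crude (fun t => F t ^+ k)); first exact: disc_hol_expn.
  move=> w wr; rewrite cmodX; apply: lerXn2r; rewrite ?nnegrE ?cmod_ge0 //.
  exact: hB.
have [B00|Bn0] := eqVneq B 0.
  by have := pow 1%N; rewrite !expr1 B00 mul0r leNgt -B00 lt.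
have Bp : 0 < B by rewrite lt_def Bn0 B0.
pose d := cmod (F t) / B - 1.
have d0 : 0 < d by rewrite subr_gt0 ltr_pdivlMr // mul1r.
have bern k : 1 + k%:R * d <= (1 + d) ^+ k.
  elim: k => [|k IH]; first by rewrite mul0r addr0 expr0.
  rewrite exprS -natr1.
  have : (1 + d) * (1 + k%:R * d) <= (1 + d) * (1 + d) ^+ k by rewrite ler_wpM2l //; lra.
  have : 0 <= k%:R * (d * d) by rewrite mulr_ge0 // mulr_ge0 // ltW.
  lra.
have [k hk] : exists k : nat, c / d < k%:R.
  by exists (Num.truncn (c / d)).+1; rewrite truncnS_gt.
have := pow k; have := bern k.
have -> : cmod (F t) = B * (1 + d) by rewrite /d addrC subrK mulrC divfK.
rewrite exprMn ler_pM2l ?exprn_gt0 // => h1 h2.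
move: hk; rewrite ltr_pdivrMr //; lra.
Qed.

End DiscFunctions.

Section DiscSeries.
Variable R : realType.
Local Notation C := R[i].
Implicit Types (F G : C -> C) (P Q : {poly C}) (t : C) (r : R).

Lemma expr_small r e : 0 <= r < 1 -> 0 < e -> exists m, forall n, (m <= n)%N -> r ^+ n < e.
Proof.
move=> /andP[r0 r1] e0.
have h : ((fun n => r ^+ n) @ \oo --> 0)%classic by apply: cvg_expr; rewrite ger0_norm.
move/cvgrPdist_lt: h => /(_ e e0)[m _ h]; exists m => n /h /=.
by rewrite sub0r normrN ger0_norm // exprn_ge0.
Qed.

Lemma sum_expr_le r m n : 0 <= r < 1 -> \sum_(m <= j < n) r ^+ j <= r ^+ m / (1 - r).
Proof.
move=> /andP[r0 r1]; have r2 : 0 < 1 - r by lra.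
have [nm|/ltnW mn] := leqP n m.
  by rewrite big_geq // divr_ge0 ?exprn_ge0 // ltW.
rewrite ler_pdivlMr // mulr_suml (eq_bigr (fun j => - (r ^+ j.+1 - r ^+ j))); last first.
  by move=> j _; rewrite exprS; ring.
by rewrite sumrN telescope_sumr // opprB gerBl exprn_ge0.
Qed.

Definition uniformly_bounded (e : nat -> C -> C) := forall r, 0 <= r < 1 ->
  exists2 B : R, 0 < B & forall j t, cmod t <= r -> cmod (e j t) <= B.

Lemma disc_series (e : nat -> C -> C) :
  (forall j, disc_hol (e j)) -> uniformly_bounded e ->
  exists2 G, disc_hol G & forall t, cmod t < 1 ->
    cv (fun n => \sum_(0 <= j < n) t ^+ j.+1 * e j t) (G t).
Proof.
move=> hol bnd.
pose S n t := \sum_(0 <= j < n) t ^+ j.+1 * e j t.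
have tail r B m n t : 0 <= r < 1 -> 0 < B -> (forall j t, cmod t <= r -> cmod (e j t) <= B) ->
    (m <= n)%N -> cmod t <= r -> cmod (S n t - S m t) <= r ^+ m * (B / (1 - r)).
  move=> r01 B0 hB mn tr; rewrite /S (@big_cat_nat _ _ _ m) //= addrAC subrr add0r.
  apply: (le_trans (cmod_sum _ _ _)).
  apply: (@le_trans _ _ (\sum_(m <= j < n) B * r ^+ j)).
    apply: ler_sum => j _; rewrite cmodM mulrC; apply: ler_pM; rewrite ?cmod_ge0 //.
      exact: hB.
    case/andP: r01 => r0 r1.
    rewrite cmodX exprS -[leRHS]mul1r; apply: ler_pM; rewrite ?exprn_ge0 ?cmod_ge0 //.
      by apply: le_trans tr (ltW r1).
    by apply: lerXn2r; rewrite ?nnegrE ?cmod_ge0.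
  rewrite -mulr_sumr mulrCA; apply: ler_wpM2l; first exact: ltW.
  exact: sum_expr_le.
have small r B d : 0 <= r < 1 -> 0 < B -> 0 < d ->
    exists m, forall n, (m <= n)%N -> r ^+ n * (B / (1 - r)) <= d.
  move=> r01 B0 d0; have r2 : 0 < 1 - r by case/andP: r01 => *; lra.
  have Br : 0 < B / (1 - r) by rewrite divr_gt0.
  have [m hm] := expr_small r01 (divr_gt0 d0 Br).
  by exists m => n /hm /ltW; rewrite ler_pdivlMr.
have /choice[G hG] : forall t, exists l, cmod t < 1 -> cv (S^~ t) l.
  move=> t; have [t1|t1] := ltP (cmod t) 1; last by exists 0.
  have t01 : 0 <= cmod t < 1 by rewrite cmod_ge0.
  have [B B0 hB] := bnd _ t01.
  have [|l hl] := @cauchy_cv _ (S^~ t); last by exists l.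
  move=> d d0; have [m hm] := small _ _ _ t01 B0 d0.
  by exists m => k n mk kn; apply: (le_trans (tail _ _ _ _ _ t01 B0 hB kn (lexx _))); exact: hm.
exists G => //; apply: disc_hol_uniform => r r1 d d0.
have r01 : 0 <= `|r| < 1 \/ r < 0.
  by have [r0|r0] := leP 0 r; [left; rewrite ger0_norm ?r0 | right].
case: r01 => [r01|rn]; last first.
  exists (fun=> 0); first exact: disc_hol_cst.
  by move=> t tr; have := le_trans (cmod_ge0 t) tr; rewrite leNgt rn.
have [B B0 hB] := bnd _ r01; have [m hm] := small _ _ _ r01 B0 d0.
exists (S m).
  apply: disc_hol_sum => j; apply: disc_holM => //; exact: disc_holX.
move=> t tr.
have tr' : cmod t <= `|r| by apply: le_trans tr (ler_norm _).
have t1 : cmod t < 1 by case/andP: r01 => _; apply: le_lt_trans.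
apply: (@cv_le _ (fun n => S n t - S m t) _ _ m).
  apply: cvB; [exact: hG | exact: cv_cst].
move=> n mn; apply: (le_trans (tail _ _ _ _ _ r01 B0 hB mn tr')).
exact: hm.
Qed.

(* Functions on the open unit disc whose Taylor coefficients at 0 are algebraic integers. *)
Definition int_series F := forall K, exists P G,
  [/\ P \is a polyOver (@algint C), disc_hol G
    & forall t, cmod t < 1 -> F t = P.[t] + t ^+ K * G t].

Lemma int_series_hol F : int_series F -> disc_hol F.
Proof.
move=> /(_ 0)[P [G [_ hG e]]].
apply: (eq_disc_hol (F := fun t => P.[t] + G t)).
  by move=> t /e ->; rewrite expr0 mul1r.
by apply: disc_holD => //; exact: disc_hol_poly.
Qed.

Lemma eq_int_series F G : (forall t, cmod t < 1 -> F t = G t) -> int_series F -> int_series G.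
Proof.
move=> FG hF K; have [P [H [iP hH e]]] := hF K.
by exists P, H; split=> // t t1; rewrite -FG ?e.
Qed.

Lemma int_series_poly P : P \is a polyOver (@algint C) -> int_series (horner P).
Proof.
move=> iP K; exists P, (fun=> 0); split=> //; first exact: disc_hol_cst.
by move=> t _; rewrite mulr0 addr0.
Qed.

Lemma int_series_cst a : a \in @algint C -> int_series (fun=> a).
Proof.
move=> ia; apply: (eq_int_series (F := horner a%:P)); first by move=> t _; rewrite hornerC.
by apply: int_series_poly; rewrite polyOverC.
Qed.

Lemma int_seriesX n : int_series (fun t => t ^+ n).
Proof.
apply: (eq_int_series (F := horner 'X^n)); first by move=> t _; rewrite hornerXn.
by apply: int_series_poly; rewrite rpredX // polyOverX.
Qed.

Lemma int_seriesD F G : int_series F -> int_series G -> int_series (fun t => F t + G t).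
Proof.
move=> hF hG K; have [P [F' [iP hF' eF]]] := hF K; have [Q [G' [iQ hG' eG]]] := hG K.
exists (P + Q), (fun t => F' t + G' t); split; first exact: rpredD.
  exact: disc_holD.
by move=> t t1; rewrite eF // eG // hornerD; ring.
Qed.

Lemma int_seriesM F G : int_series F -> int_series G -> int_series (fun t => F t * G t).
Proof.
move=> hF hG K; have [P [F' [iP hF' eF]]] := hF K; have [Q [G' [iQ hG' eG]]] := hG K.
exists (P * Q), (fun t => P.[t] * G' t + F' t * G t); split; first exact: rpredM.
  apply: disc_holD; apply: disc_holM => //; first exact: disc_hol_poly.
  exact: int_series_hol.
by move=> t t1; rewrite eF // {1}eG // hornerM [G t]eG //; ring.
Qed.

Lemma int_series_scale a F : a \in @algint C -> int_series F -> int_series (fun t => a * F t).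
Proof. by move=> ia; apply: int_seriesM; exact: int_series_cst. Qed.

Lemma int_series_expn F n : int_series F -> int_series (fun t => F t ^+ n).
Proof.
move=> hF; elim: n => [|n IH].
  by apply: (eq_int_series (F := fun=> 1)) => //; apply: int_series_cst; exact: rpred1.
apply: (eq_int_series (F := fun t => F t * F t ^+ n)); last exact: int_seriesM.
by move=> t _; rewrite exprS.
Qed.

Lemma int_series_prod I (s : seq I) (F : I -> C -> C) :
  (forall i, int_series (F i)) -> int_series (fun t => \prod_(i <- s) F i t).
Proof.
move=> hF; elim: s => [|i s IH].
  apply: (eq_int_series (F := fun=> 1)); last by apply: int_series_cst; exact: rpred1.
  by move=> t _; rewrite big_nil.
apply: (eq_int_series (F := fun t => F i t * \prod_(j <- s) F j t)); last exact: int_seriesM.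
by move=> t _; rewrite big_cons.
Qed.

Lemma int_series_comp F (c : C) m : c \in @algint C -> cmod c = 1 -> (0 < m)%N ->
  int_series F -> int_series (fun t => F (c * t ^+ m)).
Proof.
move=> ic c1 m0 hF K; have [P [G [iP hG e]]] := hF K.
exists (P \Po (c%:P * 'X^m)), (fun t => c ^+ K * t ^+ ((m.-1) * K) * G (c * t ^+ m)); split.
- apply: polyOver_comp => //; apply: rpredM; first by rewrite polyOverC.
  by apply: rpredX; exact: polyOverX.
- apply: disc_holM; last exact: disc_hol_comp.
  apply: disc_holM; [exact: disc_hol_cst | exact: disc_holX].
- move=> t t1; rewrite horner_comp hornerM hornerC hornerXn e.
    congr (_ + _); rewrite [RHS]mulrA; congr (_ * _).
    rewrite exprMn -exprM mulrCA -exprD; congr (_ * _ ^+ _).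
    by case: (m) m0 => //= m' _; rewrite mulSn.
  exact: le_lt_trans (cmod_monomial_le c1 m0 t1 (lexx _)) t1.
Qed.

Lemma disc_hol_cont0 F e : disc_hol F -> 0 < e -> exists2 d : R, 0 < d < 1 &
  forall t, cmod t <= d -> cmod (F t - F 0) <= e.
Proof.
move=> hF e0; have e3 : 0 < e / 3 by lra.
have h1 : (2^-1 : R) < 1 by lra.
have [P hP] := hF _ h1 _ e3.
pose S := \sum_(i < size P) cmod P`_i.
have S0 : 0 <= S by apply: sumr_ge0 => i _; rewrite cmod_ge0.
exists (Num.min 2^-1 (e / 3 / (S + 1))).
  rewrite lt_min gt_min h1 /= andbT invr_gt0 ltr0n /= divr_gt0 //; lra.
move=> t; rewrite le_min => /andP[t2 tS].
have P0 : cmod (P.[t] - P.[0]) <= e / 3.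
  have -> : P.[t] - P.[0] = \sum_(i < size P) P`_i * (t ^+ i - 0 ^+ i).
    by rewrite !horner_coef -sumrB; apply: eq_bigr => i _; rewrite mulrBr.
  apply: (le_trans (cmod_sum _ _ _)).
  apply: (@le_trans _ _ (\sum_(i < size P) cmod P`_i * cmod t)).
    apply: ler_sum => -[[|i] ?] _ /=; rewrite cmodM ler_wpM2l ?cmod_ge0 //.
      by rewrite subrr cmod0 cmod_ge0.
    rewrite expr0n subr0 cmodX exprS -[leRHS]mulr1 ler_wpM2l ?cmod_ge0 //.
    by rewrite exprn_ile1 ?cmod_ge0 //; lra.
  rewrite -mulr_suml -/S.
  move: tS; rewrite ler_pdivlMr; last lra.
  have := cmod_ge0 t; move: (cmod t) => x; nra.
have := hP _ t2; have := hP 0; rewrite cmod0 invr_ge0 ler0n => /(_ isT).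
have := ler_cmodD (F t - P.[t]) ((P.[t] - P.[0]) + (P.[0] - F 0)).
have := ler_cmodD (P.[t] - P.[0]) (P.[0] - F 0).
have -> : F t - P.[t] + (P.[t] - P.[0] + (P.[0] - F 0)) = F t - F 0 by ring.
rewrite (cmodB P.[0]); lra.
Qed.

(** Continuity at 0. The parameter t = e(z/N) never vanishes and division by t fails at 0, so
    identities obtained in either way are extended to 0 through this lemma. *)
Lemma disc_hol_eq0 F G : disc_hol F -> disc_hol G ->
  (forall t, 0 < cmod t < 1 -> F t = G t) -> F 0 = G 0.
Proof.
move=> hF hG e; apply/eqP; rewrite -subr_eq0 -cmod_eq0 eq_le cmod_ge0 andbT.
apply/ler_addgt0Pr => d d0; rewrite add0r.
have d2 : 0 < d / 2 by lra.
have [a a01 ha] := disc_hol_cont0 hF d2; have [b b01 hb] := disc_hol_cont0 hG d2.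
pose x := Num.min a b.
have x0 : 0 < x by rewrite lt_min; case/andP: a01 => ->; case/andP: b01 => ->.
have x1 : x < 1 by rewrite gt_min; case/andP: a01 => _ ->.
have cx : cmod x%:C%C = x by rewrite cmod_real gtr0_norm.
have := ha x%:C%C; have := hb x%:C%C; rewrite cx !ge_min !lexx orbT.
rewrite -e ?cx ?x0 // => /(_ isT) h1 /(_ isT).
have := ler_cmodB (F x%:C%C - G 0) (F x%:C%C - F 0).
rewrite opprB addrC -addrA [- _ + (_ - _)]addrA addNr sub0r; lra.
Qed.

Lemma int_series_at0 F : int_series F -> F 0 \in @algint C.
Proof.
move=> /(_ 1%N)[P [G [iP _ e]]]; rewrite e ?cmod0 // expr1 mul0r addr0.
by rewrite horner_coef0; apply: polyOverP.
Qed.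

(** Each order K yields its own quotient of F by t. All of them agree with the one from [step 0]
    away from 0, hence at 0 by continuity. *)
Lemma int_series_divX F : int_series F -> F 0 = 0 ->
  exists2 G, int_series G & forall t, cmod t < 1 -> F t = t * G t.
Proof.
move=> hF F0.
have step K : exists P G, [/\ P \is a polyOver (@algint C), disc_hol G
    & forall t, cmod t < 1 -> F t = t * (P.[t] + t ^+ K * G t)].
  have [P [G [iP hG e]]] := hF K.+1.
  have P0 : P.[0] = 0 by have := e 0; rewrite cmod0 ltr01 F0 exprS !mul0r addr0 => /(_ isT).
  exists (drop_poly 1 P), G; split=> //.
    by apply/polyOverP => i; rewrite coef_drop_poly; exact: (polyOverP iP).
  move=> t t1; rewrite e // mulrDr exprS mulrA; congr (_ + _).
  rewrite -[P in LHS](poly_take_drop 1) hornerD hornerM hornerXn expr1 mulrC.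
  rewrite (_ : take_poly 1 P = 0) ?hornerC ?add0r //.
  by apply/polyP => -[|i]; rewrite coef_take_poly coef0 //= -horner_coef0.
have [P0 [G0 [_ hG0 e0]]] := step 0%N.
pose H t := P0.[t] + G0 t.
have hH : disc_hol H by apply: disc_holD => //; exact: disc_hol_poly.
have eH t : cmod t < 1 -> F t = t * H t by move=> /e0 ->; rewrite expr0 mul1r.
exists H => // K; have [P [G [iP hG e]]] := step K.
exists P, G; split=> // t t1; have [->|tn0] := eqVneq t 0.
  apply: (disc_hol_eq0 (G := fun t => P.[t] + t ^+ K * G t)) => //.
    by apply: disc_holD; [exact: disc_hol_poly | apply: disc_holM => //; exact: disc_holX].
  move=> s /andP[s0 s1]; rewrite cmod_gt0 in s0.
  by apply: (mulfI s0); rewrite -eH // -e.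
by apply: (mulfI tn0); rewrite -eH // -e.
Qed.

Definition clim (u : nat -> C) : C := xget 0 [set l | cv u l]%classic.

Lemma climE u l : cv u l -> clim u = l.
Proof.
move=> h; rewrite /clim; case: xgetP => [y _ hy|/(_ l)]; last by [].
exact: cv_unique hy h.
Qed.

(** A telescoping sum writes the factors beyond K as 1 + t^K G with G given by [disc_series]. The
    limit thus shares its coefficients below degree K with a finite product, where they are
    algebraic integers. *)
Lemma int_series_infprod (h : nat -> C -> C) :
  (forall j, int_series (h j)) -> uniformly_bounded h ->
  let prodn n t := \prod_(0 <= j < n) (1 + t ^+ j.+1 * h j t) in
  exists2 G, int_series G & forall t, cmod t < 1 -> cv (prodn^~ t) (G t).
Proof.
move=> hser hbnd prodn.
have fser j : int_series (fun t => 1 + t ^+ j.+1 * h j t).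
  apply: int_seriesD; first by apply: int_series_cst; exact: rpred1.
  by apply: int_seriesM => //; exact: int_seriesX.
have tail K : exists2 G, disc_hol G & forall t, cmod t < 1 ->
    cv (prodn^~ t) (prodn K t * (1 + t ^+ K * G t)).
  pose tailn n t := \prod_(0 <= i < n) (1 + t ^+ (K + i).+1 * h (K + i)%N t).
  have hole j : disc_hol (fun t => h (K + j)%N t * tailn j t).
    apply: disc_holM; first exact: int_series_hol.
    by apply: disc_hol_prod => i; exact: int_series_hol.
  have bnde : uniformly_bounded (fun j t => h (K + j)%N t * tailn j t).
    move=> r r01; have [B B0 hB] := hbnd _ r01.
    exists (B * expR (B / (1 - r))); first by rewrite mulr_gt0 ?expR_gt0.
    move=> j t tr; rewrite cmodM; apply: ler_pM; rewrite ?cmod_ge0 ?hB //.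
    apply: (le_trans (cmod_prod1D _ _ _)); rewrite ler_expR.
    apply: (@le_trans _ _ (\sum_(0 <= i < j) r ^+ i * B)).
      apply: ler_sum => i _; rewrite cmodM; apply: ler_pM; rewrite ?cmod_ge0 ?hB //.
      case/andP: r01 => r0 r1; rewrite cmodX.
      apply: (@le_trans _ _ (r ^+ (K + i).+1)).
        by apply: lerXn2r; rewrite ?nnegrE ?cmod_ge0.
      by apply: ler_wiXn2l => //; [exact: ltW | rewrite ltnW // ltnS leq_addl].
    rewrite -mulr_suml mulrC; apply: ler_wpM2l; first exact: ltW.
    by apply: (le_trans (sum_expr_le _ _ r01)); rewrite expr0 mul1r.
  have [G hG cvG] := disc_series hole bnde.
  exists G => // t t1.
  have E n : tailn n t = 1 + t ^+ K * \sum_(0 <= j < n) t ^+ j.+1 * (h (K + j)%N t * tailn j t).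
    elim: n => [|n IH]; first by rewrite /tailn !big_geq // mulr0 addr0.
    rewrite big_nat_recr //= mulrDr addrA -IH /tailn big_nat_recr //= -/(tailn n t).
    by rewrite mulrDr mulr1 -addnS exprD; ring.
  apply: (@eq_cv_near _ K (fun n => prodn K t * tailn (n - K)%N t)).
    move=> n Kn; rewrite /prodn [RHS](@big_cat_nat _ _ _ K) //=; congr (_ * _).
    rewrite -{2}[K]add0n big_addn; apply: eq_bigr => i _.
    by rewrite addnC.
  apply: cvM; first exact: cv_cst.
  apply: (@eq_cv _ (fun n => 1 + t ^+ K * \sum_(0 <= j < n - K) t ^+ j.+1 * (h (K + j)%N t * tailn j t))).
    by move=> n; rewrite E.
  apply: cvD; first exact: cv_cst.
  apply: cvM; first exact: cv_cst.
  move=> e e0; have [n0 hn0] := cvG _ t1 _ e0.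
  exists (n0 + K)%N => n hn; apply: hn0; lia.
pose G t := clim (prodn^~ t).
have GE K H : (forall t, cmod t < 1 -> cv (prodn^~ t) (prodn K t * (1 + t ^+ K * H t))) ->
  forall t, cmod t < 1 -> G t = prodn K t * (1 + t ^+ K * H t).
  by move=> hc t t1; apply: climE; exact: hc.
exists G; last first.
  by move=> t t1; have [H hH hc] := tail 0%N; rewrite (GE _ _ hc) //; exact: hc.
move=> K; have [H hH hc] := tail K.
have : int_series (prodn K) by exact: int_series_prod.
move=> /[dup] /int_series_hol hp /(_ K)[P [H' [iP hH' e]]].
exists P, (fun t => H' t + prodn K t * H t); split=> //.
  by apply: disc_holD => //; exact: disc_holM.
by move=> t t1; rewrite (GE _ _ hc) // mulrDr mulr1 {1}e //; ring.
Qed.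

End DiscSeries.

(** * The modular discriminant *)

Section EulerFunction.
Variable R : realType.
Local Notation C := R[i].
Local Notation Im := complex.Im.
Implicit Types (t x z : C).

Definition euler x : C := clim (fun n => \prod_(0 <= j < n) (1 - x ^+ j.+1)).

Lemma int_series_geom : int_series (fun t : C => (1 - t)^-1).
Proof.
have hol : disc_hol (fun t : C => (1 - t)^-1).
  have one_bounded : uniformly_bounded (fun (_ : nat) (_ : C) => 1 : C).
    by move=> r _; exists 1 => // j t _; rewrite cmod1.
  have [G hG cvG] := disc_series (fun _ => @disc_hol_cst R 1) one_bounded.
  apply: (eq_disc_hol (F := fun t => 1 + G t)); last first.
    by apply: disc_holD => //; exact: disc_hol_cst.
  move=> t t1; have t0 : 1 - t != 0.
    by rewrite subr_eq0; apply: contraTneq t1 => <-; rewrite cmod1 ltxx.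
  apply: (mulIf t0); rewrite mulVf //.
  apply: (@cv_unique _ (fun n => 1 - t ^+ n.+1)).
    apply: (eq_cv (u := fun n => (1 + \sum_(0 <= j < n) t ^+ j.+1 * 1) * (1 - t))).
      move=> n; rewrite -[LHS]opprK -mulrN opprB mulrC.
      have -> : 1 + \sum_(0 <= j < n) t ^+ j.+1 * 1 = \sum_(i < n.+1) t ^+ i.
        rewrite big_mkord big_ord_recl expr0; congr (1 + _).
        by apply: eq_bigr => i _; rewrite mulr1.
      by rewrite -subrX1 opprB.
    apply: cvM; last exact: cv_cst.
    by apply: cvD; [exact: cv_cst | exact: cvG].
  have t01 : 0 <= cmod t < 1 by rewrite cmod_ge0.
  move=> e e0; have [m hm] := expr_small t01 e0.
  exists m => n /leqW /hm; rewrite addrAC subrr add0r cmodN cmodX; apply: le_lt_trans.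
  done.
move=> K; exists (\poly_(i < K) 1), (fun t => (1 - t)^-1); split => //.
  apply/polyOverP => i; rewrite coef_poly; case: ifP => _; [exact: rpred1 | exact: rpred0].
move=> t t1; have t0 : 1 - t != 0.
  by rewrite subr_eq0; apply: contraTneq t1 => <-; rewrite cmod1 ltxx.
apply: (mulIf t0); rewrite mulrDl mulVf // mulfVK // horner_poly.
rewrite -[X in _ = X + _]opprK -mulrN opprB mulrC.
under eq_bigr do rewrite mul1r.
by rewrite -subrX1 opprB subrK.
Qed.

Lemma cv_prod_int_series (h : nat -> C -> C) :
  (forall j, int_series (h j)) -> uniformly_bounded h ->
  int_series (fun t => clim (fun n => \prod_(0 <= j < n) (1 + t ^+ j.+1 * h j t)))
  /\ forall t, cmod t < 1 ->
     cv (fun n => \prod_(0 <= j < n) (1 + t ^+ j.+1 * h j t))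
        (clim (fun n => \prod_(0 <= j < n) (1 + t ^+ j.+1 * h j t))).
Proof.
move=> h1 h2; have [G hG cG] := int_series_infprod h1 h2.
split; last by move=> t t1; rewrite (climE (cG t t1)); exact: cG.
by apply: eq_int_series hG => t t1; rewrite (climE (cG t t1)).
Qed.

Lemma eq_clim (u v : nat -> C) : u =1 v -> clim u = clim v.
Proof. by move=> /funext ->. Qed.

Lemma euler_spec : int_series euler /\ forall t, cmod t < 1 ->
  cv (fun n => \prod_(0 <= j < n) (1 - t ^+ j.+1)) (euler t).
Proof.
have [||h1 h2] := @cv_prod_int_series (fun _ _ => -1).
- by move=> _; apply: int_series_cst; rewrite rpredN rpred1.
- by move=> r _; exists 1 => // j t _; rewrite cmodN cmod1.
have e t : (fun n => \prod_(0 <= j < n) (1 + t ^+ j.+1 * -1)) =1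
    (fun n => \prod_(0 <= j < n) (1 - t ^+ j.+1)).
  by move=> n; apply: eq_bigr => j _; rewrite mulrN1.
split; first by apply: eq_int_series h1 => t _; exact: eq_clim.
move=> t /h2; rewrite (eq_clim (e t)); exact: eq_cv.
Qed.

Lemma int_series_euler : int_series euler. Proof. exact: euler_spec.1. Qed.

Lemma cv_euler t : cmod t < 1 -> cv (fun n => \prod_(0 <= j < n) (1 - t ^+ j.+1)) (euler t).
Proof. exact: euler_spec.2. Qed.

Lemma disc_1BX_neq0 t n : cmod t < 1 -> 1 - t ^+ n.+1 != 0.
Proof.
move=> t1; rewrite subr_eq0; apply: contraTneq isT => e.
have : cmod t ^+ n.+1 < 1 by rewrite exprn_ilt1 ?cmod_ge0.
by rewrite -cmodX -e cmod1 ltxx.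
Qed.

(** 1 / (1 - x) = 1 + x / (1 - x) puts the inverse product in the shape of [int_series_infprod]; its
    product with [euler] being 1 also shows that [euler] has no zeros. *)
Lemma euler_inv_spec : int_series (fun t => (euler t)^-1) /\
  forall t, cmod t < 1 -> euler t != 0.
Proof.
have [||h1 h2] := @cv_prod_int_series (fun j t => (1 - t ^+ j.+1)^-1).
- move=> j; apply: (eq_int_series (F := fun t => (1 - (1 * t ^+ j.+1))^-1)).
    by move=> t _; rewrite mul1r.
  by apply: (int_series_comp (F := fun t => (1 - t)^-1)); rewrite ?rpred1 ?cmod1 //; exact: int_series_geom.
- move=> r /andP[r0 r1]; exists (1 - r)^-1; first by rewrite invr_gt0; lra.
  move=> j t tr; rewrite cmodV lef_pV2 ?posrE; last 2 first.
  + by rewrite cmod_gt0 disc_1BX_neq0 // (le_lt_trans tr).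
  + lra.
  apply: le_trans (lerB_cmod _ _); rewrite cmod1 lerD2l lerN2 cmodX.
  apply: (@le_trans _ _ (cmod t ^+ 1)); last by rewrite expr1.
  by apply: ler_wiXn2l; rewrite ?cmod_ge0 // (le_trans tr (ltW r1)).
have key t : cmod t < 1 -> euler t *
    clim (fun n => \prod_(0 <= j < n) (1 + t ^+ j.+1 * (1 - t ^+ j.+1)^-1)) = 1.
  move=> t1; apply: (cv_unique (cvM (cv_euler t1) (h2 t t1))).
  apply: (eq_cv (u := fun=> 1)); last exact: cv_cst.
  move=> n; rewrite -big_split big1 //= => j _.
  rewrite mulrDr mulr1 mulrCA divff ?disc_1BX_neq0 // mulr1.
  by rewrite subrK.
have nz t : cmod t < 1 -> euler t != 0.
  by move=> /key; apply: contra_eq_neq => ->; rewrite mul0r eq_sym oner_eq0.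
split=> //; apply: eq_int_series h1 => t t1.
by apply: (mulfI (nz _ t1)); rewrite key // mulfV // nz.
Qed.

Lemma int_series_euler_inv : int_series (fun t => (euler t)^-1).
Proof. exact: euler_inv_spec.1. Qed.

Lemma euler_neq0 t : cmod t < 1 -> euler t != 0.
Proof. exact: euler_inv_spec.2. Qed.

Lemma euler0 : euler 0 = 1.
Proof.
apply: climE; apply: (eq_cv (u := fun=> 1)); last exact: cv_cst.
by move=> n; rewrite big1 // => j _; rewrite expr0n subr0.
Qed.

(** Euler's identity between partitions into distinct and into odd parts. Splitting 1 - t^(2j) as (1
    - t^j)(1 + t^j) shows that the partial product is the Euler product of length 2n over that of
    length n. *)
Lemma cv_euler_odd t : cmod t < 1 ->
  cv (fun n => \prod_(0 <= j < n) ((1 + t ^+ j.+1) * (1 - t ^+ j.*2.+1))) 1.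
Proof.
move=> t1; have E0 := euler_neq0 t1.
rewrite -[X in cv _ X](divff E0).
apply: (eq_cv (u := fun n => (\prod_(0 <= j < n.*2) (1 - t ^+ j.+1)) / \prod_(0 <= j < n) (1 - t ^+ j.+1))).
  move=> n; have P0 : \prod_(0 <= j < n) (1 - t ^+ j.+1) != 0.
    by rewrite prodf_seq_neq0; apply/allP => j _; rewrite disc_1BX_neq0.
  apply: (mulIf P0); rewrite divfK // -big_split /=.
  elim: {P0} n => [|n IH]; first by rewrite !big_geq.
  rewrite doubleS !big_nat_recr //= IH -!mulrA; congr (_ * _).
  have -> : t ^+ n.*2.+2 = t ^+ n.+1 ^+ 2 by rewrite -exprM muln2 doubleS.
  by move: (t ^+ n.*2.+1) (t ^+ n.+1) => a b; ring.
apply: cv_div => //; last exact: cv_euler.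
apply: (cv_sub (k := fun n => n.*2) (u := fun n => \prod_(0 <= j < n) (1 - t ^+ j.+1))).
  by move=> n; rewrite -addnn leq_addr.
exact: cv_euler.
Qed.

Definition upper z := 0 < Im z.

Lemma cmod_ee_upper z : upper z -> cmod (ee z) < 1.
Proof.
move=> z0; rewrite cmod_ee -expR0 ltr_expR oppr_lt0 !mulr_gt0 //.
exact: pi_gt0.
Qed.

(** The discriminant form in the normalization q prod (1 - q^n)^24, without (2 pi)^12. *)
Definition Delta z : C := ee z * euler (ee z) ^+ 24.

Lemma Delta_neq0 z : upper z -> Delta z != 0.
Proof. by move=> z0; rewrite mulf_neq0 ?ee_neq0 // expf_neq0 // euler_neq0 // cmod_ee_upper. Qed.

End EulerFunction.

(** * Infinite products over a lattice *)

Section IteratedProducts.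
Variable R : realType.
Local Notation C := R[i].

(* Fubini for an absolutely convergent double product. *)
Lemma iterated_product_limits (c : nat -> nat -> C) (B : R) (rho sig : nat -> C) (a b : C) :
  (forall m n, cmod (c m n) <= B / (m.+1%:R ^+ 2 * n.+1%:R ^+ 2)) ->
  (forall M, cv (fun N => \prod_(0 <= m < M) \prod_(0 <= n < N) (1 + c m n)) (rho M)) ->
  (forall N, cv (fun M => \prod_(0 <= m < M) \prod_(0 <= n < N) (1 + c m n)) (sig N)) ->
  cv rho a -> cv sig b -> a = b.
Proof.
move=> hc hrho hsig ha hb.
pose P M N := \prod_(0 <= m < M) \prod_(0 <= n < N) (1 + c m n).
have B0 : 0 <= B.
  by have := le_trans (cmod_ge0 _) (hc 0%N 0%N); rewrite !expr1n mulr1 divr1.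
have bsum M K N : \sum_(0 <= m < M) \sum_(K <= n < N) cmod (c m n) <=
    B * 2 * \sum_(K <= n < N) (n.+1%:R ^+ 2)^-1.
  apply: (@le_trans _ _ (\sum_(0 <= m < M) (m.+1%:R ^+ 2)^-1 * (B * \sum_(K <= n < N) (n.+1%:R ^+ 2)^-1))).
    apply: ler_sum => m _; rewrite !mulr_sumr; apply: ler_sum => n _.
    by apply: (le_trans (hc m n)); rewrite invfM mulrCA.
  rewrite -mulr_suml mulrAC [leRHS]mulrC; apply: ler_wpM2r; last exact: sum_invsq_le2.
  by rewrite mulr_ge0 // sumr_ge0 // => n _; rewrite invr_ge0 sqr_ge0.
have pE M K N : \prod_(0 <= m < M) \prod_(K <= n < N) (1 + c m n) =
    \prod_(p <- [seq (m, n) | m <- index_iota 0 M, n <- index_iota K N]) (1 + c p.1 p.2).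
  by rewrite big_allpairs.
have sE M K N : \sum_(p <- [seq (m, n) | m <- index_iota 0 M, n <- index_iota K N]) cmod (c p.1 p.2)
    = \sum_(0 <= m < M) \sum_(K <= n < N) cmod (c m n).
  by rewrite big_allpairs.
pose D := expR (B * 2 * 2).
have Pb M N : cmod (P M N) <= D.
  rewrite /P pE; apply: (le_trans (cmod_prod1D _ _ _)); rewrite ler_expR sE.
  apply: (le_trans (bsum M 0%N N)); apply: ler_wpM2l; last exact: sum_invsq_le2.
  by rewrite mulr_ge0.
pose T := D * (B * 2 * expR (B * 2)).
have key M N K : (K.+1 <= N)%N -> cmod (P M N - P M K.+1) <= T / K.+1%:R.
  move=> KN.
  have -> : P M N = P M K.+1 * \prod_(0 <= m < M) \prod_(K.+1 <= n < N) (1 + c m n).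
    by rewrite /P -big_split /=; apply: eq_bigr => m _; rewrite -big_cat_nat.
  rewrite -[X in _ - X]mulr1 -mulrBr cmodM pE /T -mulrA.
  apply: ler_pM; rewrite ?cmod_ge0 //.
  have h : \sum_(p <- [seq (m, n) | m <- index_iota 0 M, n <- index_iota K.+1 N]) cmod (c p.1 p.2)
      <= B * 2 / K.+1%:R.
    rewrite sE; apply: (le_trans (bsum _ _ _)); apply: ler_wpM2l; first by rewrite mulr_ge0.
    exact: sum_invsq_le.
  apply: (le_trans (cmod_prod1D_sub1_le h)).
  rewrite mulrAC; apply: ler_wpM2r; first by rewrite invr_ge0.
  apply: ler_wpM2l; first by rewrite mulr_ge0.
  by rewrite ler_expR ler_pdivrMr // ler_peMr ?ler1n // mulr_ge0.
have k2 M K : cmod (rho M - P M K.+1) <= T / K.+1%:R.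
  apply: (@cv_le _ (fun N => P M N - P M K.+1) _ _ K.+1); last by move=> N; exact: key.
  by apply: cvB; [exact: hrho | exact: cv_cst].
have k3 K : cmod (a - sig K.+1) <= T / K.+1%:R.
  apply: (@cv_le _ (fun M => rho M - P M K.+1) _ _ 0%N); last by move=> M _; exact: k2.
  by apply: cvB => //; exact: hsig.
apply: (@cv_unique _ sig) => // e e0.
exists (Num.truncn (T / e)).+2 => -[//|K] hK.
rewrite cmodB; apply: (le_lt_trans (k3 K)).
rewrite ltr_pdivrMr // mulrC -ltr_pdivrMr //.
apply: (lt_trans (truncnS_gt _)); rewrite ltr_nat; exact: hK.
Qed.

End IteratedProducts.

Section LinearFactors.
Variable R : realType.
Local Notation C := R[i].

(** Only the sum of the A enters to first order, so two such products with equal sums have a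
    quotient 1 + O(x^2). *)
Lemma prod_1BM_expansion (s : seq C) : exists2 H : R, 0 < H & forall x, cmod x <= 1 ->
  cmod (\prod_(A <- s) (1 - A * x) - 1 + (\sum_(A <- s) A) * x) <= H * cmod x ^+ 2.
Proof.
elim: s => [|A s [H H0 IH]].
  by exists 1 => // x _; rewrite !big_nil subrr mul0r addr0 cmod0 mul1r sqr_ge0.
pose S := \sum_(A <- s) A.
exists (H + cmod A * H + cmod A * cmod S) => [|x x1].
  by have := cmod_ge0 A; have := cmod_ge0 S; move: (cmod A) (cmod S) => y z *; nra.
rewrite !big_cons -/S; have := IH _ x1; rewrite -/S.
set Pi := \prod_(_ <- s) _ => h.
have -> : (1 - A * x) * Pi - 1 + (A + S) * x =
  (Pi - 1 + S * x) - A * x * (Pi - 1 + S * x) + A * S * x ^+ 2 by ring.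
have := ler_cmodD (Pi - 1 + S * x - A * x * (Pi - 1 + S * x)) (A * S * x ^+ 2).
have := ler_cmodB (Pi - 1 + S * x) (A * x * (Pi - 1 + S * x)).
rewrite !cmodM.
have := cmod_ge0 (Pi - 1 + S * x); have := cmod_ge0 x; have := cmod_ge0 A.
move: h x1; set u := cmod (Pi - 1 + S * x); set w := cmod x.
set y := cmod A; set z := cmod S => hu w1 y0 w0 u0 k1 k2.
have : y * w * u <= y * 1 * (H * w ^+ 2).
  apply: ler_pM => //; first exact: mulr_ge0.
  by apply: ler_wpM2l.
lra.
Qed.

End LinearFactors.

(** Regroups the linear factors w +- J +- a according to w + a and w - a, so that the product over J
    becomes a quotient of sine products. *)
Lemma phi_pair (F : fieldType) (a w J : F) : J != 0 -> w + J != 0 -> w - J != 0 ->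
  (1 - (a / (w + J)) ^+ 2) * (1 - (a / (w - J)) ^+ 2) =
  (1 - ((w + a) / J) ^+ 2) * (1 - ((w - a) / J) ^+ 2) / ((1 - (w / J) ^+ 2) ^+ 2).
Proof.
move=> J0 p0 m0; have e : 1 - (w / J) ^+ 2 = - (w + J) * (w - J) / J ^+ 2 by field.
have e0 : - (w + J) * (w - J) / J ^+ 2 != 0.
  by rewrite !mulf_neq0 ?oppr_eq0 ?invr_eq0 ?expf_neq0.
by rewrite e; field; rewrite oppr_eq0 J0 p0 m0.
Qed.

Section LatticeRows.
Variable R : realType.
Local Notation C := R[i].
Local Notation Im := complex.Im.
Implicit Types (t w a : C).

Lemma cv_shift1 (u : nat -> C) l : cv (fun n => u n.+1) l -> cv u l.
Proof.
move=> h e /h[n0 hn]; exists n0.+1 => -[//|n]; rewrite ltnS; exact: hn.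
Qed.

Definition sine_ratio a : C := (ee a - 1) / (twopii R * a * ee (a / 2)).

Lemma cv_sine_ratio a : a != 0 ->
  cv (fun N => \prod_(0 <= j < N) (1 - (a / j.+1%:R) ^+ 2)) (sine_ratio a).
Proof.
move=> a0; pose k := twopii R * a * ee (a / 2).
have k0 : k != 0 by rewrite !mulf_neq0 ?ee_neq0 // twopii_neq0.
apply: (eq_cv (u := fun N => k * (\prod_(0 <= j < N) (1 - (a / j.+1%:R) ^+ 2)) / k)).
  by move=> n; rewrite mulrAC divff // mul1r.
by apply: cv_div => //; [exact: cv_sine_product | exact: cv_cst].
Qed.

Lemma upperDreal w (x : R) : upper (w + x%:C%C) = upper w.
Proof. by case: w => a b; rewrite /upper /= addr0. Qed.

Lemma upperDn w n : upper (w + n%:R) = upper w.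
Proof. by rewrite natrC upperDreal. Qed.

Lemma upperBn w n : upper (w - n%:R) = upper w.
Proof. by rewrite natrC -rmorphN upperDreal. Qed.

Lemma upper_neq0 w : upper w -> w != 0.
Proof. by apply: contraTneq => ->; rewrite /upper ltxx. Qed.

Lemma upper_natM t n : upper t -> upper (n.+1%:R * t).
Proof.
rewrite /upper natrC; case: t => a b /= h.
by rewrite mul0r addr0 mulr_gt0.
Qed.

Lemma ee_upper_sub1 w : upper w -> ee w - 1 != 0.
Proof.
move=> /cmod_ee_upper h; rewrite subr_eq0; apply: contraTneq h => ->.
by rewrite cmod1 ltxx.
Qed.

(** The product over the row w + Z is sin (pi (w + a)) sin (pi (w - a)) / sin (pi w)^2; the
    exponentials of half arguments cancel and leave a rational function of e(w) and e(a). *)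
Lemma cv_row_factor a w : upper w ->
  cv (fun N => (1 - (a / w) ^+ 2) * \prod_(0 <= j < N)
       ((1 - (a / (w + j.+1%:R)) ^+ 2) * (1 - (a / (w - j.+1%:R)) ^+ 2)))
     ((ee w * ee a - 1) * (ee w / ee a - 1) / (ee w - 1) ^+ 2).
Proof.
move=> wu; have w0 := upper_neq0 wu.
pose RN z N := twopii R * z * ee (z / 2) * \prod_(0 <= j < N) (1 - (z / j.+1%:R) ^+ 2).
have T0 := twopii_neq0 R.
apply: (eq_cv (u := fun N => RN (w + a) N * RN (w - a) N / RN w N ^+ 2)).
  move=> N; under [in RHS]eq_bigr => j _.
    rewrite phi_pair; [|by rewrite pnatr_eq0| |].
    - over.
    - by rewrite upper_neq0 // upperDn.
    - by rewrite upper_neq0 // upperBn.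
  rewrite prodf_div big_split /= prodrXl /RN.
  set p1 := \prod_(_ <= _ < _) _; set p2 := \prod_(_ <= _ < _) _; set p3 := \prod_(_ <= _ < _) _.
  have e0 := ee_neq0 (w / 2).
  have -> : ee ((w + a) / 2) = ee (w / 2) * ee (a / 2) by rewrite -eeD mulrDl.
  have -> : ee ((w - a) / 2) = ee (w / 2) / ee (a / 2) by rewrite -eeN -eeD mulrBl.
  have p30 : p3 != 0.
    rewrite prodf_seq_neq0; apply/allP => j _ /=.
    rewrite subr_eq0 eq_sym sqrf_eq1 negb_or.
    have J0 : (j.+1%:R : C) != 0 by rewrite pnatr_eq0.
    have hm : w - j.+1%:R != 0 by rewrite upper_neq0 // upperBn.
    have hp : w + j.+1%:R != 0 by rewrite upper_neq0 // upperDn.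
    apply/andP; split; apply/eqP => /(congr1 ( *%R^~ j.+1%:R)); rewrite divfK //.
      by rewrite mul1r => e; rewrite e subrr eqxx in hm.
    by rewrite mulN1r => e; rewrite e addNr eqxx in hp.
  have a0 := ee_neq0 (a / 2).
  move: (ee (w / 2)) (ee (a / 2)) (twopii R) e0 a0 T0 => x y T e0 a0 T0.
  have -> : (1 - (a / w) ^+ 2) = (w + a) * (w - a) * (w ^- 2) by rewrite expr_div_n; field.
  move: (w + a) (w - a) p1 p2 p3 p30 => u v p1 p2 p3 p30.
  have -> : T * u * (x * y) * p1 * (T * v * (x / y) * p2) =
     (T ^+ 2 * x ^+ 2 * (y / y)) * (u * v * (p1 * p2)) by ring.
  have -> : (T * w * x * p3) ^- 2 = (T ^+ 2 * x ^+ 2)^-1 * (w ^- 2 * p3 ^- 2).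
    by field; rewrite T0 w0 e0 p30.
  rewrite divff // mulr1 mulrACA divff ?mul1r; last first.
    by rewrite mulf_neq0 // expf_neq0.
  ring.
rewrite -eeN -!eeD.
apply: cv_div; first by rewrite expf_neq0 // ee_upper_sub1.
  by apply: cvM; exact: cv_sine_product.
by apply: cvX; exact: cv_sine_product.
Qed.

(* Grouping +-(m t + n) and +-(m t - n) indexes the nonzero lattice points, up to sign, by
   pairs of natural numbers. *)
Definition lattice_factor (g : C -> C) t (m n : nat) : C :=
  match m, n with
  | 0%N, 0%N => 1
  | 0%N, _ => g n%:R
  | _, 0%N => g (m%:R * t)
  | _, _ => g (m%:R * t + n%:R) * g (m%:R * t - n%:R)
  end.

Definition quad a w : C := 1 - (a / w) ^+ 2.

Definition row_value a t (m : nat) : C :=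
  if m is m'.+1 then
    (ee (m%:R * t) * ee a - 1) * (ee (m%:R * t) / ee a - 1) / (ee (m%:R * t) - 1) ^+ 2
  else sine_ratio a.

Lemma cv_row_value a t m : upper t -> a != 0 ->
  cv (fun N => \prod_(0 <= n < N) lattice_factor (quad a) t m n) (row_value a t m).
Proof.
move=> tu a0; apply: cv_shift1; case: m => [|m].
  apply: eq_cv (cv_sine_ratio a0) => N.
  by rewrite big_nat_recl // mul1r.
apply: eq_cv (cv_row_factor a (upper_natM m tu)) => N.
by rewrite big_nat_recl.
Qed.

(** The exponents add up to 16 - 4 = 12, the weight of [Delta]. The numerator points are half
    periods; the denominator points are half periods moved by t or 1, which makes the sums of
    squares balance. Up to sign, the whole family goes over into itself when t is replaced by -1/t
    and the points are multiplied by t. *)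
Definition modular_quotient t w : C :=
  (quad (1 / 2) w ^+ 6 * quad (t / 2) w ^+ 6 *
   quad ((1 + t) / 2) w ^+ 2 * quad ((1 - t) / 2) w ^+ 2) /
  (quad (1 / 2 + t) w * quad (1 / 2 - t) w * quad (1 + t / 2) w * quad (1 - t / 2) w).

Definition row_quotient t m : C :=
  (row_value (1 / 2) t m ^+ 6 * row_value (t / 2) t m ^+ 6 *
   row_value ((1 + t) / 2) t m ^+ 2 * row_value ((1 - t) / 2) t m ^+ 2) /
  (row_value (1 / 2 + t) t m * row_value (1 / 2 - t) t m *
   row_value (1 + t / 2) t m * row_value (1 - t / 2) t m).

Lemma lattice_factor_quotient t m n :
  let f a := lattice_factor (quad a) t m n in
  lattice_factor (modular_quotient t) t m n =
  (f (1 / 2) ^+ 6 * f (t / 2) ^+ 6 * f ((1 + t) / 2) ^+ 2 * f ((1 - t) / 2) ^+ 2) /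
  (f (1 / 2 + t) * f (1 / 2 - t) * f (1 + t / 2) * f (1 - t / 2)).
Proof.
case: m n => [|m] [|n] //=; first by rewrite !expr1n !mulr1 divr1.
rewrite /modular_quotient mulf_div; congr (_ / _); last by ring.
by rewrite !exprMn; ring.
Qed.

Lemma half_neq0 (F : numFieldType) (z : F) : z != 0 -> z / 2 != 0.
Proof. by move=> z0; rewrite mulf_neq0 // invr_eq0 pnatr_eq0. Qed.

Lemma nonreal_neq0 t : Im t != 0 -> t != 0.
Proof. by apply: contraNneq => ->. Qed.

Lemma Im_half t : Im (t / 2) = Im t / 2.
Proof. by rewrite natrC -fmorphV; case: t => a b /=; rewrite mulr0 add0r. Qed.

Lemma division_points_neq0 t : upper t ->
  [/\ t / 2 != 0, (1 + t) / 2 != 0 & (1 - t) / 2 != 0] /\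
  [/\ 1 / 2 + t != 0, 1 / 2 - t != 0, 1 + t / 2 != 0 & 1 - t / 2 != 0].
Proof.
rewrite /upper => h.
have I1 : Im (1 / 2 : C) = 0 by rewrite Im_half mul0r.
have ImD z w : Im (z + w) = Im z + Im w by case: z w => [? ?] [? ?].
have ImN z : Im (- z) = - Im z by case: z.
split; split; apply: nonreal_neq0; rewrite ?(Im_half, ImD, ImN) ?I1 /=; rewrite ?(Im_half, ImD, ImN) /=; lra.
Qed.

Lemma half1_neq0 : 1 / 2 != 0 :> C.
Proof. by apply: half_neq0; exact: oner_neq0. Qed.

End LatticeRows.

Section LatticeBound.
Variable R : realType.
Local Notation C := R[i].
Local Notation Im := complex.Im.
Implicit Types (t w a : C).

Lemma quadE a w : quad a w = 1 - a ^+ 2 * w ^- 2.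
Proof. by rewrite /quad expr_div_n. Qed.

(* The squares of the numerator points and of the denominator points have the same sum. *)
Lemma modular_quotient_near1 t : exists d H : R, [/\ 0 < d, 0 < H &
  forall w, cmod (w ^- 2) <= d -> cmod (modular_quotient t w - 1) <= H * cmod (w ^- 2) ^+ 2].
Proof.
pose sq (a : C) := a ^+ 2.
pose num := nseq 6 (sq (1 / 2)) ++ nseq 6 (sq (t / 2)) ++
            nseq 2 (sq ((1 + t) / 2)) ++ nseq 2 (sq ((1 - t) / 2)).
pose den := [:: sq (1 / 2 + t); sq (1 / 2 - t); sq (1 + t / 2); sq (1 - t / 2)].
have sumE : \sum_(A <- num) A = \sum_(A <- den) A.
  by rewrite /num /den /sq !big_cons !big_nil /=; field.
have QE w : modular_quotient t w =
    (\prod_(A <- num) (1 - A * w ^- 2)) / \prod_(A <- den) (1 - A * w ^- 2).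
  rewrite /modular_quotient !quadE /num /den /sq !big_cons !big_nil /=.
  by congr (_ / _); rewrite !(exprS, expr0) ?mulr1 -?mulrA.
have [H1 H10 h1] := prod_1BM_expansion num.
have [H2 H20 h2] := prod_1BM_expansion den.
pose S := \sum_(A <- den) A.
have S0 := cmod_ge0 S.
pose d := Num.min 1 (2^-1 / (cmod S + H2)).
have d0 : 0 < d by rewrite lt_min ltr01 divr_gt0 //; lra.
exists d, (2 * (H1 + H2)); split => //; first lra.
move=> w wd; rewrite QE; set x := w ^- 2 in wd *.
have x1 : cmod x <= 1 by apply: (le_trans wd); rewrite ge_min lexx.
have := h1 _ x1; have := h2 _ x1; rewrite sumE -/S.
set P1 := \prod_(_ <- num) _; set P2 := \prod_(_ <- den) _ => k2 k1.
have P2l : 2^-1 <= cmod P2.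
  have hx : cmod x * (cmod S + H2) <= 2^-1.
    by rewrite -ler_pdivlMr ?(le_trans wd) ?ge_min ?lexx ?orbT //; lra.
  have := ler_cmodB (P2 - 1 + S * x) (S * x); rewrite addrK cmodM.
  have := lerB_cmod 1 (1 - P2); rewrite opprB addrCA subrr addr0 cmod1 (cmodB 1 P2).
  have := cmod_ge0 x; move: k2; set v := cmod x in x1 hx *.
  move: (cmod (P2 - 1 + _)) => z k2 v0 g1 g2.
  have : H2 * v ^+ 2 <= H2 * v by apply: ler_wpM2l; [exact: ltW | rewrite expr2; nra].
  lra.
have P20 : P2 != 0 by rewrite -cmod_gt0; lra.
have -> : P1 / P2 - 1 = (P1 - P2) / P2 by rewrite mulrBl divff.
rewrite cmodf_div ler_pdivrMr; last lra.
have : cmod (P1 - P2) <= (H1 + H2) * cmod x ^+ 2.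
  have -> : P1 - P2 = (P1 - 1 + S * x) - (P2 - 1 + S * x) by ring.
  by apply: (le_trans (ler_cmodB _ _)); rewrite mulrDl lerD.
have : 0 <= (H1 + H2) * cmod x ^+ 2 by rewrite mulr_ge0 ?sqr_ge0 //; lra.
rewrite -(mulrA 2); set z := _ * cmod x ^+ 2 => z0 h; nra.
Qed.

(** The imaginary part of m t + s n is m Im t, which bounds m; the triangle inequality then bounds
    n. *)
Lemma lattice_lower_bound t : upper t -> exists2 k : R, 0 < k &
  forall (m n : R), 0 <= m -> 0 <= n ->
   forall s : R, s ^+ 2 = 1 ->
   m <= k * cmod (m%:C%C * t + (s * n)%:C%C) /\ n <= k * cmod (m%:C%C * t + (s * n)%:C%C).
Proof.
rewrite /upper; set y := Im t => y0; have t0 := cmod_ge0 t.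
exists ((1 + y + cmod t) / y); first by rewrite divr_gt0 //; lra.
move=> m n m0 n0 s s1; set w := m%:C%C * t + _.
have hy : m * y <= cmod w.
  apply: le_trans (ler_Im_cmod w); rewrite /w /y; case: (t) => a b /=.
  by rewrite mul0r !addr0 ler_norm.
have hn : n <= cmod w + m * cmod t.
  have e : cmod ((s * n)%:C%C : C) = n.
    rewrite cmod_real normrM (ger0_norm n0).
    have -> : `|s| = 1 by apply/eqP; rewrite -(@eqrXn2 _ 2) ?normr_ge0 ?expr1n // real_normK ?num_real // s1.
    by rewrite mul1r.
  have := ler_cmodB w (m%:C%C * t).
  by rewrite {1}/w addrAC subrr add0r e cmodM cmod_real ger0_norm.
have w0 := cmod_ge0 w.
have hm : m <= cmod w / y by rewrite ler_pdivlMr.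
have ky : (1 + y + cmod t) / y * cmod w = (1 + y + cmod t) * (cmod w / y) by rewrite mulrAC -mulrA.
have wy : 0 <= cmod w / y by rewrite divr_ge0 // ltW.
have wE : cmod w = y * (cmod w / y) by rewrite mulrCA mulfV ?mulr1 // gt_eqF.
rewrite ky; move: hm hn wy; rewrite {2}wE; set z := cmod w / y => hm hn wy.
have : m * cmod t <= z * cmod t by rewrite ler_wpM2r.
have : 0 <= y * z by rewrite mulr_ge0 // ltW.
have : 0 <= cmod t * z by rewrite mulr_ge0.
by split; lra.
Qed.

Lemma sqrB1_bound (p q : C) (b : R) : 0 <= b -> cmod (p - 1) <= b -> cmod (q - 1) <= b ->
  cmod (p * q - 1) <= 2 * b + b ^+ 2.
Proof.
move=> b0 hp hq; have -> : p * q - 1 = (p - 1) + (q - 1) + (p - 1) * (q - 1) by ring.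
have := ler_cmodD (p - 1 + (q - 1)) ((p - 1) * (q - 1)).
have := ler_cmodD (p - 1) (q - 1); rewrite cmodM.
have : cmod (p - 1) * cmod (q - 1) <= b * b by apply: ler_pM; rewrite ?cmod_ge0.
lra.
Qed.

(** A factor differs from 1 by O(|w|^-4), and (m + 1)(n + 1) = O(|w|^2); squaring the latter
    distributes the decay evenly over both indices. *)
Lemma lattice_factor_bound t : upper t -> exists B : R, forall m n,
  cmod (lattice_factor (modular_quotient t) t m n - 1) <= B / (m.+1%:R ^+ 2 * n.+1%:R ^+ 2).
Proof.
move=> tu; have [d [H [d0 H0 hQ]]] := modular_quotient_near1 t.
have [k k0 hk] := lattice_lower_bound tu.
pose f := lattice_factor (modular_quotient t) t.
pose w (s : R) (m n : nat) : C := m%:R * t + (s * n%:R)%:C%C.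
have hw s m n : s ^+ 2 = 1 -> (0 < m + n)%N ->
    m.+1%:R * n.+1%:R <= 4 * k ^+ 2 * cmod (w s m n) ^+ 2.
  move=> s1 mn; have [] := hk m%:R n%:R (ler0n _ _) (ler0n _ _) _ s1.
  rewrite -natrC -/(w s m n) => h1 h2.
  have h3 : 1 <= k * cmod (w s m n).
    case: m n mn h1 h2 => [|m] [|n] // _ h1 h2.
    - by apply: le_trans h2; rewrite ler1n.
    - by apply: le_trans h1; rewrite ler1n.
    - by apply: le_trans h1; rewrite ler1n.
  have hm : (m.+1%:R : R) <= 2 * (k * cmod (w s m n)) by rewrite -natr1; lra.
  have hn : (n.+1%:R : R) <= 2 * (k * cmod (w s m n)) by rewrite -natr1; lra.
  have -> : 4 * k ^+ 2 * cmod (w s m n) ^+ 2 = (2 * (k * cmod (w s m n))) * (2 * (k * cmod (w s m n))) by ring.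
  exact: ler_pM.
pose K := 4 * k ^+ 2; have K0 : 0 < K by rewrite mulr_gt0 // exprn_gt0.
have near m n s : s ^+ 2 = 1 -> (0 < m + n)%N -> K <= d * (m.+1%:R * n.+1%:R) ->
    cmod (modular_quotient t (w s m n) - 1) <= H * K ^+ 2 / (m.+1%:R * n.+1%:R) ^+ 2.
  move=> s1 mn; have := hw _ _ _ s1 mn; rewrite -/K.
  set p : R := m.+1%:R * n.+1%:R; have p0 : 0 < p by rewrite mulr_gt0.
  move=> h1 h2; have cw : 0 < cmod (w s m n) ^+ 2.
    by rewrite -(pmulr_rgt0 _ K0) (lt_le_trans p0).
  have hx : cmod (w s m n ^- 2) <= K / p.
    rewrite cmodV cmodX -[leLHS]mul1r ler_pdivrMr // mulrAC ler_pdivlMr // mul1r //.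
  apply: (le_trans (hQ _ _)).
    by apply: (le_trans hx); rewrite ler_pdivrMr.
  rewrite -mulrA ler_pM2l // -expr_div_n; apply: lerXn2r; rewrite ?nnegrE ?cmod_ge0 //.
  by rewrite divr_ge0 // ltW.
have one_sq : (1 : R) ^+ 2 = 1 by rewrite expr1n.
have None_sq : (-1 : R) ^+ 2 = 1 by rewrite sqrrN expr1n.
pose c1 := H * K ^+ 2; have c10 : 0 <= c1 by rewrite mulr_ge0 ?sqr_ge0 // ltW.
have bnd (p b : R) : 1 <= p -> b <= c1 / p ^+ 2 -> 0 <= b ->
    2 * b + b ^+ 2 <= (2 * c1 + c1 ^+ 2) / p ^+ 2.
  move=> p1 hb b0; have p0 : 0 < p ^+ 2 by rewrite exprn_gt0 //; lra.
  have p1' : 1 <= p ^+ 2 by rewrite exprn_ege1.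
  have z0 : 0 <= c1 / p ^+ 2 by rewrite divr_ge0 // ltW.
  have : (c1 / p ^+ 2) ^+ 2 <= c1 ^+ 2 / p ^+ 2.
    rewrite expr_div_n; apply: ler_wpM2l; first exact: sqr_ge0.
    have p20 : 0 < (p ^+ 2) ^+ 2 by rewrite exprn_gt0.
    by rewrite lef_pV2 ?posrE // [leRHS]expr2 ler_peMr // ltW.
  have : b ^+ 2 <= (c1 / p ^+ 2) ^+ 2 by apply: lerXn2r; rewrite ?nnegrE.
  rewrite mulrDl -mulrA; lra.
have one (p b : R) : 1 <= p -> b <= c1 / p ^+ 2 -> 0 <= b ->
    b <= (2 * c1 + c1 ^+ 2) / p ^+ 2.
  by move=> p1 hb b0; apply: le_trans (bnd p b p1 hb b0); have := sqr_ge0 b; lra.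
have ge1 (m n : nat) : 1 <= m.+1%:R * n.+1%:R :> R by rewrite -natrM ler1n.
have c1p0 (p : R) : 0 <= c1 / p ^+ 2 by rewrite divr_ge0 ?sqr_ge0.
have far m n : K <= d * (m.+1%:R * n.+1%:R) ->
    cmod (f m n - 1) <= (2 * c1 + c1 ^+ 2) / (m.+1%:R ^+ 2 * n.+1%:R ^+ 2).
  rewrite -exprMn => hK; have near' := near m n; rewrite /f.
  case: m n hK near' => [|m] [|n] hK near'; rewrite /lattice_factor.
  - rewrite subrr cmod0; apply: one (ge1 _ _) (c1p0 _) (lexx _).
  - apply: one; [exact: ge1 | | exact: cmod_ge0].
    have := near' 1 one_sq isT hK.
    by rewrite /w mul0r add0r mul1r -natrC.
  - apply: one; [exact: ge1 | | exact: cmod_ge0].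
    have := near' 1 one_sq isT hK.
    by rewrite /w mulr0 addr0.
  - apply: le_trans (sqrB1_bound (b := c1 / (m.+2%:R * n.+2%:R) ^+ 2) _ _ _) _.
    + exact: c1p0.
    + by have := near' 1 one_sq isT hK; rewrite /w mul1r -natrC.
    + by have := near' (-1) None_sq isT hK; rewrite /w mulN1r rmorphN /= -natrC.
    + by apply: bnd; rewrite ?ge1 ?c1p0.
(* [far] applies once (m + 1)(n + 1) >= K / d. All other pairs have m, n < L, and the finite sum [S]
   absorbs them into the constant. *)
pose L := (Num.truncn (K / d)).+1.
pose S := \sum_(i < L) \sum_(j < L) cmod (f i j - 1) * (i.+1%:R ^+ 2 * j.+1%:R ^+ 2).
have trm (i j : nat) : 0 <= cmod (f i j - 1) * (i.+1%:R ^+ 2 * j.+1%:R ^+ 2).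
  by rewrite !mulr_ge0 ?cmod_ge0 ?sqr_ge0.
have S0 : 0 <= S by apply: sumr_ge0 => i _; apply: sumr_ge0 => j _; exact: trm.
exists (2 * c1 + c1 ^+ 2 + S) => m n.
have pos : (0 : R) < m.+1%:R ^+ 2 * n.+1%:R ^+ 2 by rewrite mulr_gt0 ?exprn_gt0.
have [hK|hK] := leP K (d * (m.+1%:R * n.+1%:R)).
  apply: (le_trans (far m n hK)); rewrite ler_pM2r ?invr_gt0 //; lra.
rewrite -/f ler_pdivlMr //.
have lt : m.+1%:R * n.+1%:R < (L%:R : R).
  by apply: lt_trans (truncnS_gt _); rewrite ltr_pdivlMr // mulrC.
rewrite -natrM ltr_nat in lt.
have mL : (m < L)%N by apply: leq_trans (ltnW lt); rewrite leq_pmulr.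
have nL : (n < L)%N by apply: leq_trans (ltnW lt); rewrite leq_pmull.
have : cmod (f m n - 1) * (m.+1%:R ^+ 2 * n.+1%:R ^+ 2) <= S.
  rewrite /S (bigD1 (Ordinal mL)) //= (bigD1 (Ordinal nL)) //= -addrA lerDl.
  by apply: addr_ge0; repeat (apply: sumr_ge0 => ? _) => //; exact: trm.
have := sqr_ge0 c1; lra.
Qed.

End LatticeBound.

(** * Rational identities behind the row products *)

Section FieldIdentities.
Variable F : fieldType.

Lemma row_quotient_step (A B C D E G : F) : D != 0 -> E != 0 -> G != 0 -> B != 0 ->
  A ^+ 12 * (C * B) ^+ 4 / ((D * E) ^+ 2 * G ^+ 24) =
  (A * B) ^+ 8 / G ^+ 24 * ((C / B) ^+ 4 * (A ^+ 2 / (D * E)) ^+ 2).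
Proof. by move=> D0 E0 G0 B0; field; rewrite D0 E0 G0 B0. Qed.

Lemma row_quotient_identity (A D E G K L : F) : D != 0 -> E != 0 -> G != 0 -> K != 0 ->
  ((A / G) ^+ 2) ^+ 6 * (K / G ^+ 2) ^+ 6 * (L / G ^+ 2) ^+ 2 * (L / G ^+ 2) ^+ 2 /
  (D * E / G ^+ 2 * (D * E / G ^+ 2) * (K / G ^+ 2) * (K / G ^+ 2)) =
  A ^+ 12 * (K * L) ^+ 4 / ((D * E) ^+ 2 * G ^+ 24).
Proof. by move=> D0 E0 G0 K0; field; rewrite D0 E0 G0 K0. Qed.

(** The induction step of [prod_row_quotientS]: E, A, D stand for 1 + q^M, 1 + q^(M+1), 1 + q^(M+2),
    G for 1 - q^(M+1), B and X for 1 - q^(2M+1) and 1 - q^(2M+3), n and p for 1 - q and 1 + q, and c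
    for 2. *)
Lemma row_telescope (P Q E A D G B X n p c : F) : P != 0 -> E != 0 -> A != 0 -> D != 0 ->
  G != 0 -> B != 0 -> n != 0 -> c != 0 ->
  Q ^+ 8 / P ^+ 24 * ((B / n) ^+ 4 * (p * E / (c * A)) ^+ 2) *
  ((A * B) ^+ 8 / G ^+ 24 * ((X / B) ^+ 4 * (A ^+ 2 / (D * E)) ^+ 2)) =
  (Q * (A * B)) ^+ 8 / (P * G) ^+ 24 * ((X / n) ^+ 4 * (p * A / (c * D)) ^+ 2).
Proof.
move=> P0 E0 A0 D0 G0 B0 n0 c0.
have -> : (X / n) ^+ 4 * (p * A / (c * D)) ^+ 2 =
  (B / n) ^+ 4 * (p * E / (c * A)) ^+ 2 * ((X / B) ^+ 4 * (A ^+ 2 / (D * E)) ^+ 2).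
  by field; rewrite n0 c0 D0 A0 B0 E0.
rewrite !exprMn [(P ^+ 24 * _)^-1]invfM; ring.
Qed.

Lemma row0_identity (x U V W T a1 a2 a3 a4 b1 b2 b3 b4 : F) :
  x != 0 -> U != 0 -> V != 0 -> W != 0 -> T != 0 ->
  [/\ a1 != 0, a2 != 0, a3 != 0 & a4 != 0] ->
  [/\ b1 != 0, b2 != 0, b3 != 0 & b4 != 0] ->
  (- 4 / (T * a1) ^+ 2) ^+ 3 * (U / (T * a2 * x)) ^+ 6 *
   (- (V / (T * a3 * x)) ^+ 2) * (- (V / (T * a4 * x)) ^+ 2) /
  (- (W ^+ 2 / (T ^+ 2 * (b1 * b2) * x ^+ 4)) * - (U ^+ 2 / (T ^+ 2 * (b3 * b4) * x ^+ 2))) =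
  - 64 * (U * V) ^+ 4 / (T ^+ 12 * x ^+ 4 * W ^+ 2) *
    ((b1 * b2 * b3 * b4) / (a1 ^+ 6 * a2 ^+ 6 * a3 ^+ 2 * a4 ^+ 2)).
Proof.
move=> x0 U0 V0 W0 T0 [a10 a20 a30 a40] [b10 b20 b30 b40].
by field; rewrite !oppr_eq0 !(expf_neq0 2) ?x0 ?U0 ?V0 ?W0 ?T0 ?a10 ?a20 ?a30 ?a40 ?b10 ?b20 ?b30 ?b40.
Qed.

End FieldIdentities.

Section RowQuotient.
Variable R : realType.
Local Notation C := R[i].
Implicit Types (t w a : C).

Lemma ee_1div2 : ee (1 / 2 : C) = -1.
Proof. by rewrite div1r ee_half. Qed.

Lemma ee_double z : ee z = ee (z / 2) ^+ 2 :> C.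
Proof. by rewrite -eeMn mulr2n -splitr. Qed.

Lemma disc_1B_neq0 (z : C) : cmod z < 1 -> 1 - z != 0.
Proof. by move=> z1; rewrite -[z]expr1 disc_1BX_neq0. Qed.

Lemma disc_1D_neq0 (z : C) : cmod z < 1 -> 1 + z != 0.
Proof. by move=> z1; rewrite -[z]opprK disc_1B_neq0 // cmodN. Qed.

Lemma cmod_ee_half t : upper t -> cmod (ee (t / 2)) < 1.
Proof. by move=> tu; apply: cmod_ee_upper; move: tu; rewrite /upper Im_half => ?; lra. Qed.

Lemma row_value_half t m (W := ee t ^+ m.+1) :
  row_value (1 / 2) t m.+1 = ((1 + W) / (1 - W)) ^+ 2.
Proof.
rewrite /row_value ee_natl -/W ee_1div2 invrN invr1 mulrN1 expr_div_n -[(1 - W) ^+ 2]sqrrN opprB.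
by congr (_ / _); ring.
Qed.

Lemma row_value_ee (c : C) a t m (W := ee t ^+ m.+1) : ee a = c \/ ee a = c^-1 ->
  row_value a t m.+1 = (W * c - 1) * (W / c - 1) / (1 - W) ^+ 2.
Proof.
rewrite /row_value ee_natl -/W -[(1 - W) ^+ 2]sqrrN opprB => -[->|->] //.
by rewrite invrK [(W / c - 1) * _]mulrC.
Qed.

Lemma ee_division_points t (u := ee (t / 2)) :
  [/\ ee ((1 + t) / 2) = - u, ee ((1 - t) / 2) = (- u)^-1,
      ee (1 / 2 + t) = - u ^+ 2 & ee (1 / 2 - t) = (- u ^+ 2)^-1] /\
  (ee (1 + t / 2) = u /\ ee (1 - t / 2) = u^-1).
Proof.
have h := ee_1div2.
split; split.
- by rewrite mulrDl eeD h mulN1r.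
- by rewrite mulrBl eeD eeN h mulN1r invrN.
- by rewrite eeD h mulN1r [ee t]ee_double.
- by rewrite eeD eeN h mulN1r invrN [ee t]ee_double.
- by rewrite eeD ee1 mul1r.
- by rewrite eeD eeN ee1 mul1r.
Qed.

(** At all points involving t the exponentials are signs times powers of u = e(t/2). The factors [K]
    and [L] contain odd powers of u, but both survive with exponent 4 and their product is a
    polynomial in q = u^2. *)
Lemma row_quotientS t m (q := ee t) : upper t ->
  row_quotient t m.+1 =
  (1 + q ^+ m.+1) ^+ 12 * ((1 - q ^+ m.*2.+3) * (1 - q ^+ m.*2.+1)) ^+ 4 /
  (((1 + q ^+ m.+2) * (1 + q ^+ m)) ^+ 2 * (1 - q ^+ m.+1) ^+ 24).
Proof.
move=> tu; have [[e1 e2 e3 e4] [e5 e6]] := ee_division_points t.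
have qu : q = ee (t / 2) ^+ 2 by exact: ee_double.
have u1 := cmod_ee_half tu; have u0 := ee_neq0 (t / 2).
have q1 : cmod q < 1 := cmod_ee_upper tu.
rewrite /row_quotient row_value_half -/q.
rewrite (@row_value_ee (ee (t / 2)) (t / 2)); last by left.
rewrite (@row_value_ee (- ee (t / 2)) ((1 + t) / 2)); last by left.
rewrite (@row_value_ee (- ee (t / 2)) ((1 - t) / 2)); last by right.
rewrite (@row_value_ee (- ee (t / 2) ^+ 2) (1 / 2 + t)); last by left.
rewrite (@row_value_ee (- ee (t / 2) ^+ 2) (1 / 2 - t)); last by right.
rewrite (@row_value_ee (ee (t / 2)) (1 + t / 2)); last by left.
rewrite (@row_value_ee (ee (t / 2)) (1 - t / 2)); last by right.
rewrite -/q; move: u0 u1 qu; set u := ee (t / 2) => u0 u1 qu.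
have q0 : q != 0 by rewrite ee_neq0.
pose y := q ^+ m.
have yE : q ^+ m.+1 = q * y by rewrite exprS.
have E1 : (q * y * - u ^+ 2 - 1) * (q * y / - u ^+ 2 - 1) = (1 + q ^+ m.+2) * (1 + q ^+ m).
  rewrite -qu invrN !mulrN [q * y / q]mulrC mulKf // (exprS q m.+1) yE -/y; ring.
have y1 : cmod y <= 1 by rewrite cmodX exprn_ile1 ?cmod_ge0 // ltW.
have uy (k : nat) : cmod (u ^+ k.+1 * y) < 1.
  rewrite cmodM cmodX; apply: (@le_lt_trans _ _ (cmod u ^+ k.+1 * 1)).
    by rewrite ler_wpM2l // exprn_ge0 ?cmod_ge0.
  by rewrite mulr1 exprn_ilt1 ?cmod_ge0.
pose K := (u ^+ 3 * y - 1) * (u * y - 1); pose L := (u ^+ 3 * y + 1) * (u * y + 1).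
have E2 : (q * y * u - 1) * (q * y / u - 1) = K.
  rewrite /K qu; congr (_ * _); first by ring.
  by congr (_ - 1); field.
have E3 : (q * y * - u - 1) * (q * y / - u - 1) = L.
  rewrite invrN !mulrN -!opprD mulrNN /L qu; congr (_ * _); first by ring.
  by congr (_ + 1); field.
rewrite yE E1 E2 E3 row_quotient_identity.
- have -> : K * L = (1 - q ^+ m.*2.+3) * (1 - q ^+ m.*2.+1); last by [].
  have -> : q ^+ m.*2.+3 = q ^+ 3 * y ^+ 2 by rewrite -exprM muln2 -exprD.
  have -> : q ^+ m.*2.+1 = q * y ^+ 2 by rewrite -exprM muln2 -exprS.
  rewrite /K /L qu; ring.
- apply: disc_1D_neq0; rewrite cmodX exprn_ilt1 ?cmod_ge0 //.
- by case: (m) => [|k]; [rewrite expr0 -mulr2n pnatr_eq0 | apply: disc_1D_neq0; rewrite cmodX exprn_ilt1 ?cmod_ge0].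
- by rewrite -yE disc_1BX_neq0.
- rewrite /K -[X in X * _]opprB -[X in _ * X]opprB mulrNN mulf_neq0 // disc_1B_neq0 //.
  by have := uy 0%N; rewrite expr1.
Qed.

(** The rows telescope to boundary factors, an 8th power that tends to 1 by [cv_euler_odd], and the
    inverse 24th power of a partial Euler product. *)
Lemma prod_row_quotientS t M (q := ee t) : upper t ->
  \prod_(0 <= m < M) row_quotient t m.+1 =
  (\prod_(0 <= m < M) ((1 + q ^+ m.+1) * (1 - q ^+ m.*2.+1))) ^+ 8 /
  (\prod_(0 <= m < M) (1 - q ^+ m.+1)) ^+ 24 *
  (((1 - q ^+ M.*2.+1) / (1 - q)) ^+ 4 *
   ((1 + q) * (1 + q ^+ M) / (2 * (1 + q ^+ M.+1))) ^+ 2).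
Proof.
move=> tu; have q1 : cmod q < 1 := cmod_ee_upper tu.
have n1 : 1 - q != 0 := disc_1B_neq0 q1.
have p1 : 1 + q != 0 := disc_1D_neq0 q1.
have pX k : 1 + q ^+ k != 0.
  by case: k => [|k]; [rewrite expr0 -mulr2n pnatr_eq0 | apply: disc_1D_neq0; rewrite cmodX exprn_ilt1 ?cmod_ge0].
have two0 : (2 : C) != 0 by rewrite pnatr_eq0.
elim: M => [|M IH].
  have e : (1 + q) * (1 + q ^+ 0) / (2 * (1 + q ^+ 1)) = 1.
    by rewrite expr0 -mulr2n expr1 mulrC [X in X^-1]mulrC mulVf // mulf_neq0.
  by rewrite !big_geq // e expr1 (divff n1) !expr1n divr1 !mulr1.
rewrite big_nat_recr //= IH row_quotientS // -/q doubleS.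
rewrite [\prod_(0 <= m < M.+1) ((1 + _) * _)]big_nat_recr //=.
rewrite [\prod_(0 <= m < M.+1) (1 - _)]big_nat_recr //=.
have G0 : 1 - q ^+ M.+1 != 0 by rewrite disc_1BX_neq0.
have B0 : 1 - q ^+ M.*2.+1 != 0 by rewrite disc_1BX_neq0.
rewrite row_quotient_step ?pX //.
have P0 : \prod_(0 <= m < M) (1 - q ^+ m.+1) != 0.
  by rewrite prodf_seq_neq0; apply/allP => j _; rewrite disc_1BX_neq0.
move: P0 (pX M) (pX M.+1) (pX M.+2) G0 B0.
move: (\prod_(0 <= m < M) _) (\prod_(0 <= m < M) _) => P Q.
move: (1 + q ^+ M) (1 + q ^+ M.+1) (1 + q ^+ M.+2) (1 - q ^+ M.+1) (1 - q ^+ M.*2.+1) (1 - q ^+ M.*2.+3).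
move: (1 - q) (1 + q) n1 p1 => n p n1 p1 E A D G B X P0 E0 A0 D0 G0 B0.
exact: row_telescope.
Qed.

End RowQuotient.

Section SineRatioIdentities.
Variable F : fieldType.
Variables (i x T a b : F).
Hypotheses (i2 : i ^+ 2 = -1) (x0 : x != 0) (T0 : T != 0) (a0 : a != 0) (b0 : b != 0).

Let i0 : i != 0.
Proof. by apply: contra_eq_neq i2 => ->; rewrite expr0n eq_sym oppr_eq0 oner_eq0. Qed.

Lemma sine_ratio_sq1 : ((-1 - 1) / (T * a * i)) ^+ 2 = - 4 / (T * a) ^+ 2.
Proof.
have -> : (-1 - 1) / (T * a * i) = - 2 / (T * a) / i by field; rewrite T0 a0 i0.
rewrite expr_div_n i2 invrN invr1 mulrN1 expr_div_n mulNr; congr (- (_ / _)); ring.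
Qed.

Lemma sine_ratio_sq3 :
  ((- x ^+ 2 - 1) / (T * a * (i * x))) ^+ 2 = - ((x ^+ 2 + 1) / (T * a * x)) ^+ 2.
Proof.
have -> : (- x ^+ 2 - 1) / (T * a * (i * x)) = - ((x ^+ 2 + 1) / (T * a * x)) / i.
  by field; rewrite x0 T0 a0 i0.
by rewrite expr_div_n i2 invrN invr1 mulrN1 sqrrN.
Qed.

Lemma sine_ratio_sq4 :
  (((- x ^+ 2)^-1 - 1) / (T * a * (i / x))) ^+ 2 = - ((x ^+ 2 + 1) / (T * a * x)) ^+ 2.
Proof.
have -> : ((- x ^+ 2)^-1 - 1) / (T * a * (i / x)) = - ((x ^+ 2 + 1) / (T * a * x)) / i.
  by field; rewrite ?oppr_eq0 ?expf_neq0 // x0 T0 a0 i0.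
by rewrite expr_div_n i2 invrN invr1 mulrN1 sqrrN.
Qed.

Lemma sine_ratio_pair1 :
  (- x ^+ 4 - 1) / (T * a * (i * x ^+ 2)) * (((- x ^+ 4)^-1 - 1) / (T * b * (i / x ^+ 2))) =
  - ((x ^+ 4 + 1) ^+ 2 / (T ^+ 2 * (a * b) * x ^+ 4)).
Proof.
transitivity ((x ^+ 4 + 1) ^+ 2 / (T ^+ 2 * (a * b) * x ^+ 4) / i ^+ 2).
  by field; rewrite ?oppr_eq0 ?expf_neq0 // x0 T0 a0 b0 i0.
by rewrite i2 invrN invr1 mulrN1.
Qed.

Lemma sine_ratio_pair2 :
  (x ^+ 2 - 1) / (T * a * - x) * (((x ^+ 2)^-1 - 1) / (T * b * - x^-1)) =
  - ((x ^+ 2 - 1) ^+ 2 / (T ^+ 2 * (a * b) * x ^+ 2)).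
Proof. by field; rewrite ?oppr_eq0 ?oner_eq0 ?x0 ?T0 ?a0 ?b0. Qed.

End SineRatioIdentities.

(** * The inversion formula for the discriminant form *)

Section DeltaTransformation.
Variable R : realType.
Local Notation C := R[i].
Implicit Types (t a : C).

Lemma sub1_neq0_cmod (z : C) : cmod z < 1 -> z - 1 != 0.
Proof. by move=> z1; rewrite -opprB oppr_eq0 disc_1B_neq0. Qed.

Lemma row_value_small a c t m : upper t -> ee a = c \/ ee a = c^-1 ->
  cmod c < 1 -> ee t / c != 1 -> (cmod (ee t / c) <= 1) ->
  row_value a t m.+1 != 0.
Proof.
move=> tu ha c1 tc tc1; rewrite (row_value_ee _ _ ha).
have q1 := cmod_ee_upper tu.
rewrite !mulf_neq0 ?invr_eq0 ?expf_neq0 ?disc_1BX_neq0 //.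
  apply: sub1_neq0_cmod; rewrite cmodM -[ltRHS](mulr1 1).
  apply: (@le_lt_trans _ _ (1 * cmod c)); last by rewrite !mul1r.
  rewrite ler_wpM2r ?cmod_ge0 // cmodX exprn_ile1 ?cmod_ge0 // ltW //.
rewrite exprSr -mulrA; case: m => [|m]; first by rewrite expr0 mul1r subr_eq0.
apply: sub1_neq0_cmod; rewrite cmodM cmodX.
apply: (@le_lt_trans _ _ (cmod (ee t) ^+ m.+1 * 1)).
  by rewrite ler_wpM2l // exprn_ge0 ?cmod_ge0.
by rewrite mulr1 exprn_ilt1 ?cmod_ge0.
Qed.

Lemma sine_ratio_neq0 a : a != 0 -> ee a != 1 -> sine_ratio a != 0.
Proof.
move=> a0 e1; rewrite /sine_ratio; apply: mulf_neq0; first by rewrite subr_eq0.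
by rewrite invr_eq0 !mulf_neq0 ?ee_neq0 // twopii_neq0.
Qed.

Lemma row_value_den_neq0 t m : upper t ->
  [/\ row_value (1 / 2 + t) t m != 0, row_value (1 / 2 - t) t m != 0,
      row_value (1 + t / 2) t m != 0 & row_value (1 - t / 2) t m != 0].
Proof.
move=> tu; have [[e1 e2 e3 e4] [e5 e6]] := ee_division_points t.
have [_ [b1 b2 b3 b4]] := division_points_neq0 tu.
have u1 := cmod_ee_half tu; have u0 := ee_neq0 (t / 2).
have qu : ee t = ee (t / 2) ^+ 2 by exact: ee_double.
have q1 := cmod_ee_upper tu; have q0 := ee_neq0 t.
have z1 (z : C) : cmod z < 1 -> z != 1.
  by apply: contraTneq => ->; rewrite cmod1 ltxx.
have zV (z : C) : cmod z < 1 -> z^-1 != 1 by move=> /z1; rewrite invr_eq1.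
have k1 : cmod (- ee t) < 1 by rewrite cmodN.
case: m => [|m].
  split; apply: sine_ratio_neq0 => //.
  - by rewrite e3 -qu; exact: z1.
  - by rewrite e4 -qu; exact: zV.
  - by rewrite e5; exact: z1.
  - by rewrite e6; exact: zV.
have k2 : ee t / - ee t = -1 by rewrite invrN mulrN divff.
have k3 : ee t / ee (t / 2) = ee (t / 2) by rewrite qu expr2 mulfK.
have k4 : (-1 : C) != 1 by rewrite eq_sym -subr_eq0 opprK -mulr2n pnatr_eq0.
split.
- by apply: (row_value_small (c := - ee t)); rewrite ?k2 ?cmodN ?cmod1 //; left; rewrite e3 -qu.
- by apply: (row_value_small (c := - ee t)); rewrite ?k2 ?cmodN ?cmod1 //; right; rewrite e4 -qu.
- by apply: (row_value_small (c := ee (t / 2))); rewrite ?k3 ?z1 ?(ltW u1) //; left.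
- by apply: (row_value_small (c := ee (t / 2))); rewrite ?k3 ?z1 ?(ltW u1) //; right.
Qed.

Lemma cv_row_quotient t m : upper t ->
  cv (fun N => \prod_(0 <= n < N) lattice_factor (modular_quotient t) t m n)
     (row_quotient t m).
Proof.
move=> tu; have [[a2 a3 a4] [b1 b2 b3 b4]] := division_points_neq0 tu.
have [n1 n2 n3 n4] := row_value_den_neq0 m tu.
have h a : a != 0 -> cv (fun N => \prod_(0 <= n < N) lattice_factor (quad a) t m n) (row_value a t m).
  exact: cv_row_value.
apply: eq_cv; last first.
  apply: cv_div; last first.
  - apply: cvM (h _ b4); apply: cvM (h _ b3); exact: cvM (h _ b1) (h _ b2).
  - apply: cvM (cvX 2 (h _ a4)); apply: cvM (cvX 2 (h _ a3)).
    exact: cvM (cvX 6 (h _ (half1_neq0 R))) (cvX 6 (h _ a2)).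
  - by rewrite !mulf_neq0.
move=> N /=; under [RHS]eq_bigr do rewrite lattice_factor_quotient.
by rewrite prodf_div -!prodrXl -!big_split.
Qed.

Definition quotient_weight t : C :=
  ((1 / 2 + t) * (1 / 2 - t) * (1 + t / 2) * (1 - t / 2)) /
  ((1 / 2) ^+ 6 * (t / 2) ^+ 6 * ((1 + t) / 2) ^+ 2 * ((1 - t) / 2) ^+ 2).

(** Row 0 contains only the positive integers, so its values are sine ratios. Their denominators
    [twopii] a e(a/2) produce the 12th power of [twopii] and the factor [quotient_weight]. *)
Lemma row_quotient0 t : upper t ->
  row_quotient t 0 =
  - 64 * (ee t - 1) ^+ 4 / (twopii R ^+ 12 * ee t * (ee t + 1) ^+ 2) * quotient_weight t.
Proof.
move=> tu; have [[a2 a3 a4] [b1 b2 b3 b4]] := division_points_neq0 tu.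
have [[e1 e2 e3 e4] [e5 e6]] := ee_division_points t.
have a1 := half1_neq0 R; have T0 := twopii_neq0 R.
(* x = e(t/4) and i = e(1/4), a square root of -1: all the half exponents of the division points
   become monomials in these two. *)
set x := ee (t / 2 / 2); set i := ee (1 / 2 / 2 : C).
have x0 : x != 0 by exact: ee_neq0.
have ux : ee (t / 2) = x ^+ 2 by exact: ee_double.
have qx : ee t = x ^+ 4 by rewrite ee_double ux -exprM.
have i2 : i ^+ 2 = -1 by rewrite -ee_double ee_1div2.
have i0 : i != 0 by exact: ee_neq0.
have u1 := cmod_ee_half tu; have q1 := cmod_ee_upper tu.
have h1 : ee ((1 + t) / 2 / 2) = i * x by rewrite 2!mulrDl eeD.
have h2 : ee ((1 - t) / 2 / 2) = i / x by rewrite 2!mulrBl eeD eeN.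
have h3 : ee ((1 / 2 + t) / 2) = i * x ^+ 2 by rewrite mulrDl eeD ux.
have h4 : ee ((1 / 2 - t) / 2) = i / x ^+ 2 by rewrite mulrBl eeD eeN ux.
have h5 : ee ((1 + t / 2) / 2) = - x by rewrite mulrDl eeD ee_1div2 mulN1r.
have h6 : ee ((1 - t / 2) / 2) = - x^-1 by rewrite mulrBl eeD eeN ee_1div2 mulN1r.
have U0 : x ^+ 2 - 1 != 0 by rewrite -ux sub1_neq0_cmod.
have V0 : x ^+ 2 + 1 != 0 by rewrite -ux addrC disc_1D_neq0.
have W0 : x ^+ 4 + 1 != 0 by rewrite -qx addrC disc_1D_neq0.
have R1 : sine_ratio (1 / 2) ^+ 2 = - 4 / (twopii R * (1 / 2)) ^+ 2.
  by rewrite /sine_ratio ee_1div2; exact: sine_ratio_sq1.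
have R2 : sine_ratio (t / 2) = (x ^+ 2 - 1) / (twopii R * (t / 2) * x) by rewrite /sine_ratio ux.
have R3 : sine_ratio ((1 + t) / 2) ^+ 2 =
    - ((x ^+ 2 + 1) / (twopii R * ((1 + t) / 2) * x)) ^+ 2.
  rewrite /sine_ratio e1 ux h1; exact: sine_ratio_sq3.
have R4 : sine_ratio ((1 - t) / 2) ^+ 2 =
    - ((x ^+ 2 + 1) / (twopii R * ((1 - t) / 2) * x)) ^+ 2.
  by rewrite /sine_ratio e2 ux h2; exact: sine_ratio_sq4.
have R5 : sine_ratio (1 / 2 + t) * sine_ratio (1 / 2 - t) =
   - ((x ^+ 4 + 1) ^+ 2 / (twopii R ^+ 2 * ((1 / 2 + t) * (1 / 2 - t)) * x ^+ 4)).
  rewrite /sine_ratio e3 e4 ux h3 h4 -exprM; exact: sine_ratio_pair1.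
have R6 : sine_ratio (1 + t / 2) * sine_ratio (1 - t / 2) =
   - ((x ^+ 2 - 1) ^+ 2 / (twopii R ^+ 2 * ((1 + t / 2) * (1 - t / 2)) * x ^+ 2)).
  rewrite /sine_ratio e5 e6 ux h5 h6; exact: sine_ratio_pair2.
rewrite /row_quotient /row_value (exprM _ 2 3) R1 R2 R3 R4 R5 -[_ * sine_ratio (1 + t / 2) * _]mulrA R6.
rewrite row0_identity // qx /quotient_weight; congr (_ * _ ^+ 4 / (_ * _ ^+ 2) * _).
  by ring.
Qed.

End DeltaTransformation.

Section LimitIdentities.
Variable F : numFieldType.

Lemma quotient_limit_identity (q T w E : F) : q != 0 -> T != 0 -> 1 - q != 0 -> 1 + q != 0 -> E != 0 ->
  - 16 / T ^+ 12 * (w / (q * E ^+ 24)) =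
  - 64 * (q - 1) ^+ 4 / (T ^+ 12 * q * (q + 1) ^+ 2) * w *
  (1 / E ^+ 24 * ((1 / (1 - q)) ^+ 4 * ((1 + q) / 2) ^+ 2)).
Proof.
move=> q0 T0 n0 p0 E0.
have -> : (q - 1) ^+ 4 = (1 - q) ^+ 4 by ring.
rewrite [q + 1]addrC; move: (1 - q) (1 + q) n0 p0 => n p n0 p0.
rewrite [(q * _)^-1]invfM; move: (E ^+ 24) (expf_neq0 24 E0) => e e0.
by field; rewrite q0 T0 n0 p0 e0.
Qed.

Lemma quotient_weight_identity (t : F) (s := - t^-1) : t != 0 -> 1 + t != 0 -> 1 - t != 0 ->
  ((1 / 2 + s) * (1 / 2 - s) * (1 + s / 2) * (1 - s / 2)) /
  ((1 / 2) ^+ 6 * (s / 2) ^+ 6 * ((1 + s) / 2) ^+ 2 * ((1 - s) / 2) ^+ 2) =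
  t ^+ 12 * (((1 / 2 + t) * (1 / 2 - t) * (1 + t / 2) * (1 - t / 2)) /
  ((1 / 2) ^+ 6 * (t / 2) ^+ 6 * ((1 + t) / 2) ^+ 2 * ((1 - t) / 2) ^+ 2)).
Proof.
move=> t0 p0 m0.
have -> : (1 / 2 + s) * (1 / 2 - s) * (1 + s / 2) * (1 - s / 2) =
  ((1 / 2 + t) * (1 / 2 - t) * (1 + t / 2) * (1 - t / 2)) / t ^+ 4 by rewrite /s; field.
have -> : (1 / 2) ^+ 6 * (s / 2) ^+ 6 * ((1 + s) / 2) ^+ 2 * ((1 - s) / 2) ^+ 2 =
  (1 / 2) ^+ 6 * (t / 2) ^+ 6 * ((1 + t) / 2) ^+ 2 * ((1 - t) / 2) ^+ 2 / t ^+ 16.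
  by rewrite /s; field.
move: ((1 / 2 + t) * (1 / 2 - t) * (1 + t / 2) * (1 - t / 2)) => x.
move: ((1 / 2) ^+ 6 * (t / 2) ^+ 6 * ((1 + t) / 2) ^+ 2 * ((1 - t) / 2) ^+ 2) => A.
rewrite invf_div; move: A^-1 => y.
have -> : t ^+ 16 = t ^+ 4 * t ^+ 12 by rewrite -exprD.
by field.
Qed.

End LimitIdentities.

Section DeltaInversion.
Variable R : realType.
Local Notation C := R[i].
Implicit Types (t w a : C).

Lemma cv_exp0 (z : C) (k : nat -> nat) : cmod z < 1 -> (forall n, (n <= k n)%N) ->
  cv (fun n => z ^+ k n) 0.
Proof.
move=> z1 hk; apply: (cv_sub (u := fun n => z ^+ n)) => // e e0.
have z01 : 0 <= cmod z < 1 by rewrite cmod_ge0.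
have [m hm] := expr_small z01 e0.
by exists m => n /hm; rewrite subr0 cmodX.
Qed.

Lemma cv_prod_row_quotient t : upper t ->
  cv (fun M => \prod_(0 <= m < M) row_quotient t m)
     (- 16 / twopii R ^+ 12 * (quotient_weight t / Delta t)).
Proof.
move=> tu; have q1 : cmod (ee t) < 1 := cmod_ee_upper tu.
have n0 : 1 - ee t != 0 := disc_1B_neq0 q1.
have p0 : 1 + ee t != 0 := disc_1D_neq0 q1.
have E0 := euler_neq0 q1.
have T0 := twopii_neq0 R; have q0 := ee_neq0 t.
apply: cv_shift1.
apply: (@eq_cv _ (fun M => row_quotient t 0 * ((\prod_(0 <= m < M) ((1 + ee t ^+ m.+1) * (1 - ee t ^+ m.*2.+1))) ^+ 8 /
  (\prod_(0 <= m < M) (1 - ee t ^+ m.+1)) ^+ 24 *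
  (((1 - ee t ^+ M.*2.+1) / (1 - ee t)) ^+ 4 *
   ((1 + ee t) * (1 + ee t ^+ M) / (2 * (1 + ee t ^+ M.+1))) ^+ 2)))).
  by move=> M; rewrite -prod_row_quotientS // big_nat_recl.
(* -16 is the -64 of row 0 times the 1/4 left by the boundary factors, whose powers of 1 - q and 1 +
   q cancel those of row 0. *)
have -> : - 16 / twopii R ^+ 12 * (quotient_weight t / Delta t) =
  row_quotient t 0 * (1 ^+ 8 / euler (ee t) ^+ 24 *
   (((1 - 0) / (1 - ee t)) ^+ 4 * ((1 + ee t) * (1 + 0) / (2 * (1 + 0))) ^+ 2)).
  rewrite row_quotient0 // /Delta subr0 addr0 !mulr1 expr1n.
  exact: quotient_limit_identity.
apply: cvM; first exact: cv_cst.
have one : cv (fun=> 1 : C) 1 by exact: cv_cst.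
apply: cvM; apply: cvM.
- by apply: cvX; exact: cv_euler_odd.
- by apply: cvV; [exact: expf_neq0 | apply: cvX; exact: cv_euler].
- apply: cvX; apply: cvM; last exact: cv_cst.
  apply: cvB => //; apply: cv_exp0 => // n; rewrite -addnn; lia.
- apply: cvX; apply: cv_div; first by rewrite addr0 mulr1 pnatr_eq0.
    by apply: cvM; [exact: cv_cst | apply: cvD => //; exact: (cv_exp0 (k := id))].
  apply: cvM; first exact: cv_cst.
  by apply: cvD => //; apply: cv_exp0.
Qed.

Lemma quadN_pt a w : quad (- a) w = quad a w.
Proof. by rewrite /quad mulNr sqrrN. Qed.

Lemma quadN w a : quad a (- w) = quad a w.
Proof. by rewrite /quad invrN mulrN sqrrN. Qed.

Lemma quad_scale t a w : t != 0 -> quad a w = quad (t * a) (t * w).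
Proof. by move=> t0; rewrite /quad -mulf_div divff ?mul1r. Qed.

Lemma modular_quotientN t w : modular_quotient t (- w) = modular_quotient t w.
Proof. by rewrite /modular_quotient !quadN. Qed.

(** Multiplication by t carries the points attached to -1/t to those attached to t, up to sign and
    order. Together with the exchange of m and n this makes the rows for -1/t the columns for t. *)
Lemma modular_quotient_inv t w : t != 0 ->
  modular_quotient (- t^-1) w = modular_quotient t (t * w).
Proof.
move=> t0; rewrite /modular_quotient !(quad_scale _ w t0).
have ti : t * - t^-1 = - 1 by rewrite mulrN divff.
have -> : t * (1 / 2) = t / 2 by rewrite mulrA mulr1.
have -> : t * (- t^-1 / 2) = - (1 / 2) by rewrite mulrA ti mulNr.
have -> : t * ((1 + - t^-1) / 2) = - ((1 - t) / 2).
  by rewrite mulrA mulrDr ti mulr1 -mulNr opprB.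
have -> : t * ((1 - - t^-1) / 2) = (1 + t) / 2.
  by rewrite mulrA mulrBr ti mulr1 opprK addrC.
have -> : t * (1 / 2 + - t^-1) = - (1 - t / 2).
  by rewrite mulrDr ti mulrA mulr1 opprB.
have -> : t * (1 / 2 - - t^-1) = 1 + t / 2.
  by rewrite mulrBr ti mulrA mulr1 opprK addrC.
have -> : t * (1 + - t^-1 / 2) = - (1 / 2 - t).
  by rewrite mulrDr mulr1 mulrA ti mulNr opprB.
have -> : t * (1 - - t^-1 / 2) = 1 / 2 + t.
  by rewrite mulrBr mulr1 mulrA ti mulNr opprK addrC.
rewrite !quadN_pt; congr (_ / _); last by ring.
by rewrite [quad (t / 2) _ ^+ 6 * _]mulrC [LHS]mulrAC.
Qed.

Lemma lattice_factor_inv t m n : t != 0 ->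
  lattice_factor (modular_quotient (- t^-1)) (- t^-1) m n =
  lattice_factor (modular_quotient t) t n m.
Proof.
move=> t0; have ti : t * - t^-1 = - 1 by rewrite mulrN divff.
case: m n => [|m] [|n] //=; rewrite !modular_quotient_inv //.
- by rewrite mulrC.
- by rewrite mulrCA ti mulrN1 modular_quotientN.
- rewrite mulrC; congr (_ * _).
    by rewrite mulrBr mulrCA ti mulrN1 -opprD modular_quotientN addrC mulrC.
  by rewrite mulrDr mulrCA ti mulrN1 addrC mulrC.
Qed.

Lemma upper_inv t : upper t -> upper (- t^-1).
Proof.
rewrite /upper; case: t => a b /= b0.
rewrite ?mulNr opprK divr_gt0 // ltr_wpDl ?sqr_ge0 // exprn_gt0 //.
Qed.

Lemma quotient_weight_inv t : upper t -> quotient_weight (- t^-1) = t ^+ 12 * quotient_weight t.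
Proof.
move=> tu; have [[a2 a3 a4] _] := division_points_neq0 tu.
have t0 := upper_neq0 tu.
have [p0 m0] : 1 + t != 0 /\ 1 - t != 0.
  by split; [apply: contraNneq a3 => -> | apply: contraNneq a4 => ->]; rewrite mul0r.
exact: quotient_weight_identity.
Qed.

Lemma quotient_weight_neq0 t : upper t -> quotient_weight t != 0.
Proof.
move=> tu; have [[a2 a3 a4] [b1 b2 b3 b4]] := division_points_neq0 tu.
have a1 := half1_neq0 R.
by apply: mulf_neq0; rewrite ?invr_eq0; repeat (apply: mulf_neq0 => //); exact: expf_neq0.
Qed.

Lemma Delta_inv t : upper t -> Delta (- t^-1) = t ^+ 12 * Delta t.
Proof.
move=> tu; have t0 := upper_neq0 tu; have su := upper_inv tu.
have [B hB] := lattice_factor_bound tu.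
pose f := lattice_factor (modular_quotient t) t.
have key : - 16 / twopii R ^+ 12 * (quotient_weight t / Delta t) =
    - 16 / twopii R ^+ 12 * (quotient_weight (- t^-1) / Delta (- t^-1)).
  apply: (@iterated_product_limits _ (fun m n => f m n - 1) B
    (fun M => \prod_(0 <= m < M) row_quotient t m)
    (fun N => \prod_(0 <= n < N) row_quotient (- t^-1) n)) => //.
  - move=> M; apply: cv_prod => m.
    by apply: eq_cv (cv_row_quotient m tu) => N; apply: eq_bigr => n _; rewrite addrC subrK.
  - move=> N; apply: (eq_cv (u := fun M => \prod_(0 <= n < N) \prod_(0 <= m < M)
        lattice_factor (modular_quotient (- t^-1)) (- t^-1) n m)).
      move=> M; rewrite exchange_big /=; apply: eq_bigr => m _; apply: eq_bigr => n _.
      by rewrite lattice_factor_inv // addrC subrK.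
    by apply: cv_prod => n; exact: cv_row_quotient.
  - exact: cv_prod_row_quotient.
  - exact: cv_prod_row_quotient.
have c0 : - 16 / twopii R ^+ 12 != 0.
  apply: mulf_neq0; first by rewrite oppr_eq0 pnatr_eq0.
  by rewrite invr_eq0; apply: expf_neq0; exact: twopii_neq0.
move/(mulfI c0): key; rewrite quotient_weight_inv //.
have w0 := quotient_weight_neq0 tu; have d0 := Delta_neq0 tu; have d1 := Delta_neq0 su.
move=> e; apply: (mulfI (mulf_neq0 w0 (mulf_neq0 (invr_neq0 d0) (invr_neq0 d1)))).
move: (quotient_weight t) (Delta t) (Delta _) w0 d0 d1 e => w d d' w0 d0 d1 e.
rewrite -mulrA mulfVK // e.
by rewrite -[LHS]mulr1 -(mulVf d0); ring.
Qed.

End DeltaInversion.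

(** * Closure properties of algebraic integers *)

Section AlgebraicIntegerLemmas.
Variable F : fieldType.

Lemma algint_int (k : int) : k%:~R \in @algint F.
Proof. by rewrite rpred_int. Qed.

Lemma algint_nat (n : nat) : n%:R \in @algint F.
Proof. by rewrite rpred_nat. Qed.

Lemma algint_root (p : {poly F}) (x : F) : p \is monic -> root p x ->
  p \is a polyOver (@algint F) -> x \in @algint F.
Proof.
move=> mp rp ip.
have h : integralOver (intr : int -> F) x.
  apply: (@integral_root_monic int F intr x p mp rp) => y /(nthP 0)[i _ <-].
  by have /asboolP := polyOverP ip i.
by apply/asboolP.
Qed.

Lemma algint_exp (x : F) n : (0 < n)%N -> x ^+ n \in @algint F -> x \in @algint F.
Proof.
move=> n0 hx; apply: (@algint_root ('X^n - (x ^+ n)%:P)).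
- exact: monicXnsubC.
- by rewrite /root !hornerE ?hornerXn subrr.
- by rewrite rpredB ?polyOverC // rpredX // polyOverX.
Qed.

Lemma algint_root_unit (p : {poly F}) (x : F) : p != 0 -> root p x ->
  p \is a polyOver (@algint F) -> (lead_coef p)^-1 \in @algint F -> x \in @algint F.
Proof.
move=> p0 rp ip iu; apply: (@algint_root ((lead_coef p)^-1 *: p)).
- by rewrite monicE lead_coefZ mulVf // lead_coef_eq0.
- by rewrite rootZ // invr_eq0 lead_coef_eq0.
- by rewrite polyOverZ.
Qed.

End AlgebraicIntegerLemmas.

(** * Expansions at infinity and modular functions *)

Section QExpansions.
Variable R : realType.
Local Notation C := R[i].
Implicit Types (t z : C) (f g : C -> C).

(* f = t^M F(t) with t = q^(1/N), where F has algebraic integer coefficients and F(0) = u. *)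
Definition qexp (N : nat) (M : int) (u : C) f := exists F,
  [/\ int_series F, F 0 = u
    & forall z, upper z -> f z = ee (z / N%:R) ^ M * F (ee (z / N%:R))].

Lemma upper_divn z n : upper z -> upper (z / n.+1%:R).
Proof.
rewrite /upper natrC -fmorphV; case: z => a b /= b0.
by rewrite mulr0 add0r mulr_gt0 // invr_gt0.
Qed.

Lemma eq_qexp N M u f g : (forall z, upper z -> f z = g z) -> qexp N M u f -> qexp N M u g.
Proof. by move=> fg [F [iF F0 e]]; exists F; split=> // z zu; rewrite -fg ?e. Qed.

Lemma qexp_alg N M u f : qexp N M u f -> u \in @algint C.
Proof. by move=> [F [iF <- _]]; exact: int_series_at0. Qed.

Lemma qexp_cst N a : a \in @algint C -> qexp N 0 a (fun=> a).
Proof.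
move=> ia; exists (fun=> a); split=> //; first exact: int_series_cst.
by move=> z _; rewrite expr0z mul1r.
Qed.

Lemma qexpM N M M' u u' f g : qexp N M u f -> qexp N M' u' g ->
  qexp N (M + M') (u * u') (fun z => f z * g z).
Proof.
move=> [F [iF F0 e]] [G [iG G0 e']]; exists (fun t => F t * G t); split.
- exact: int_seriesM.
- by rewrite F0 G0.
- by move=> z zu; rewrite e // e' // expfzDr ?ee_neq0 // mulrACA.
Qed.

Lemma qexpD N M u u' f g : qexp N M u f -> qexp N M u' g ->
  qexp N M (u + u') (fun z => f z + g z).
Proof.
move=> [F [iF F0 e]] [G [iG G0 e']]; exists (fun t => F t + G t); split.
- exact: int_seriesD.
- by rewrite F0 G0.
- by move=> z zu; rewrite e // e' // mulrDr.
Qed.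

Lemma qexpZ N M a u f : a \in @algint C -> qexp N M u f -> qexp N M (a * u) (fun z => a * f z).
Proof.
by move=> ia h; rewrite -[M]add0r; apply: qexpM => //; exact: qexp_cst.
Qed.

Lemma qexpN N M u f : qexp N M u f -> qexp N M (- u) (fun z => - f z).
Proof.
move=> h; rewrite -mulN1r; apply: (@eq_qexp _ _ _ (fun z => -1 * f z)).
  by move=> z _; rewrite mulN1r.
by apply: qexpZ => //; rewrite rpredN rpred1.
Qed.

Lemma qexp_expn N M u f k : qexp N M u f -> qexp N (M * k%:Z) (u ^+ k) (fun z => f z ^+ k).
Proof.
move=> h; elim: k => [|k IH].
  rewrite mulr0; apply: (@eq_qexp _ _ _ (fun=> 1)) => //; exact: qexp_cst (rpred1 _).
rewrite exprS -[k.+1%:Z]/((1 + k)%N%:Z) PoszD mulrDr mulr1.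
by apply: (@eq_qexp _ _ _ (fun z => f z * f z ^+ k)); [move=> z _; rewrite exprS | exact: qexpM].
Qed.

Lemma qexp_prod N (I : eqType) (s : seq I) (M : I -> int) (u : I -> C) (f : I -> C -> C) :
  (forall i, i \in s -> qexp N (M i) (u i) (f i)) ->
  qexp N (\sum_(i <- s) M i) (\prod_(i <- s) u i) (fun z => \prod_(i <- s) f i z).
Proof.
elim: s => [|i s IH] h.
  rewrite !big_nil; apply: (@eq_qexp _ _ _ (fun=> 1)); last exact: qexp_cst (rpred1 _).
  by move=> z _; rewrite big_nil.
rewrite !big_cons; apply: (@eq_qexp _ _ _ (fun z => f i z * \prod_(j <- s) f j z)).
  by move=> z _; rewrite big_cons.
apply: qexpM; first by apply: h; exact: mem_head.
by apply: IH => j js; apply: h; rewrite inE js orbT.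
Qed.

Lemma qexp_weaken N M k u f : qexp N (M + k.+1%:Z) u f -> qexp N M 0 f.
Proof.
move=> [F [iF F0 e]]; exists (fun t => t ^+ k.+1 * F t); split.
- by apply: int_seriesM => //; exact: int_seriesX.
- by rewrite expr0n mul0r.
- by move=> z zu; rewrite e // expfzDr ?ee_neq0 // mulrA.
Qed.

Lemma qexp_lift N M k u f : qexp N (M + k%:Z) u f -> exists v, qexp N M v f.
Proof.
case: k => [|k]; first by rewrite addr0 => h; exists u.
by move/qexp_weaken => h; exists 0.
Qed.

Lemma qexp_add_any N M M' u u' f g : qexp N M u f -> qexp N M' u' g ->
  exists M'' u'', qexp N M'' u'' (fun z => f z + g z).
Proof.
move=> qf qg; pose M0 : int := - (absz M + absz M')%N%:Z.
have [v qf'] : exists v, qexp N M0 v f.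
  apply: (@qexp_lift N M0 (absz (M - M0))%N u).
  suff -> : M0 + (absz (M - M0))%N%:Z = M by [].
  rewrite /M0; lia.
have [v' qg'] : exists v, qexp N M0 v g.
  apply: (@qexp_lift N M0 (absz (M' - M0))%N u').
  suff -> : M0 + (absz (M' - M0))%N%:Z = M' by [].
  rewrite /M0; lia.
by exists M0, (v + v'); exact: qexpD.
Qed.

Lemma qexp_strict N M f : (0 < N)%N -> qexp N M 0 f -> exists u, qexp N (M + 1) u f.
Proof.
case: N => // N _ [F [iF F0 e]]; have [G iG eG] := int_series_divX iF F0.
exists (G 0), G; split=> // z zu; rewrite e // expfzDr ?ee_neq0 // expr1z -mulrA -eG //.
exact/cmod_ee_upper/upper_divn.
Qed.

Lemma algint_ee_div (b : int) (m : nat) : (0 < m)%N ->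
  ee (b%:~R / m%:R) \in @algint C.
Proof.
move=> m0; apply: (algint_exp m0); rewrite -ee_natl mulrCA divff ?pnatr_eq0 -?lt0n //.
by rewrite mulr1 ee_int rpred1.
Qed.

Lemma cmod_ee_real (x : R) : cmod (ee x%:C%C) = 1.
Proof. by rewrite cmod_ee /= mulr0 oppr0 expR0. Qed.

Lemma cmod_ee_div (b : int) (m : nat) : cmod (ee (b%:~R / m%:R : C)) = 1.
Proof.
have -> : (b%:~R / m%:R : C) = (b%:~R / m%:R : R)%:C%C.
  by rewrite rmorphM fmorphV rmorph_int rmorph_nat.
exact: cmod_ee_real.
Qed.

Lemma algint_exprz_unit (c : C) (M : int) : c \in @algint C -> c^-1 \in @algint C ->
  c ^ M \in @algint C.
Proof.
move=> ic iv; case: M => n; first exact: rpredX.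
by rewrite NegzE -exprz_inv; exact: rpredX.
Qed.

(** (a z + b) / (d N) = a^2 z / (N a d) + b / (N d), so the parameter is replaced by c t^(a^2). The
    level N a d is preferred to N d because it is the same for all upper triangular matrices of one
    determinant. *)
Lemma qexp_comp N M u f (a b d : nat) (c := ee (b%:R / (N * d)%:R : C)) :
  (0 < N)%N -> (0 < a)%N -> (0 < d)%N -> qexp N M u f ->
  qexp (N * (a * d)) (M * (a ^ 2)%N%:Z) (c ^ M * u) (fun z => f ((a%:R * z + b%:R) / d%:R)).
Proof.
move=> N0 a0 d0 [F [iF F0 e]].
have Nd0 : (0 < N * d)%N by rewrite muln_gt0 N0.
have ic : c \in @algint C by rewrite /c -[b%:R]/(b%:Z%:~R); exact: algint_ee_div.
have icV : c^-1 \in @algint C.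
  rewrite /c -eeN -mulNr (_ : - b%:R = (- b%:Z)%:~R :> C) ?rmorphN //.
  by have := algint_ee_div (- b%:Z) Nd0; rewrite rmorphN.
have c1 : cmod c = 1 by rewrite /c -[b%:R]/(b%:Z%:~R); exact: cmod_ee_div.
exists (fun t => c ^ M * F (c * t ^+ (a ^ 2))); split.
- apply: int_series_scale; first exact: algint_exprz_unit.
  by apply: int_series_comp => //; rewrite expn_gt0 a0.
- by rewrite expr0n expn_eq0 /= eqn0Ngt a0 /= mulr0 F0.
- move=> z zu; rewrite e.
    have n0 (k : nat) : (0 < k)%N -> (k%:R : C) != 0 by rewrite pnatr_eq0 -lt0n.
    have -> : ee ((a%:R * z + b%:R) / d%:R / N%:R) = c * ee (z / (N * (a * d))%:R) ^+ (a ^ 2).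
      rewrite /c -ee_natl -eeD natrX !natrM; congr ee.
      move: (n0 _ N0) (n0 _ a0) (n0 _ d0); move: (N%:R : C) (a%:R : C) (d%:R : C) (b%:R : C).
      by move=> N' a' d' b' h1 h2 h3; field; rewrite h1 h2 h3.
    have tM (t : C) (k : nat) : (t ^+ k) ^ M = t ^ (M * k%:Z).
      by rewrite exprnP exprz_exp mulrC.
    rewrite exprzMl ?unitfE ?expf_neq0 ?ee_neq0 // tM -mulrA mulrCA //.
  case: d d0 {Nd0 c ic icV c1} => // d _; apply: upper_divn; rewrite upperDn.
  by case: a a0 => // a _; exact: upper_natM.
Qed.

Lemma qexp_level N M u f k : (0 < N)%N -> (0 < k)%N -> qexp N M u f ->
  qexp (N * k) (M * k%:Z) u f.
Proof.
move=> N0 k0 [F [iF F0 e]]; exists (fun t => F (1 * t ^+ k)); split.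
- by apply: int_series_comp; rewrite ?rpred1 ?cmod1.
- by rewrite expr0n eqn0Ngt k0 /= mulr0.
- move=> z zu; rewrite e // mul1r.
  have -> : ee (z / N%:R) = ee (z / (N * k)%:R) ^+ k.
    rewrite -ee_natl natrM; congr ee.
    have Nn : (N%:R : C) != 0 by rewrite pnatr_eq0 -lt0n.
    have kn : (k%:R : C) != 0 by rewrite pnatr_eq0 -lt0n.
    by field; rewrite Nn kn.
  by congr (_ * _); rewrite exprnP exprz_exp (mulrC M).
Qed.

End QExpansions.

Section ModularFunctions.
Variable R : realType.
Local Notation C := R[i].
Local Notation Im := complex.Im.
Local Notation Re := complex.Re.
Implicit Types (t w z : C) (f g : C -> C).

Definition modular f := (forall z, upper z -> f (- z^-1) = f z) /\
  (forall z (k : int), upper z -> f (z + k%:~R) = f z).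

Lemma intrC (k : int) : (k%:~R : C) = (k%:~R : R)%:C%C.
Proof. by rewrite rmorph_int. Qed.

Lemma upperDz z (k : int) : upper (z + k%:~R) = upper z.
Proof. by rewrite intrC upperDreal. Qed.

(* Inversion at least doubles an imaginary part below 1/2, once the real part is reduced. *)
Lemma half_plane_reduction f z : modular f -> upper z ->
  exists z', [/\ upper z', 2^-1 <= Im z' & f z' = f z].
Proof.
move=> [fS fT] zu.
have [n hn] : exists n : nat, 2 ^- n <= Im z.
  have h2 : 0 <= (2^-1 : R) < 1 by apply/andP; split; lra.
  by have [m /(_ m (leqnn m)) hm] := expr_small h2 zu; exists m; rewrite -exprVn ltW.
elim: n z zu hn => [|n IH] z zu hn.
  by exists z; split => //; move: hn; rewrite expr0; lra.
have [le|lt] := leP 2^-1 (Im z); first by exists z.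
pose k : int := - Num.floor (Re z + 2^-1).
pose w := z + k%:~R; have wu : upper w by rewrite upperDz.
have Iw : Im w = Im z by rewrite /w intrC; case: (z) => a b /=; rewrite addr0.
have Rw : `|Re w| <= 2^-1.
  have -> : Re w = Re z + k%:~R by rewrite /w intrC; case: (z).
  rewrite /k rmorphN /=; have /andP[] := floor_itv (Re z + 2^-1).
  rewrite intrD ler_norml => h1 h2; apply/andP; split; lra.
have su := upper_inv wu.
have Is : Im (- w^-1) = Im w / (Re w ^+ 2 + Im w ^+ 2).
  by case: (w) => a b /=; rewrite ?mulNr opprK.
have [|z' [z'u Iz' e]] := IH _ su.
  rewrite Is Iw; move: hn zu; rewrite /upper => hn zu.
  have d0 : 0 < Re w ^+ 2 + Im z ^+ 2 by rewrite ltr_wpDl ?sqr_ge0 // exprn_gt0.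
  rewrite ler_pdivlMr //.
  have r2 : Re w ^+ 2 <= 2^-1 ^+ 2.
    by rewrite -[leLHS]real_normK ?num_real //; apply: lerXn2r; rewrite ?nnegrE.
  have i2 : Im z ^+ 2 <= 2^-1 ^+ 2 by apply: lerXn2r; rewrite ?nnegrE ltW.
  have : 2 ^- n.+1 = 2 ^- n / 2 :> R by rewrite exprSr invfM.
  have p0 : 0 <= 2 ^- n :> R by rewrite invr_ge0 exprn_ge0.
  move: (Re w ^+ 2) (Im z ^+ 2) r2 i2 => x y r2 i2 e.
  apply: (@le_trans _ _ (2 ^- n * 2^-1)); last by rewrite -e.
  by rewrite ler_wpM2l //; move: r2 i2; rewrite expr2; lra.
by exists z'; split=> //; rewrite e fS // fT.
Qed.

(** The disc |t| <= r0 = exp (-pi/N), that is Im z >= 1/2, meets every orbit, so a bound for P there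
    holds on the whole disc. The maximum principle for F = P / t on the circle of radius rho > r0
    then improves the bound by the factor r0 / rho, and iteration gives 0. *)
Lemma qexp_modular_eq0 N u f : (0 < N)%N -> qexp N 1 u f -> modular f ->
  forall z, upper z -> f z = 0.
Proof.
case: N => // N _ [F [iF _ e]] mf; set n := N.+1 in e.
have hF := int_series_hol iF.
pose P t := t * F t.
have eP z : upper z -> f z = P (ee (z / n%:R)) by move=> zu; rewrite e // expr1z.
have pi0 := pi_gt0 R.
pose r0 := expR (- (pi / n%:R)) : R.
have r00 : 0 < r0 by exact: expR_gt0.
have r01 : r0 < 1 by rewrite -expR0 ltr_expR oppr_lt0 divr_gt0.
have Imn z : Im (z / n%:R) = Im z / n%:R.
  by rewrite natrC -fmorphV; case: z => a b /=; rewrite mulr0 add0r.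
have fund B : (forall t, cmod t <= r0 -> cmod (P t) <= B) ->
    forall w, cmod w < 1 -> cmod (P w) <= B.
  move=> hB w w1; have [->|w0] := eqVneq w 0.
    by apply: hB; rewrite cmod0 ltW.
  have [s es] := ee_surj w0.
  have su : upper s.
    move: w1; rewrite -es cmod_ee -expR0 ltr_expR oppr_lt0 /upper.
    by rewrite pmulr_rgt0 // mulr_gt0.
  have ns : upper (n%:R * s) by exact: upper_natM.
  have [z' [z'u Iz' fz']] := half_plane_reduction mf ns.
  have -> : P w = P (ee (z' / n%:R)).
    rewrite -eP // fz' eP //; congr (P _).
    by rewrite mulrC mulKf ?pnatr_eq0 // es.
  apply: hB; rewrite cmod_ee ler_expR lerN2 Imn mulrA ler_pM2r ?invr_gt0 //.
  by move: pi0 Iz'; nra.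
pose rho := (1 + r0) / 2.
have rho01 : 0 < rho < 1 by rewrite /rho; apply/andP; split; lra.
have r0rho : r0 < rho by rewrite /rho; lra.
pose kap := r0 / rho.
have kap01 : 0 <= kap < 1.
  case/andP: rho01 => h _; rewrite /kap divr_ge0 ?(ltW h) ?(ltW r00) //=.
  by rewrite ltr_pdivrMr // mul1r.
have shrink B : (forall t, cmod t <= r0 -> cmod (P t) <= B) ->
    forall t, cmod t <= r0 -> cmod (P t) <= kap * B.
  move=> hB t tr; have [rho0 rho1] := andP rho01.
  have hFc w : cmod w = rho -> cmod (F w) <= B / rho.
    move=> wr; have w1 : cmod w < 1 by rewrite wr.
    by rewrite ler_pdivlMr // -wr mulrC -cmodM; exact: (fund B).
  have := disc_hol_max hF rho01 hFc (le_lt_trans tr r0rho).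
  rewrite /P cmodM => h.
  have -> : kap * B = r0 * (B / rho) by rewrite /kap mulrAC -mulrA.
  by apply: ler_pM; rewrite ?cmod_ge0.
have hPh : disc_hol P.
  apply: disc_holM => //.
  by apply: (eq_disc_hol (F := fun t => t ^+ 1)) => //; exact: disc_holX.
have [B B0 hB] := disc_hol_bounded hPh r01.
have iter k : forall t, cmod t <= r0 -> cmod (P t) <= kap ^+ k * B.
  elim: k => [|k IH] t tr; first by rewrite expr0 mul1r; exact: hB.
  by rewrite exprS -mulrA; exact: shrink.
have P0 t : cmod t <= r0 -> cmod (P t) <= 0.
  move=> tr; apply/ler_addgt0Pr => d d0; rewrite add0r.
  have [m /(_ m (leqnn m)) hm] := expr_small kap01 (divr_gt0 d0 B0).
  apply: (le_trans (iter m t tr)); rewrite -ler_pdivlMr // ltW //.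
move=> z zu; apply/eqP; rewrite -cmod_eq0 eq_le cmod_ge0 andbT eP //.
by apply: (fund 0 P0); apply: cmod_ee_upper; exact: upper_divn.
Qed.

Lemma modular_sub_scale f g (a : C) k : modular f -> modular g ->
  modular (fun z => f z - a * g z ^+ k).
Proof.
by move=> [fS fT] [gS gT]; split=> z; [move=> zu; rewrite fS // gS | move=> j zu; rewrite fT // gT].
Qed.

(** z |-> z + 1 multiplies t = e(z/N) by a primitive N-th root of unity; comparison of the leading
    terms gives zeta^M u = u. *)
Lemma qexp_periodic N M u f : (0 < N)%N -> qexp N M u f -> modular f ->
  ~~ (N%:Z %| M)%Z -> u = 0.
Proof.
move=> N0 [F [iF F0 e]] [_ fT] NM; have hF := int_series_hol iF.
pose z0 := zeta R N; have zp := zeta_prim R N0.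
have z0n : z0 != 0 by exact: ee_neq0.
have cz : cmod z0 = 1.
  by have := cmod_ee_div R 1 N; rewrite rmorph1 mul1r.
have key : z0 ^ M * F 0 = F 0.
  have hG : disc_hol (fun t => z0 ^ M * F (z0 * t ^+ 1)).
    by apply: disc_holM; [exact: disc_hol_cst | exact: disc_hol_comp].
  have := @disc_hol_eq0 _ _ _ hG hF; rewrite /= mulr0; apply => t /andP[t0 t1].
  rewrite cmod_gt0 in t0; have [s es] := ee_surj t0.
  have su : upper s.
    move: t1; rewrite -es cmod_ee -expR0 ltr_expR oppr_lt0 /upper.
    by rewrite pmulr_rgt0 // mulr_gt0 // pi_gt0.
  have Nn : (N%:R : C) != 0 by rewrite pnatr_eq0 -lt0n.
  have Nu : upper (N%:R * s) by case: (N) N0 => // k _; exact: upper_natM.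
  have sN : N%:R * s / N%:R = s by rewrite mulrC mulKf.
  have := fT _ 1 Nu; rewrite !e ?upperDz // rmorph1 mulrDl sN eeD es div1r -/(zeta R N) -/z0.
  move=> E; apply: (mulfI (expfz_neq0 M t0)).
  by rewrite -E expr1 [z0 * t]mulrC mulrA -exprzMl ?unitfE.
apply: contraNeq NM => u0; rewrite -F0 in u0.
have zM : z0 ^ M = 1 by apply: (mulIf u0); rewrite mul1r.
case: M zM {key e} => k zk.
  by rewrite dvdzE /= (prim_order_dvd zp); apply/eqP; exact: zk.
rewrite dvdzE /= (prim_order_dvd zp); apply/eqP/invr_inj.
by rewrite invr1; exact: zk.
Qed.

End ModularFunctions.

(** * Polynomials in a Hauptmodul *)

Section HauptmodulPolynomials.
Variable R : realType.
Local Notation C := R[i].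
Implicit Types (z : C) (f : C -> C).

Variables (N : nat) (J : C -> C).
Hypotheses (N0 : (0 < N)%N) (qJ : qexp N (- N%:Z) 1 J) (mJ : modular J).

(** Descent on the pole order k: if N divides k, subtracting u J^(k/N) lowers it, and otherwise the
    leading coefficient is 0 by periodicity. What remains after the constant term vanishes at
    infinity. The degree and the top coefficient are recorded for the polynomials with unit leading
    coefficient. *)
Lemma modular_poly_lead k u f : qexp N (- k%:Z) u f -> modular f ->
  exists p : {poly C}, [/\ p \is a polyOver (@algint C),
    forall z, upper z -> f z = p.[J z],
    (size p <= (k %/ N).+1)%N & (N %| k)%N -> p`_(k %/ N) = u].
Proof.
have qJl (a : C) l : a \in @algint C ->
    qexp N (- (l * N)%N%:Z) (- a) (fun z => - (a * J z ^+ l)).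
  move=> ia; have := qexpN (qexpZ ia (qexp_expn l qJ)).
  by rewrite expr1n mulr1 mulNr -PoszM mulnC.
elim: k u f => [|k IH] u f qf mf.
  have iu := qexp_alg qf.
  exists u%:P; split; rewrite ?polyOverC ?div0n ?coefC ?size_polyC_leq1 //.
  move=> z zu; rewrite hornerC; apply/eqP; rewrite -subr_eq0; apply/eqP.
  have := qexpD qf (qJl u 0%N iu); rewrite subrr => /(qexp_strict N0)[v qv].
  have := qexp_modular_eq0 N0 qv (modular_sub_scale u 0 mf mJ) zu.
  by rewrite expr0 mulr1.
have kS : - k.+1%:Z + 1 = - k%:Z by rewrite -[k.+1]add1n PoszD opprD addrAC addNr add0r.
have [dv|ndv] := boolP (N %| k.+1)%N; last first.
  have u0 : u = 0.
    by apply: (qexp_periodic N0 qf mf); rewrite dvdzE abszN.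
  rewrite u0 in qf; have [v] := qexp_strict N0 qf; rewrite kS => qv.
  have [p [ip ep sp _]] := IH _ _ qv mf; exists p; split => //.
  by rewrite divnS // (negbTE ndv).
set l := (k.+1 %/ N)%N; have lE : (l * N)%N = k.+1 by rewrite divnK.
have iu := qexp_alg qf.
have := qJl u l iu; rewrite lE => qu; have := qexpD qf qu; rewrite subrr.
move=> /(qexp_strict N0)[v]; rewrite kS => qv.
have [p [ip ep sp _]] := IH _ _ qv (modular_sub_scale u l mf mJ).
have sl : (size p <= l)%N.
  by apply: (leq_trans sp); rewrite /l divnS // dv.
exists (p + u *: 'X^l); split.
- by rewrite rpredD // polyOverZ // rpredX // polyOverX.
- by move=> z zu; rewrite hornerD hornerZ hornerXn -ep // subrK.
- rewrite (leq_trans (size_polyD _ _)) // geq_max (leq_trans sl) //.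
  by rewrite (leq_trans (size_scale_leq _ _)) // size_polyXn.
- by move=> _; rewrite coefD coefZ coefXn eqxx mulr1 nth_default // add0r.
Qed.

Lemma modular_poly M u f : qexp N M u f -> modular f ->
  exists2 p : {poly C}, p \is a polyOver (@algint C) & forall z, upper z -> f z = p.[J z].
Proof.
move=> qf mf.
have [k [v qv]] : exists k v, qexp N (- k%:Z) v f.
  case: M qf => k qf; last by exists k.+1, u; rewrite -NegzE.
  by exists 0%N; apply: (@qexp_lift _ _ _ k u); rewrite oppr0 add0r.
by have [p [ip ep _ _]] := modular_poly_lead qv mf; exists p.
Qed.

Lemma modular_unit_poly k u f : qexp N (- k%:Z) u f -> modular f -> u != 0 -> u^-1 \in @algint C ->
  exists2 p : {poly C}, p \is a polyOver (@algint C) /\ (lead_coef p)^-1 \in @algint C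
    & p != 0 /\ forall z, upper z -> f z = p.[J z].
Proof.
move=> qf mf u0 iu; have [p [ip ep sp lp]] := modular_poly_lead qf mf.
have dv : (N %| k)%N.
  by apply: contraNT u0 => ndv; apply/eqP/(qexp_periodic N0 qf mf); rewrite dvdzE abszN.
have lc := lp dv.
have szp : size p = (k %/ N).+1.
  by apply/eqP; rewrite eqn_leq sp ltnNge; apply: contra u0 => le; rewrite -lc nth_default.
exists p; split => //; first by rewrite lead_coefE szp lc.
by rewrite -size_poly_gt0 szp.
Qed.

End HauptmodulPolynomials.

(** * Integer matrices of a given determinant *)

Record imat := Imat { m00 : int; m01 : int; m10 : int; m11 : int }.

Definition idet M := m00 M * m11 M - m01 M * m10 M.

Definition imul M N := Imat
  (m00 M * m00 N + m01 M * m10 N) (m00 M * m01 N + m01 M * m11 N)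
  (m10 M * m00 N + m11 M * m10 N) (m10 M * m01 N + m11 M * m11 N).

Definition iS := Imat 0 (-1) 1 0.
Definition iT k := Imat 1 k 0 1.

Lemma imatE a b c d a' b' c' d' : a = a' -> b = b' -> c = c' -> d = d' ->
  Imat a b c d = Imat a' b' c' d'.
Proof. by move=> -> -> -> ->. Qed.

Lemma imulA M N P : imul M (imul N P) = imul (imul M N) P.
Proof. by case: M N P => [? ? ? ?] [? ? ? ?] [? ? ? ?]; apply: imatE => /=; ring. Qed.

Lemma idetM M N : idet (imul M N) = idet M * idet N.
Proof. by case: M N => [? ? ? ?] [? ? ? ?]; rewrite /idet /=; ring. Qed.

Definition iadj M := Imat (m11 M) (- m01 M) (- m10 M) (m00 M).

Lemma imul_adjl M : idet M = 1 -> imul (iadj M) M = iT 0.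
Proof. by case: M => a b c d; rewrite /idet /= => h; apply: imatE => /=; rewrite -?h; ring. Qed.

Lemma imul_adjr M : idet M = 1 -> imul M (iadj M) = iT 0.
Proof. by case: M => a b c d; rewrite /idet /= => h; apply: imatE => /=; rewrite -?h; ring. Qed.

Lemma idet_adj M : idet (iadj M) = idet M.
Proof. by case: M => a b c d; rewrite /idet /=; ring. Qed.

Lemma imul1 M : imul M (iT 0) = M.
Proof. by case: M => a b c d; apply: imatE => /=; ring. Qed.

Lemma imul1l M : imul (iT 0) M = M.
Proof. by case: M => a b c d; apply: imatE => /=; ring. Qed.

(** Left multiplication by words in [iS] and [iT k], so that an invariant has to be checked on these
    generators only. *)
Inductive sl2_equiv : imat -> imat -> Prop :=
| sl2_refl M : sl2_equiv M M
| sl2_S M M' : sl2_equiv (imul iS M) M' -> sl2_equiv M M'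
| sl2_T k M M' : sl2_equiv (imul (iT k) M) M' -> sl2_equiv M M'.

Lemma sl2_equiv_mul M M' : sl2_equiv M M' -> exists2 G, idet G = 1 & M' = imul G M.
Proof.
elim=> {M M'} [M|M M' _ [G dG ->]|k M M' _ [G dG ->]].
- by exists (iT 0); rewrite ?imul1l.
- by exists (imul G iS); rewrite ?imulA // idetM dG.
- by exists (imul G (iT k)); rewrite ?imulA // idetM dG /idet /=; ring.
Qed.

Lemma sl2_equiv_invariant (T : Type) (g : imat -> T) :
  (forall M, 0 < idet M -> g (imul iS M) = g M) ->
  (forall k M, 0 < idet M -> g (imul (iT k) M) = g M) ->
  forall M M', sl2_equiv M M' -> 0 < idet M -> g M = g M'.
Proof.
move=> gS gT M M'; elim=> {M M'} [//|M M' _ IH|k M M' _ IH] dM.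
  by rewrite -IH ?gS // idetM mul1r.
by rewrite -IH ?gT // idetM /idet /= ?mulr0 ?subr0 ?mulr1 ?mul1r.
Qed.

(** Parameters of the Hermite normal forms, one for each class of integer matrices of determinant n
    under left multiplication by SL2(Z). *)
Definition hermite_seq (n : nat) : seq (nat * nat) :=
  [seq (a, b) | a <- divisors n, b <- iota 0 (n %/ a)].

Definition hmat (n : nat) (p : nat * nat) := Imat p.1 p.2 0 (n %/ p.1)%N.

Lemma mem_hermite n a b : (0 < n)%N ->
  ((a, b) \in hermite_seq n) = (a %| n)%N && (b < n %/ a)%N.
Proof.
move=> n0; apply/allpairsPdep/andP => [[x [y [hx hy [-> ->]]]]|[an bn]].
  by rewrite dvdn_divisors // mem_iota in hx hy *.
by exists a, b; rewrite -dvdn_divisors // mem_iota.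
Qed.

Lemma uniq_hermite n : uniq (hermite_seq n).
Proof.
apply: allpairs_uniq_dep; first exact: divisors_uniq.
  by move=> a _; exact: iota_uniq.
by move=> [a b] [a' b'] _ _ /= [-> ->].
Qed.

Lemma hermite_dims n p : (0 < n)%N -> p \in hermite_seq n ->
  [/\ (0 < p.1)%N, (0 < n %/ p.1)%N, (p.1 * (n %/ p.1) = n)%N & (p.2 < n %/ p.1)%N].
Proof.
case: p => a b n0; rewrite mem_hermite // => /andP[an bn] /=.
have a0 : (0 < a)%N by exact: dvdn_gt0 an.
by split => //; [exact: leq_trans bn | rewrite mulnC divnK].
Qed.

Lemma idet_hmat n p : (0 < n)%N -> p \in hermite_seq n -> idet (hmat n p) = n%:Z.
Proof.
move=> n0 hp; have [_ _ e _] := hermite_dims n0 hp.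
by rewrite /idet /= mulr0 subr0 -PoszM e.
Qed.

Lemma modz_subE (a c : int) : (a %% c)%Z = a - (a %/ c)%Z * c.
Proof. by rewrite {2}(divz_eq a c) addrAC subrr add0r. Qed.

(** Euclid's algorithm on the first column, by induction on the absolute value of the lower left
    entry. *)
Lemma hermite_exists n M : (0 < n)%N -> idet M = n%:Z ->
  exists2 p, p \in hermite_seq n & sl2_equiv M (hmat n p).
Proof.
move=> n0; have [k] := ubnP (absz (m10 M)); elim: k M => // k IH M hk dM.
have [c0|cn0] := eqVneq (m10 M) 0; last first.
  pose q := (m00 M %/ m10 M)%Z.
  have [||p hp ep] := IH (imul iS (imul (iT (- q)) M)).
  - have -> : m10 (imul iS (imul (iT (- q)) M)) = (m00 M %% m10 M)%Z.
      by rewrite /= modz_subE /q; case: M {hk dM cn0 q} => a b c d /=; ring.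
    have := ltz_mod (m00 M) cn0; have := modz_ge0 (m00 M) cn0; lia.
  - by rewrite !idetM dM /idet /=; ring.
  by exists p => //; apply: (@sl2_T (- q)); apply: sl2_S.
(* An upper triangular matrix with positive diagonal only needs its upper right entry reduced by a
   translation. *)
have pos M1 : m10 M1 = 0 -> idet M1 = n%:Z -> 0 < m00 M1 ->
    exists2 p, p \in hermite_seq n & sl2_equiv M1 (hmat n p).
  case: M1 => a b c d /= -> {IH}; rewrite /idet /= mulr0 subr0.
  case: a => // a ad a0; have d0 : 0 < d by rewrite -(pmulr_rgt0 d a0) ad.
  case: d ad d0 => // d; rewrite -PoszM => -[ad] d0.
  have a0' : (0 < a)%N by [].
  have nd : (n %/ a)%N = d by rewrite -ad mulKn.
  pose q := (b %/ d)%Z; have dn0 : d%:Z != 0 by rewrite gt_eqF.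
  have rE : (b %% d)%Z = b + (- q) * d by rewrite modz_subE mulNr.
  have r0 := modz_ge0 b dn0; have r1 := ltz_pmod b d0.
  exists (a, absz (b %% d)%Z).
    by rewrite mem_hermite // -{1}ad dvdn_mulr //= nd; lia.
  apply: (@sl2_T (- q)); rewrite /hmat /= nd gez0_abs //.
  have -> : imul (iT (- q)) (Imat a b 0 d) = Imat a (b %% d)%Z 0 d.
    by apply: imatE => /=; rewrite ?rE; ring.
  exact: sl2_refl.
have [a0|a0] := ltP 0 (m00 M); first exact: pos.
have an0 : m00 M != 0.
  by apply: contra_eq_neq dM => a00; rewrite /idet a00 c0 mul0r mulr0 subrr eq_sym; lia.
(* S^2 = -1 makes both diagonal entries positive. *)
have [|||p hp ep] := pos (imul iS (imul iS M)).
- by move: c0; case: (M) => a b c d /= ->; ring.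
- by rewrite !idetM dM /idet /=; ring.
- by move: a0 an0; case: (M) => a b c d /=; lia.
by exists p => //; apply: sl2_S; apply: sl2_S.
Qed.

Lemma hermite_unique n p p' G : (0 < n)%N -> p \in hermite_seq n -> p' \in hermite_seq n ->
  idet G = 1 -> hmat n p' = imul G (hmat n p) -> p = p'.
Proof.
move=> n0 hp hp'; have [a0 d0 ad bd] := hermite_dims n0 hp.
have [a0' d0' ad' bd'] := hermite_dims n0 hp'.
case: G => x y z w; rewrite /idet /hmat /imul /= => dG [].
rewrite !mulr0 !addr0; case: p p' {hp hp'} a0 d0 ad bd a0' d0' ad' bd' => [a b] [a' b'] /=.
move: (n %/ a)%N (n %/ a')%N => d d' a0 d0 ad bd a0' d0' ad' bd' e1 e2 e3 e4.
have z0 : z = 0 by move/esym/eqP: e3; rewrite mulf_eq0 => /orP[/eqP //|/eqP h]; lia.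
rewrite z0 in dG e4; have xw : x * w = 1 by lia.
have x0 : 0 < x by rewrite -(pmulr_lgt0 x (_ : 0 < a%:Z)) // -e1; lia.
have w0 : 0 < w by rewrite -(pmulr_rgt0 w x0) xw.
have x1 : x = 1 by nia.
have w1 : w = 1 by rewrite x1 in xw; lia.
rewrite x1 in e1 e2; have a1 : a = a' by lia.
have d1 : d = d' by rewrite w1 in e4; lia.
rewrite -d1 in bd' e4; have y0 : y = 0 by nia.
by rewrite y0 in e2; congr pair; lia.
Qed.

(** Right multiplication by N acts on the classes under left multiplication; N being invertible, the
    induced map on the finite list of representatives is injective. *)
Lemma hermite_permute n N : (0 < n)%N -> idet N = 1 ->
  exists2 s : nat * nat -> nat * nat, perm_eq (map s (hermite_seq n)) (hermite_seq n) &
    forall p, p \in hermite_seq n -> sl2_equiv (imul (hmat n p) N) (hmat n (s p)).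
Proof.
move=> n0 dN.
have /choice[s hs] : forall p, exists p', p \in hermite_seq n ->
    p' \in hermite_seq n /\ sl2_equiv (imul (hmat n p) N) (hmat n p').
  move=> p; have [hp|hp] := boolP (p \in hermite_seq n); last by exists p.
  have [|p' hp' e] := @hermite_exists n (imul (hmat n p) N) n0; last by exists p'.
  by rewrite idetM dN mulr1 idet_hmat.
exists s; last by move=> p /hs[].
have inj : {in hermite_seq n &, injective s}.
  move=> p p' hp hp' e; have [_ /sl2_equiv_mul[G dG eG]] := hs p hp.
  have [_ /sl2_equiv_mul[G' dG' eG']] := hs p' hp'.
  apply: (@hermite_unique n p p' (imul (iadj G') G)) => //.
    by rewrite idetM idet_adj dG dG'.
  have : imul G (imul (hmat n p) N) = imul G' (imul (hmat n p') N) by rewrite -eG -eG' e.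
  move=> /(congr1 (fun X => imul (imul (iadj G') X) (iadj N))).
  have NK X : imul (imul X N) (iadj N) = X by rewrite -imulA imul_adjr // imul1.
  by rewrite !imulA imul_adjl // imul1l !NK => <-.
have us : uniq (map s (hermite_seq n)) by rewrite map_inj_in_uniq // uniq_hermite.
have sub : {subset map s (hermite_seq n) <= hermite_seq n}.
  by move=> _ /mapP[p hp ->]; have [] := hs p hp.
have [_ e] := uniq_min_size us sub (eq_leq (esym (size_map _ _))).
by apply: uniq_perm => //; exact: uniq_hermite.
Qed.

(** * Integer matrices acting on points and functions *)

Section MatrixActions.
Variable R : realType.
Local Notation C := R[i].
Local Notation Im := complex.Im.
Implicit Types (z : C) (M N : imat).

Definition iden M z : C := (m10 M)%:~R * z + (m11 M)%:~R.
Definition mobius M z : C := ((m00 M)%:~R * z + (m01 M)%:~R) / iden M z.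

Lemma Im_affine (a b : int) z : Im (a%:~R * z + b%:~R) = a%:~R * Im z.
Proof. by rewrite !intrC; case: z => x y /=; rewrite mul0r !addr0. Qed.

Lemma iden_neq0 M z : 0 < idet M -> upper z -> iden M z != 0.
Proof.
move=> dM zu; have [c0|c0] := eqVneq (m10 M) 0.
  rewrite /iden c0 mul0r add0r intr_eq0; apply: contraTneq dM => d0.
  by rewrite /idet c0 d0 !mulr0 subrr ltxx.
by apply: nonreal_neq0; rewrite Im_affine mulf_neq0 ?intr_eq0 // gt_eqF.
Qed.

Lemma Im_div (p q r s : R) : (r +i* s)%C != 0 ->
  Im ((p +i* q) / (r +i* s))%C = (q * r - p * s) / (r ^+ 2 + s ^+ 2).
Proof.
move=> n0 /=; have : r ^+ 2 + s ^+ 2 != 0 by rewrite -(sqr_cmod (r +i* s)%C) expf_neq0 // cmod_eq0.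
by move=> h; rewrite -mulrN; field.
Qed.

Lemma upper_mobius M z : 0 < idet M -> upper z -> upper (mobius M z).
Proof.
move=> dM zu; have := iden_neq0 dM zu; rewrite /upper /mobius /iden !intrC.
move: dM zu; rewrite /upper /idet; case: M => a b c d; case: z => x y; rewrite /m00 /m01 /m10 /m11 => dM y0.
have aff (p q : R) : (p%:C * (x +i* y) + q%:C = (p * x + q) +i* (p * y))%C.
  by apply/eqP; rewrite eq_complex /=; apply/andP; split; apply/eqP; ring.
rewrite !aff => n0; rewrite Im_div //.
have d0 : 0 < (c%:~R * x + d%:~R) ^+ 2 + (c%:~R * y) ^+ 2.
  rewrite -[X in _ < X](sqr_cmod ((c%:~R * x + d%:~R) +i* (c%:~R * y))%C).
  by rewrite exprn_gt0 // cmod_gt0.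
rewrite divr_gt0 //.
have -> : a%:~R * y * (c%:~R * x + d%:~R) - (a%:~R * x + b%:~R) * (c%:~R * y) =
  (a * d - b * c)%:~R * y by rewrite intrB !intrM; ring.
by rewrite mulr_gt0 // ltr0z.
Qed.

Lemma iden_mul M N z : 0 < idet N -> upper z ->
  iden (imul M N) z = iden M (mobius N z) * iden N z.
Proof.
move=> dN zu; have n0 := iden_neq0 dN zu.
rewrite {1 2}/iden mulrDl /mobius -mulrA divfK //.
by case: M N {dN n0} => [a b c d] [a' b' c' d'] /=; rewrite /iden !intrD !intrM /=; ring.
Qed.

Lemma mobius_mul M N z : 0 < idet N -> upper z ->
  mobius (imul M N) z = mobius M (mobius N z).
Proof.
move=> dN zu; have n0 := iden_neq0 dN zu; rewrite {1}/mobius iden_mul // {2}/mobius.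
have -> : (m00 (imul M N))%:~R * z + (m01 (imul M N))%:~R =
   ((m00 M)%:~R * mobius N z + (m01 M)%:~R) * iden N z.
  rewrite mulrDl /mobius -[RHS]/(_ * _ * _ + _) -[X in _ = X + _]mulrA divfK //.
  by case: M N {dN n0} => [a b c d] [a' b' c' d'] /=; rewrite /iden !intrD !intrM /=; ring.
by rewrite -mulf_div divff // mulr1.
Qed.

Lemma mobius_S z : mobius iS z = - z^-1.
Proof. by rewrite /mobius /iden /= rmorphN rmorph1 mul0r add0r mul1r addr0 mulN1r. Qed.

Lemma iden_S z : iden iS z = z.
Proof. by rewrite /iden /= rmorph1 mul1r addr0. Qed.

Lemma mobius_T k z : mobius (iT k) z = z + k%:~R.
Proof. by rewrite /mobius /iden /= rmorph1 mul1r mul0r add0r divr1. Qed.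

Lemma iden_T k z : iden (iT k) z = 1.
Proof. by rewrite /iden /= mul0r add0r. Qed.

Lemma idet_T k : idet (iT k) = 1. Proof. by rewrite /idet /= mulr0 subr0 mulr1. Qed.

Lemma Delta_period z (k : int) : Delta (z + k%:~R) = Delta z.
Proof. by rewrite /Delta eeD ee_int mulr1. Qed.

(** The slash operator of weight 12 on [Delta], without its determinant factor, which enters in
    [delta_quotient]. *)
Definition slash M z : C := Delta (mobius M z) / iden M z ^+ 12.

Lemma slash_Sl M z : 0 < idet M -> upper z -> slash (imul iS M) z = slash M z.
Proof.
move=> dM zu; have zu' := upper_mobius dM zu; have n0 := iden_neq0 dM zu.
rewrite /slash mobius_mul // mobius_S Delta_inv // iden_mul // iden_S [(mobius M z * iden M z) ^+ 12]exprMn.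
by rewrite -[LHS]mulf_div divff ?mul1r // expf_neq0 // upper_neq0.
Qed.

Lemma slash_Tl k M z : 0 < idet M -> upper z -> slash (imul (iT k) M) z = slash M z.
Proof.
move=> dM zu; rewrite /slash mobius_mul // mobius_T Delta_period iden_mul // iden_T.
by rewrite mul1r.
Qed.

Definition modular_gen N := N = iS \/ exists k, N = iT k.

Lemma modular_gen_det N : modular_gen N -> idet N = 1.
Proof. by case=> [->|[k ->]]; rewrite ?idet_T. Qed.

Lemma Delta_gen N z : modular_gen N -> upper z ->
  Delta (mobius N z) = iden N z ^+ 12 * Delta z.
Proof.
move=> [->|[k ->]] zu; first by rewrite mobius_S iden_S Delta_inv.
by rewrite mobius_T iden_T Delta_period expr1n mul1r.
Qed.

Lemma slash_gen M N z : modular_gen N -> 0 < idet M -> upper z ->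
  slash M (mobius N z) = iden N z ^+ 12 * slash (imul M N) z.
Proof.
move=> gN dM zu; have dN : 0 < idet N by rewrite modular_gen_det.
rewrite /slash mobius_mul // iden_mul //.
have := expf_neq0 12 (iden_neq0 dN zu).
move: (Delta _) (iden M _) (iden N z) => D u n n0.
by rewrite [RHS]mulrCA; congr (_ * _); rewrite [(u * n) ^+ 12]exprMn;
  move: (u ^+ 12) (n ^+ 12) n0 => a b b0; rewrite invfM mulrCA divff ?mulr1.
Qed.

(* A function of an integer matrix and a point that only depends on the SL2(Z)-class of the
   matrix and on which SL2(Z) acts compatibly on both arguments. *)
Definition modular_family (g : imat -> C -> C) :=
  (forall M N z, modular_gen N -> 0 < idet M -> upper z -> g (imul N M) z = g M z) /\
  (forall M N z, modular_gen N -> 0 < idet M -> upper z ->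
     g M (mobius N z) = g (imul M N) z).

Lemma modular_family_equiv g M M' z : modular_family g -> sl2_equiv M M' -> 0 < idet M ->
  upper z -> g M z = g M' z.
Proof.
move=> [gl _] e dM zu; apply: (sl2_equiv_invariant (g := g^~ z)) e dM.
  by move=> M1 d1; apply: gl => //; left.
by move=> k M1 d1; apply: gl => //; right; exists k.
Qed.

(** Replacing z by N z only permutes the terms. The operation is arbitrary so as to cover sums,
    products and products of polynomials X - g. *)
Lemma big_hermite (A : Type) (idx : A) (op : Monoid.com_law idx) (h : C -> A) g n N z :
  modular_family g -> modular_gen N -> (0 < n)%N -> upper z ->
  \big[op/idx]_(p <- hermite_seq n) h (g (hmat n p) (mobius N z)) =
  \big[op/idx]_(p <- hermite_seq n) h (g (hmat n p) z).
Proof.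
move=> fg gN n0 zu; have dN := modular_gen_det gN.
have [s ps es] := hermite_permute n0 dN.
rewrite -[RHS](perm_big _ ps) big_map big_seq [RHS]big_seq; apply: eq_bigr => p hp; congr h.
have dp : 0 < idet (hmat n p) by rewrite idet_hmat.
rewrite (proj2 fg) //; apply: modular_family_equiv (es p hp) _ zu => //.
by rewrite idetM dN mulr1.
Qed.

Lemma modular_of_gen (f : C -> C) :
  (forall N z, modular_gen N -> upper z -> f (mobius N z) = f z) -> modular f.
Proof.
move=> h; split=> [z zu|z k zu]; first by rewrite -mobius_S; apply: h => //; left.
by rewrite -mobius_T; apply: h => //; right; exists k.
Qed.

Lemma modular_gen_inv (f : C -> C) N z : modular f -> modular_gen N -> upper z ->
  f (mobius N z) = f z.
Proof. by move=> [fS fT] [->|[k ->]] zu; rewrite ?mobius_S ?mobius_T ?fS ?fT. Qed.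

Lemma modular_family_mobius (f : C -> C) : modular f ->
  modular_family (fun M z => f (mobius M z)).
Proof.
move=> mf; split=> M N z gN dM zu; last by rewrite mobius_mul ?modular_gen_det.
by rewrite mobius_mul // modular_gen_inv // upper_mobius.
Qed.

Lemma modular_family2 (op : C -> C -> C) f g : modular f -> modular_family g ->
  modular_family (fun M z => op (f z) (g M z)).
Proof.
move=> mf [gl gr]; split=> M N z gN dM zu; first by rewrite gl.
by rewrite gr // modular_gen_inv.
Qed.

Definition delta_quotient M z : C := (idet M)%:~R ^+ 12 * (slash M z / Delta z).

Lemma modular_family_delta : modular_family delta_quotient.
Proof.
split=> M N z gN dM zu; have dN := modular_gen_det gN.
  rewrite /delta_quotient idetM dN mul1r; congr (_ * (_ / _)).
  by case: gN => [->|[k ->]]; [exact: slash_Sl | exact: slash_Tl].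
rewrite /delta_quotient idetM dN (mulr1 (idet M)).
suff -> : slash M (mobius N z) / Delta (mobius N z) = slash (imul M N) z / Delta z by [].
rewrite (slash_gen gN dM zu) (Delta_gen gN zu).
have : iden N z ^+ 12 != 0 by apply: expf_neq0; apply: iden_neq0; rewrite ?dN.
move: (iden N z ^+ 12) (slash _ _) (Delta _) => k x y k0.
by rewrite -mulf_div divff // mul1r.
Qed.

Lemma delta_quotient_hmat n p z : (0 < n)%N -> p \in hermite_seq n -> upper z ->
  delta_quotient (hmat n p) z =
  p.1%:R ^+ 12 * (Delta ((p.1%:R * z + p.2%:R) / (n %/ p.1)%:R) / Delta z).
Proof.
move=> n0 hp zu; have [a0 d0 ad _] := hermite_dims n0 hp.
rewrite /delta_quotient idet_hmat // /slash /mobius /iden /= mul0r add0r.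
rewrite -!pmulrn -{1}ad natrM exprMn.
have D0 : ((n %/ p.1)%:R : C) ^+ 12 != 0 by rewrite expf_neq0 // pnatr_eq0 -lt0n.
move: D0; move: ((n %/ p.1)%:R ^+ 12) (p.1%:R ^+ 12) (Delta _) (Delta z)^-1 => k c x y k0.
by field.
Qed.

Lemma qexp_Delta : qexp 1 1 1 (@Delta R).
Proof.
exists (fun t => euler t ^+ 24); split.
- by apply: int_series_expn; exact: int_series_euler.
- by rewrite euler0 expr1n.
- by move=> z _; rewrite divr1 expr1z.
Qed.

Lemma qexp_Delta_inv : qexp 1 (-1) 1 (fun z : C => (Delta z)^-1).
Proof.
exists (fun t => (euler t)^-1 ^+ 24); split.
- by apply: int_series_expn; exact: int_series_euler_inv.
- by rewrite euler0 invr1 expr1n.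
- by move=> z _; rewrite divr1 /Delta invfM exprVn.
Qed.

End MatrixActions.

(** * The Hauptmodul and points fixed by integer matrices *)

Section Hauptmodul.
Variable R : realType.
Local Notation C := R[i].
Implicit Types (z : C) (M N : imat).

(* The unit roots u(X) in the expansions of the quotients Delta(X z) / Delta(z). *)
Definition hroot (n : nat) (p : nat * nat) : C := ee (p.2%:R / (1 * (n %/ p.1))%:R).

Lemma hroot_unit n p (M : int) : (0 < n)%N -> p \in hermite_seq n ->
  [/\ hroot n p ^ M != 0, hroot n p ^ M \in @algint C & (hroot n p ^ M)^-1 \in @algint C].
Proof.
move=> n0 hp; have [a0 d0 _ _] := hermite_dims n0 hp.
have d1 : (0 < 1 * (n %/ p.1))%N by rewrite mul1n.
have i1 : hroot n p \in @algint C by exact: (algint_ee_div R p.2%:Z d1).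
have i2 : (hroot n p)^-1 \in @algint C.
  rewrite /hroot -eeN -mulNr.
  by have := algint_ee_div R (- p.2%:Z) d1; rewrite rmorphN.
split; first by rewrite expfz_neq0 // ee_neq0.
  exact: algint_exprz_unit.
by rewrite invr_expz; exact: algint_exprz_unit.
Qed.

Lemma qexp_comp_hmat n p (M : int) u (f : C -> C) : (0 < n)%N -> p \in hermite_seq n ->
  qexp 1 M u f ->
  qexp n (M * (p.1 ^ 2)%N%:Z) (hroot n p ^ M * u)
    (fun z => f ((p.1%:R * z + p.2%:R) / (n %/ p.1)%:R)).
Proof.
move=> n0 hp qf; have [a0 d0 ad _] := hermite_dims n0 hp.
by have := qexp_comp p.2 (isT : 0 < 1)%N a0 d0 qf; rewrite ad mul1n.
Qed.

Lemma qexp_delta_quotient n p : (0 < n)%N -> p \in hermite_seq n ->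
  qexp n ((p.1 ^ 2)%N%:Z - n%:Z) (p.1%:R ^+ 12 * hroot n p) (delta_quotient (hmat n p)).
Proof.
move=> n0 hp; have q1 := qexp_comp_hmat n0 hp (qexp_Delta R).
have q2 := qexp_level (isT : 0 < 1)%N n0 (qexp_Delta_inv R).
rewrite mul1n mulN1r in q2; rewrite mul1r expr1z mulr1 in q1.
have ia : (p.1%:R : C) ^+ 12 \in @algint C by rewrite rpredX // algint_nat.
have := qexpZ ia (qexpM q1 q2).
rewrite mulr1; apply: eq_qexp => z zu.
by rewrite (delta_quotient_hmat n0 hp zu).
Qed.

(** The factor n^12 makes the inverse integral, since n^12 / a^12 = (n / a)^12. *)
Lemma qexp_delta_quotient_inv n p : (0 < n)%N -> p \in hermite_seq n ->
  qexp n (n%:Z - (p.1 ^ 2)%N%:Z) ((n %/ p.1)%:R ^+ 12 * hroot n p ^ (-1))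
    (fun z => n%:R ^+ 12 * (delta_quotient (hmat n p) z)^-1).
Proof.
move=> n0 hp; have q1 := qexp_comp_hmat n0 hp (qexp_Delta_inv R).
have [a0 d0 ad _] := hermite_dims n0 hp.
have q2 := qexp_level (isT : 0 < 1)%N n0 (qexp_Delta R).
rewrite mul1n mul1r in q2; rewrite mulN1r mulr1 in q1.
have ia : ((n %/ p.1)%:R : C) ^+ 12 \in @algint C by rewrite rpredX // algint_nat.
have := qexpZ ia (qexpM q2 q1).
rewrite mul1r; apply: eq_qexp => z zu.
rewrite (delta_quotient_hmat n0 hp zu) -[X in _ = X%:R ^+ _ * _]ad natrM.
have a0' : (p.1%:R : C) ^+ 12 != 0 by rewrite expf_neq0 // pnatr_eq0 -lt0n.
have z1 := Delta_neq0 zu.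
have z2 : Delta ((p.1%:R * z + p.2%:R) / (n %/ p.1)%:R) != 0.
  have dX : 0 < idet (hmat n p) by rewrite idet_hmat.
  have := upper_mobius dX zu; rewrite /mobius /iden /= mul0r add0r; exact: Delta_neq0.
rewrite [(_ * _) ^+ 12]exprMn; move: a0' z1 z2.
move: ((n %/ p.1)%:R ^+ 12) (p.1%:R ^+ 12) (Delta z) (Delta _) => d a x y a0' x0 y0.
by field; rewrite a0' x0 y0.
Qed.

(** Among the three terms only that of (2, 0) has a pole at infinity, and it begins with q^-1. Hence
    this is the modular invariant j up to an additive constant, obtained without Eisenstein
    series. *)
Definition hauptmodul z : C :=
  \sum_(p <- hermite_seq 2) 2%:R ^+ 12 * (delta_quotient (hmat 2 p) z)^-1.

Lemma qexp_hauptmodul : qexp 2 (- 2%:Z) 1 hauptmodul.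
Proof.
have hE : hermite_seq 2 = [:: (1, 0); (1, 1); (2, 0)]%N by [].
have q p (hp : p \in hermite_seq 2) := qexp_delta_quotient_inv (isT : 0 < 2)%N hp.
have q1 := q (1, 0)%N isT; have q2 := q (1, 1)%N isT; have q3 := q (2, 0)%N isT.
(* The terms with a = 1 have order 2 - 1 = -2 + 3 in q^(1/2), hence coefficient 0 at order -2. *)
have w1 : qexp 2 (- 2%:Z) 0 (fun z : C => 2%:R ^+ 12 * (delta_quotient (hmat 2 (1, 0)%N) z)^-1).
  by apply: (@qexp_weaken _ _ _ 2); exact: q1.
have w2 : qexp 2 (- 2%:Z) 0 (fun z : C => 2%:R ^+ 12 * (delta_quotient (hmat 2 (1, 1)%N) z)^-1).
  by apply: (@qexp_weaken _ _ _ 2); exact: q2.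
have u3 : (2 %/ 2)%:R ^+ 12 * hroot 2 (2, 0)%N ^ (-1) = 1 :> C.
  by rewrite /hroot mul0r ee0 exp1rz mulr1 divnn expr1n.
have w3 : qexp 2 (- 2%:Z) 1 (fun z : C => 2%:R ^+ 12 * (delta_quotient (hmat 2 (2, 0)%N) z)^-1).
  by move: q3; rewrite [X in qexp _ _ X](_ : _ = 1).
have := qexpD w1 (qexpD w2 w3); rewrite !add0r; apply: eq_qexp => z _.
by rewrite /hauptmodul hE !big_cons big_nil addr0.
Qed.

Lemma modular_hauptmodul : modular hauptmodul.
Proof.
apply: modular_of_gen => N z gN zu.
exact: (big_hermite _ (fun x => 2%:R ^+ 12 * x^-1) (modular_family_delta R) gN).
Qed.

Lemma qexp_hauptmodul_level n : (0 < n)%N -> qexp (2 * n) (- (2 * n)%N%:Z) 1 hauptmodul.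
Proof.
by move=> n0; have := qexp_level (isT : 0 < 2)%N n0 qexp_hauptmodul; rewrite mulNr -PoszM.
Qed.

Lemma qexp_hauptmodul_hmat n p : (0 < n)%N -> p \in hermite_seq n -> exists u,
  [/\ u != 0, u^-1 \in @algint C &
  qexp (2 * n) (- (2 * p.1 ^ 2)%N%:Z) u (fun z => hauptmodul (mobius (hmat n p) z))].
Proof.
move=> n0 hp; have [a0 d0 ad _] := hermite_dims n0 hp.
have := qexp_comp p.2 (isT : 0 < 2)%N a0 d0 qexp_hauptmodul.
rewrite ad mulr1 mulNr -PoszM; set c := ee _ => q.
have d2 : (0 < 2 * (n %/ p.1))%N by rewrite muln_gt0.
have i1 : c \in @algint C by exact: (algint_ee_div R p.2%:Z d2).
exists (c ^ (- 2%:Z)); split.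
- by rewrite expfz_neq0 // ee_neq0.
- by rewrite invr_expz opprK; exact: rpredX.
- apply: eq_qexp q => z zu; rewrite /mobius /iden /= mul0r add0r.
  by [].
Qed.

Definition quadratic_point z := upper z /\
  exists u v d : int, [/\ u != 0, d < 0 & (u%:~R * z + v%:~R) ^+ 2 = d%:~R].

(** If a z^2 + b z + c = 0 and 4 a c - b^2 = k, then the matrix with rows (k - b, -2c) and (2a, b +
    k) fixes z and has determinant k^2 + k, which lies strictly between two consecutive squares. *)
Lemma quadratic_point_fixed z : quadratic_point z -> exists (k : nat) M,
  [/\ (0 < k)%N, idet M = (k * k.+1)%N%:Z & mobius M z = z].
Proof.
move=> [zu [u [v [d [u0 d0 e]]]]].
pose a := u ^+ 2; pose b := 2 * u * v; pose c := v ^+ 2 - d.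
pose k : nat := absz (4 * u ^+ 2 * d).
have u2 : 0 < u ^+ 2 by rewrite lt_def sqrf_eq0 u0 sqr_ge0.
have k0 : 4 * u ^+ 2 * d < 0 by rewrite pmulr_rlt0 // mulr_gt0.
have kE : k%:Z = - (4 * u ^+ 2 * d) by rewrite /k; lia.
exists k, (Imat (k%:Z - b) (- 2 * c) (2 * a) (b + k%:Z)).
have dE : idet (Imat (k%:Z - b) (- 2 * c) (2 * a) (b + k%:Z)) = (k * k.+1)%N%:Z.
  rewrite /idet /= PoszM -[k.+1]addn1 PoszD kE /a /b /c; ring.
split=> //; first by lia.
have kp : (0 < k)%N by lia.
have n0 : iden (Imat (k%:Z - b) (- 2 * c) (2 * a) (b + k%:Z)) z != 0.
  by apply: iden_neq0 => //; rewrite dE ltz_nat muln_gt0 kp.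
apply: (mulIf n0); rewrite /mobius divfK // /iden /=.
have q : a%:~R * z ^+ 2 + b%:~R * z + c%:~R = 0.
  have -> : c%:~R = (v%:~R : C) ^+ 2 - (u%:~R * z + v%:~R) ^+ 2.
    by rewrite e /c intrB rmorphXn.
  by rewrite /a /b rmorphXn !intrM; ring.
have i2 : (2 : int)%:~R = 2 :> C by [].
clear dE n0; clearbody a b c.
rewrite !(intrD, intrB, intrM) (rmorphN _ (2 : int)) /= i2.
apply/eqP; rewrite -subr_eq0; apply/eqP.
transitivity (- 2 * (a%:~R * z ^+ 2 + b%:~R * z + c%:~R)); first by ring.
by rewrite q mulr0.
Qed.

End Hauptmodul.

(** * Integrality and units at quadratic points *)

Section Integrality.
Variable R : realType.
Local Notation C := R[i].
Implicit Types (z w : C) (M N : imat).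
Local Notation J := (@hauptmodul R).

Lemma nonsquare_between (k a : nat) : (0 < k)%N -> (a ^ 2 != k * k.+1)%N.
Proof.
move=> k0; apply/eqP => e; have [le|lt] := leqP a k.
  have : (a ^ 2 <= k ^ 2)%N by rewrite leq_exp2r.
  by rewrite e -mulnn leq_pmul2l // ltnn.
have : (k.+1 ^ 2 <= a ^ 2)%N by rewrite leq_exp2r.
by rewrite e -mulnn leq_pmul2r // ltnn.
Qed.

Lemma unit_prod (I : eqType) (s : seq I) (u : I -> C) :
  (forall i, i \in s -> u i != 0 /\ (u i)^-1 \in @algint C) ->
  \prod_(i <- s) u i != 0 /\ (\prod_(i <- s) u i)^-1 \in @algint C.
Proof.
elim: s => [|i s IH] h; first by rewrite big_nil oner_neq0 invr1 rpred1.
have [h1 h2] := h i (mem_head _ _).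
have [|h3 h4] := IH; first by move=> j js; apply: h; rewrite inE js orbT.
by rewrite big_cons mulf_neq0 // invfM; split=> //; exact: rpredM.
Qed.

Lemma sum_oppz (I : Type) (s : seq I) (F : I -> nat) :
  \sum_(i <- s) (- (F i)%:Z) = - (\sum_(i <- s) F i)%N%:Z.
Proof.
elim: s => [|i s IH]; first by rewrite !big_nil.
by rewrite !big_cons IH PoszD opprD.
Qed.

(** J(z) and J(X z) have poles of order 2n and 2a^2 in the common parameter. Since a^2 differs from
    n, the larger pole survives and its coefficient 1 or -u is a unit; for a^2 = n the leading terms
    could cancel. *)
Lemma qexp_hauptmodul_diff n p : (0 < n)%N -> p \in hermite_seq n -> (p.1 ^ 2 != n)%N ->
  exists u, [/\ u != 0, u^-1 \in @algint C &
    qexp (2 * n) (- (2 * maxn n (p.1 ^ 2))%N%:Z) u (fun z => J z - J (mobius (hmat n p) z))].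
Proof.
move=> n0 hp ne; have q1 := @qexp_hauptmodul_level R n n0.
have [u [u0 iu q2]] := @qexp_hauptmodul_hmat R n p n0 hp.
have [lt|ge] := ltnP n (p.1 ^ 2).
  exists (- u); rewrite oppr_eq0 invrN rpredN; split => //.
  rewrite -[- u]add0r; apply: qexpD; last exact: qexpN.
  apply: (@qexp_weaken _ _ _ (2 * (p.1 ^ 2 - n)).-1).
  have -> : - (2 * p.1 ^ 2)%N%:Z + (2 * (p.1 ^ 2 - n)).-1.+1%:Z = - (2 * n)%N%:Z.
    by move: lt; move: (p.1 ^ 2)%N => a lt; lia.
  exact: q1.
exists 1; rewrite invr1 oner_neq0 rpred1; split => //.
rewrite -[X in qexp _ _ X](addr0 (1 : C)) -oppr0; apply: qexpD => //.
have lt : (p.1 ^ 2 < n)%N by rewrite ltn_neqAle ne.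
apply: qexpN; apply: (@qexp_weaken _ _ _ (2 * (n - p.1 ^ 2)).-1).
have -> : - (2 * n)%N%:Z + (2 * (n - p.1 ^ 2)).-1.+1%:Z = - (2 * p.1 ^ 2)%N%:Z.
  by move: lt; move: (p.1 ^ 2)%N => a lt; lia.
exact: q2.
Qed.

(* J(z) is a root of the modular equation Phi_n(X, X) for the determinant n of a matrix
   fixing z, whose leading coefficient is a unit since n is not a square. *)
Lemma hauptmodul_algint z : quadratic_point z -> J z \in @algint C.
Proof.
move=> qz; have [zu _] := qz; have [k [M [k0 dM fM]]] := quadratic_point_fixed qz.
set n := (k * k.+1)%N in dM; have n0 : (0 < n)%N by rewrite muln_gt0 k0.
pose g (X : imat) w := J w - J (mobius X w).
have fg : modular_family g.
  exact: (modular_family2 (fun x y => x - y) (@modular_hauptmodul R) (modular_family_mobius (@modular_hauptmodul R))).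
pose f w := \prod_(p <- hermite_seq n) g (hmat n p) w.
have mf : modular f.
  apply: modular_of_gen => N w gN wu.
  exact: (big_hermite _ id fg gN n0 wu).
have /choice[u hu] : forall p, exists u, p \in hermite_seq n ->
    [/\ u != 0, u^-1 \in @algint C & qexp (2 * n) (- (2 * maxn n (p.1 ^ 2))%N%:Z) u (g (hmat n p))].
  move=> p; have [hp|hp] := boolP (p \in hermite_seq n); last by exists 0.
  have [u hu] := qexp_hauptmodul_diff n0 hp (nonsquare_between p.1 k0); exists u => _; exact: hu.
have qf : qexp (2 * n) (- (\sum_(p <- hermite_seq n) 2 * maxn n (p.1 ^ 2))%N%:Z)
    (\prod_(p <- hermite_seq n) u p) f.
  by rewrite -sum_oppz; apply: qexp_prod => p /hu[].
have [u0 iu] : \prod_(p <- hermite_seq n) u p != 0 /\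
    (\prod_(p <- hermite_seq n) u p)^-1 \in @algint C.
  by apply: unit_prod => p /hu[].
have N0 : (0 < 2 * n)%N by rewrite muln_gt0.
have [P [iP iuP] [P0 eP]] := modular_unit_poly N0 (@qexp_hauptmodul_level R n n0)
  (@modular_hauptmodul R) qf mf u0 iu.
apply: (algint_root_unit P0 _ iP iuP); rewrite /root -eP //.
have [p hp ep] := hermite_exists n0 dM.
have dM0 : 0 < idet M by rewrite dM ltz_nat.
have := modular_family_equiv fg ep dM0 zu.
rewrite {1}/g fM subrr => e; apply/eqP.
by rewrite /f (big_rem p) //= -e mul0r.
Qed.

Lemma coef_prod_qexp (s : seq (nat * nat)) (g : nat * nat -> C -> C) (N : nat) :
  (forall p, p \in s -> exists (M : int) u, qexp N M u (g p)) ->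
  forall i, exists (M : int) u, qexp N M u (fun w => (\prod_(p <- s) ('X - (g p w)%:P))`_i).
Proof.
elim: s => [|p s IH] h i.
  exists 0, (i == 0)%:R; apply: (@eq_qexp _ _ _ _ (fun=> (i == 0)%:R)).
    by move=> w _; rewrite big_nil coef1.
  by apply: qexp_cst; rewrite algint_nat.
have {}IH := IH (fun q hq => h q (mem_behead (s := p :: s) hq)).
have [M [u q]] := h p (mem_head _ _).
have [M1 [u1 q1]] := IH i.
have q2 := qexpN (qexpM q q1).
have [M3 [u3 q3]] : exists (M : int) u, qexp N M u (fun w => if i is i'.+1 then
    (\prod_(p <- s) ('X - (g p w)%:P))`_i' else 0).
  case: i {q1 q2} => [|i]; last exact: IH.
  by exists 0, 0; apply: qexp_cst; exact: rpred0.
have [M4 [u4 q4]] := qexp_add_any q3 q2.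
exists M4, u4; apply: eq_qexp q4 => w _.
rewrite big_cons mulrBl coefB coefXM coefCM; case: i {q1 q2 q3} => [|i] //=.
Qed.

Lemma delta_quotient_algint z M : quadratic_point z -> 0 < idet M ->
  delta_quotient M z \in @algint C.
Proof.
move=> qz dM; have [zu _] := qz; have iJ := hauptmodul_algint qz.
pose n := absz (idet M); have dn : idet M = n%:Z by rewrite /n; lia.
have n0 : (0 < n)%N by rewrite dn ltz_nat in dM.
pose P w := \prod_(p <- hermite_seq n) ('X - (delta_quotient (hmat n p) w)%:P).
have fg := modular_family_delta R.
have N0 : (0 < 2 * n)%N by rewrite muln_gt0.
have cP i : (P z)`_i \in @algint C.
  have mf : modular (fun w => (P w)`_i).
    apply: modular_of_gen => N w gN wu.
    have e : P (mobius N w) = P w := big_hermite _ (fun x => 'X - x%:P) fg gN n0 wu.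
    by rewrite e.
  have [|M1 [u q]] := @coef_prod_qexp (hermite_seq n) (fun p => delta_quotient (hmat n p)) (2 * n) _ i.
    move=> p hp; have := qexp_level n0 (isT : 0 < 2)%N (qexp_delta_quotient R n0 hp).
    rewrite mulnC => h; eexists; eexists; exact: h.
  have [p ip ep] := modular_poly N0 (@qexp_hauptmodul_level R n n0) (@modular_hauptmodul R) q mf.
  by rewrite ep //; apply: rpred_horner.
have [p hp ep] := hermite_exists n0 dn.
have e := modular_family_equiv fg ep dM zu; rewrite e.
apply: (@algint_root _ (P z)); first exact: monic_prod_XsubC.
  rewrite /P /root horner_prod (big_rem p) //= hornerXsubC subrr mul0r.
  exact: eqxx.
by apply/polyOverP.
Qed.

End Integrality.

Lemma conj_quotient_identity (F : fieldType) (A B x y p : F) : A != 0 -> p != 0 ->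
  (A * (- B / p)) ^+ 12 * (x / A ^+ 12 / y) = B ^+ 12 * (x / y) / p ^+ 12.
Proof.
move=> A0 p0; rewrite exprMn expr_div_n (_ : (- B) ^+ 12 = B ^+ 12); last by ring.
have := expf_neq0 12 A0; move: (A ^+ 12) (B ^+ 12) (p ^+ 12) => a b q a0.
rewrite -[x / a / y]mulrA; move: (q^-1) (y^-1) => q' y'; by field.
Qed.

(** * Divisors of units and the values of prime determinant *)

Section UnitArgument.
Variable R : realType.
Local Notation C := R[i].
Implicit Types (z w x y : C).

Definition is_aunit x := [/\ x \in @algint C, x != 0 & x^-1 \in @algint C].

Lemma is_aunitM x y : is_aunit x -> is_aunit y -> is_aunit (x * y).
Proof.
move=> [ix x0 vx] [iy y0 vy]; split; [exact: rpredM | exact: mulf_neq0 |].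
by rewrite invfM; exact: rpredM.
Qed.

Lemma is_aunitV x : is_aunit x -> is_aunit x^-1.
Proof. by move=> [ix x0 vx]; split; rewrite ?invr_eq0 ?invrK. Qed.

Lemma is_aunit_factor x y t : x \in @algint C -> y \in @algint C -> is_aunit t ->
  x * y = t -> is_aunit x.
Proof.
move=> ix iy [it t0 vt] e; have x0 : x != 0 by apply: contraNneq t0 => x0; rewrite -e x0 mul0r.
split=> //; suff -> : x^-1 = y * t^-1 by exact: rpredM.
apply: (mulfI x0); rewrite mulfV // mulrA e mulfV //.
Qed.

Lemma perm_hermite_prime p : prime p ->
  perm_eq (hermite_seq p) ((p, 0%N) :: [seq (1%N, b) | b <- iota 0 p]).
Proof.
move=> pp; have p0 := prime_gt0 pp; have p1 := prime_gt1 pp.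
apply: uniq_perm; first exact: uniq_hermite.
  rewrite /= map_inj_uniq ?iota_uniq ?andbT; last by move=> a b [].
  by apply/mapP => -[b _ [e _]]; move: p1; rewrite e.
move=> [a b]; rewrite mem_hermite // inE; apply/andP/orP.
  move=> [/(primeP pp).2 /orP[] /eqP -> bn]; [right|left].
    by apply/mapP; exists b; rewrite // mem_iota; rewrite divn1 in bn.
  by move: bn; rewrite divnn p0 ltnS leqn0 => /eqP ->.
move=> [/eqP[-> ->]|/mapP[b' + [-> ->]]]; first by rewrite dvdnn divnn p0.
by rewrite mem_iota dvd1n divn1.
Qed.

(* The product of all the quotients of determinant p is a modular function without zeros or
   poles, hence its leading coefficient. *)
Lemma prod_delta_quotient p : prime p -> exists2 c, is_aunit c & forall z, upper z ->
  delta_quotient (hmat p (p, 0%N)) z *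
  \prod_(b <- iota 0 p) delta_quotient (hmat p (1%N, b)) z = p%:R ^+ 12 * c.
Proof.
move=> pp; have p0 := prime_gt0 pp; have ph := perm_hermite_prime pp.
pose f z := \prod_(q <- hermite_seq p) delta_quotient (hmat p q) z.
have fE z : f z = delta_quotient (hmat p (p, 0%N)) z *
    \prod_(b <- iota 0 p) delta_quotient (hmat p (1%N, b)) z.
  by rewrite /f (perm_big _ ph) big_cons big_map.
have mf : modular f.
  apply: modular_of_gen => N z gN zu.
  exact: (big_hermite _ id (modular_family_delta R) gN p0 zu).
pose v := \prod_(q <- hermite_seq p) hroot R p q.
have qf : qexp p 0 (p%:R ^+ 12 * v) f.
  have q : qexp p (\sum_(q <- hermite_seq p) ((q.1 ^ 2)%N%:Z - p%:Z))
     (\prod_(q <- hermite_seq p) (q.1%:R ^+ 12 * hroot R p q)) f.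
    by apply: qexp_prod => q hq; exact: qexp_delta_quotient.
  have e1 : \sum_(q <- hermite_seq p) ((q.1 ^ 2)%N%:Z - p%:Z) = 0.
    rewrite (perm_big _ ph) big_cons big_map /= exp1n big_const_seq count_predT size_iota.
    by rewrite iter_addr addr0 -mulnn PoszM -mulr_natl natz; ring.
  have e2 : \prod_(q <- hermite_seq p) (q.1%:R ^+ 12 * hroot R p q) = p%:R ^+ 12 * v.
    rewrite big_split /=; congr (_ * _).
    rewrite (perm_big _ ph) big_cons big_map /= big1 ?mulr1 // => b _.
    by rewrite expr1n.
  by rewrite e1 e2 in q.
have vu : is_aunit v.
  have [v0 iv] : v != 0 /\ v^-1 \in @algint C.
    by apply: unit_prod => q hq; have [] := hroot_unit R 1 p0 hq; rewrite expr1z.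
  split=> //; rewrite /v big_seq; apply: rpred_prod => q hq.
  by have [_] := hroot_unit R 1 p0 hq; rewrite expr1z.
exists v => // z zu; rewrite -fE.
set u := _ * v in qf *; have iu := qexp_alg qf.
have := qexpD qf (qexpN (qexp_cst p iu)); rewrite subrr => /(qexp_strict p0)[u' q1].
have m1 : modular (fun z => f z - u).
  by case: mf => fS fT; split=> [w wu|w k wu]; rewrite ?fS ?fT.
by have /eqP := qexp_modular_eq0 p0 q1 m1 zu; rewrite subr_eq0 => /eqP.
Qed.

Lemma quadratic_root_algint z (u v d : int) : (u%:~R * z + v%:~R) ^+ 2 = d%:~R :> C ->
  u%:~R * z + v%:~R \in @algint C.
Proof. by move=> e; apply: (@algint_exp _ _ 2) => //; rewrite e algint_int. Qed.

(* Integrality of the quotient at the matrix mapping z to (z + j) / p with lower row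
   u^2, u (v - s), whose determinant has only one factor p less than the norm of its
   denominator. *)
Lemma delta_quotient_conj_algint z (u v d s e l : int) (p j : nat) (r := u%:~R * z + v%:~R : C) :
  upper z -> u != 0 -> d < 0 -> r ^+ 2 = d%:~R -> (0 < p)%N -> (j < p)%N ->
  d - s ^+ 2 = p%:Z * e -> u * j%:Z = v + s + p%:Z * l ->
  (u%:~R * (r + s%:~R)) ^+ 12 * delta_quotient (hmat p (1%N, j)) z / p%:R ^+ 12 \in @algint C.
Proof.
move=> zu u0 d0 r2 p0 jp de uj.
have qz : quadratic_point z by split=> //; exists u, v, d.
pose B := Imat (u * l) (e + l * (v - s)) (u ^+ 2) (u * (v - s)).
have dB : idet B = - e * u ^+ 2 by rewrite /idet /=; ring.
have e0 : e < 0.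
  by rewrite -(pmulr_rlt0 e (_ : 0 < p%:Z)) // -de; have := sqr_ge0 s; lia.
have dB0 : 0 < idet B by rewrite dB mulr_gt0 ?oppr_gt0 // lt_def sqrf_eq0 u0 sqr_ge0.
have := delta_quotient_algint qz dB0.
have hj : (1%N, j) \in hermite_seq p by rewrite mem_hermite // dvd1n divn1.
rewrite (delta_quotient_hmat p0 hj zu) /delta_quotient /slash.
have nB := iden_neq0 dB0 zu.
have pC : (p%:R : C) != 0 by rewrite pnatr_eq0 -lt0n.
have deC : d%:~R - s%:~R ^+ 2 = p%:R * e%:~R :> C.
  by rewrite -rmorphXn -intrB de intrM -pmulrn.
have ujC : u%:~R * j%:R = v%:~R + s%:~R + p%:R * l%:~R :> C.
  by have /(congr1 (fun k : int => k%:~R : C)) := uj; rewrite !(intrM, intrD) -!pmulrn.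
have dE : iden B z = u%:~R * (r - s%:~R).
  by rewrite /iden /= rmorphXn intrM intrB /r; ring.
have mE : mobius B z = (z + j%:R) / p%:R.
  apply: (mulIf nB); rewrite /mobius divfK // dE.
  apply: (mulIf pC); rewrite [RHS]mulrAC divfK // /B /=.
  rewrite intrM intrD intrM intrB.
  have -> : (z + j%:R) * (u%:~R * (r - s%:~R)) = (u%:~R * z + u%:~R * j%:R) * (r - s%:~R) by ring.
  rewrite ujC; transitivity ((p%:R * e%:~R) + p%:R * l%:~R * (r - s%:~R)); first by rewrite /r; ring.
  by rewrite -deC -r2 /r; ring.
rewrite mE dE dB divn1 expr1n !mul1r.
have r0 : u%:~R * (r - s%:~R) != 0 by rewrite -dE.
(* (r - s)(r + s) = d - s^2 = p e exhibits the determinant as the denominator of [B] times -u (r +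
   s) / p. The 12th power of the denominator cancels in the quotient and that of u (r + s) / p is
   left. *)
have nE : (- e * u ^+ 2)%:~R = u%:~R * (r - s%:~R) * (- (u%:~R * (r + s%:~R)) / p%:R).
  apply: (mulIf pC); rewrite -[RHS]mulrA divfK // rmorphM rmorphN rmorphXn /=.
  have -> : - e%:~R * u%:~R ^+ 2 * p%:R = - (p%:R * e%:~R) * u%:~R ^+ 2 :> C by ring.
  by rewrite -deC -r2; ring.
rewrite nE; move: (Delta _) (Delta z) => x y.
suff -> : (u%:~R * (r - s%:~R) * (- (u%:~R * (r + s%:~R)) / p%:R)) ^+ 12 *
   (x / (u%:~R * (r - s%:~R)) ^+ 12 / y) =
   (u%:~R * (r + s%:~R)) ^+ 12 * (x / y) / p%:R ^+ 12 by [].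
exact: conj_quotient_identity.
Qed.

(** Every term of (X - Y)^24 contains X^12 or Y^12, so y c^24 is integral, and c^24 and p^12 are
    coprime integers. *)
Lemma algint_coprime_ideal y (X Y : C) (c : int) (p : nat) : (0 < p)%N ->
  X \in @algint C -> Y \in @algint C -> X - Y = c%:~R -> coprimez c p%:Z ->
  y * X ^+ 12 \in @algint C -> y * Y ^+ 12 \in @algint C -> y * p%:R ^+ 12 \in @algint C ->
  y \in @algint C.
Proof.
move=> p0 iX iY eXY cp hX hY hp.
have sgn i j k (U V : C) : U \in @algint C -> V \in @algint C ->
    (-1) ^+ i * U ^+ j * V ^+ k \in @algint C.
  move=> iU iV; apply: rpredM (rpredX _ iV); apply: rpredM (rpredX _ iU).
  by apply: rpredX; rewrite rpredN rpred1.
have hc : y * c%:~R ^+ 24 \in @algint C.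
  rewrite -eXY exprBn mulr_sumr; apply: rpred_sum => i _.
  rewrite mulrnAr; apply: rpredMn.
  have [le|gt] := leqP i 12.
    have -> : (24 - i = 12 + (12 - i))%N by lia.
    have -> : y * ((-1) ^+ i * X ^+ (12 + (12 - i)) * Y ^+ i) =
      (y * X ^+ 12) * ((-1) ^+ i * X ^+ (12 - i) * Y ^+ i) by rewrite exprD; ring.
    exact: rpredM (sgn i _ _ _ _ iX iY).
  have -> : y * ((-1) ^+ i * X ^+ (24 - i) * Y ^+ i) =
      (y * Y ^+ 12) * ((-1) ^+ i * X ^+ (24 - i) * Y ^+ (i - 12)).
    rewrite [Y ^+ i](_ : _ = Y ^+ 12 * Y ^+ (i - 12)); last by rewrite -exprD subnKC // ltnW.
    by ring.
  exact: rpredM (sgn i _ _ _ _ iX iY).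
have /coprimezP[[a b] /= ab] : coprimez (c ^+ 24) (p%:Z ^+ 12).
  by rewrite coprimezXl // coprimezXr.
have -> : y = a%:~R * (y * c%:~R ^+ 24) + b%:~R * (y * p%:R ^+ 12).
  have /(congr1 (fun k : int => k%:~R : C)) := ab.
  rewrite intrD [(a * _)%:~R]intrM [(b * _)%:~R]intrM !rmorphXn /= -pmulrn => h.
  have {}h : a%:~R * c%:~R ^+ 24 + b%:~R * p%:R ^+ 12 = 1 :> C := h.
  transitivity (y * (a%:~R * c%:~R ^+ 24 + b%:~R * p%:R ^+ 12)); first by rewrite h mulr1.
  by ring.
by rewrite rpredD // rpredM // algint_int.
Qed.

End UnitArgument.

Lemma ratio_chain (F : fieldType) (k k' x w y : F) : w != 0 ->
  k' * k * (x / y) = k * (w / y) * (k' * (x / w)).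
Proof. by move=> w0; move: y^-1 => y'; field. Qed.

(** * The ratios Delta(m z) / Delta(z) at quadratic points *)

Section DeltaRatioUnits.
Variable R : realType.
Local Notation C := R[i].
Implicit Types (z w x y : C).

Definition delta_ratio (m : nat) z : C := m%:R ^+ 12 * (Delta (m%:R * z) / Delta z).

Lemma delta_ratioE p z : (0 < p)%N -> upper z ->
  delta_quotient (hmat p (p, 0%N)) z = delta_ratio p z.
Proof.
move=> p0 zu; have hp : (p, 0%N) \in hermite_seq p by rewrite mem_hermite // dvdnn divnn p0.
by rewrite (delta_quotient_hmat p0 hp zu) /= divnn p0 addr0 divr1.
Qed.

Lemma delta_quotient_nat_algint p q z : (0 < p)%N -> q \in hermite_seq p -> quadratic_point z ->
  delta_quotient (hmat p q) z \in @algint C.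
Proof. by move=> p0 hq qz; apply: delta_quotient_algint => //; rewrite idet_hmat. Qed.

Lemma mem_hermite_row p b : (0 < p)%N -> (b < p)%N -> (1%N, b) \in hermite_seq p.
Proof. by move=> p0 bp; rewrite mem_hermite // dvd1n divn1. Qed.

Lemma quadratic_pointM (m : nat) z : (0 < m)%N -> quadratic_point z -> quadratic_point (m%:R * z).
Proof.
move=> m0 [zu [u [v [d [u0 d0 e]]]]]; split; first by case: m m0 => // m _; exact: upper_natM.
exists u, (m%:Z * v), (m%:Z ^+ 2 * d); split => //.
  by rewrite pmulr_rlt0 // exprn_gt0 // ltz_nat.
rewrite [(m%:Z * v)%:~R]intrM [(m%:Z ^+ 2 * d)%:~R]intrM rmorphXn /= -!pmulrn -e; ring.
Qed.

Lemma exists_residue (p : nat) (u c : int) : prime p -> ~~ (p%:Z %| u)%Z ->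
  exists (j : nat) l, (j < p)%N /\ u * j%:Z = c + p%:Z * l.
Proof.
move=> pp pu; have p0 := prime_gt0 pp.
have cp : coprimez u p%:Z by rewrite coprimezE coprime_sym prime_coprime.
have /coprimezP[[a b] /= ab] := cp.
exists (absz ((a * c) %% p%:Z)%Z), (- (u * ((a * c) %/ p%:Z)%Z) - b * c); split.
  have := modz_ge0 (a * c) (_ : p%:Z != 0); have := ltz_pmod (a * c) (_ : 0 < p%:Z).
  by move=> /(_ (_ : 0 < p%:Z)); lia.
rewrite gez0_abs ?modz_ge0 //; last by lia.
rewrite modz_subE.
have -> : u * (a * c - (a * c %/ p%:Z)%Z * p%:Z) = (a * u) * c - p%:Z * (u * (a * c %/ p%:Z)%Z) by ring.
have -> : a * u = 1 - b * p%:Z by rewrite -ab addrK.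
by ring.
Qed.

Lemma delta_ratio_unit_split z (u v d s : int) (p : nat) :
  upper z -> d < 0 -> (u%:~R * z + v%:~R) ^+ 2 = d%:~R -> prime p -> odd p ->
  ~~ (p%:Z %| u)%Z -> ~~ (p%:Z %| d)%Z -> (p%:Z %| d - s ^+ 2)%Z ->
  is_aunit (delta_ratio p z).
Proof.
move=> zu d0 r2 pp podd pu pd ps; have p0 := prime_gt0 pp.
have u0 : u != 0 by apply: contraNneq pu => ->; rewrite dvdz0.
have qz : quadratic_point z by split=> //; exists u, v, d.
pose r : C := u%:~R * z + v%:~R.
have [e de] : exists e, d - s ^+ 2 = p%:Z * e by case/dvdzP: ps => e ->; exists e; rewrite mulrC.
have de' : d - (- s) ^+ 2 = p%:Z * e by rewrite sqrrN.
have pns : ~~ (p%:Z %| s)%Z.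
  apply: contra pd => ps'; have -> : d = (d - s ^+ 2) + s * s by rewrite expr2 subrK.
  by rewrite rpredD // dvdz_mulr.
have pn2 : ~~ (p%:Z %| 2)%Z.
  by rewrite dvdzE /= (dvdn_prime2 pp) //; apply: contraTneq podd => ->.
have pprime a b : (p%:Z %| a * b)%Z = (p%:Z %| a)%Z || (p%:Z %| b)%Z.
  by rewrite !dvdzE abszM Euclid_dvdM.
(* j and j' are attached to the square roots s and -s of d modulo p; they are distinct because p
   does not divide 2 s. *)
have [j [l [jp uj]]] := @exists_residue p u (v + s) pp pu.
have [j' [l' [jp' uj']]] := @exists_residue p u (v + - s) pp pu.
have jj : j != j'.
  apply/eqP => ejj; have : (p%:Z %| 2 * s)%Z.
    have h : v + s + p%:Z * l = v + - s + p%:Z * l' by rewrite -uj -uj' ejj.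
    have -> : 2 * s = (v + s + p%:Z * l) - (v + - s) - p%:Z * l by ring.
    have -> : v + s + p%:Z * l - (v + - s) - p%:Z * l = (l' - l) * p%:Z by rewrite h; ring.
    by rewrite dvdz_mull.
  by rewrite pprime (negbTE pn2) (negbTE pns).
pose a := delta_quotient (hmat p (1%N, j)) z.
pose b := delta_quotient (hmat p (1%N, j')) z.
have ia : a \in @algint C by apply: delta_quotient_nat_algint => //; exact: mem_hermite_row.
have ib : b \in @algint C by apply: delta_quotient_nat_algint => //; exact: mem_hermite_row.
have hX := delta_quotient_conj_algint zu u0 d0 r2 p0 jp de uj.
have hY := delta_quotient_conj_algint zu u0 d0 r2 p0 jp' de' uj'.
rewrite -/r -/a in hX; rewrite -/r -/b in hY.
have ir : r \in @algint C by exact: quadratic_root_algint r2.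
have pC : (p%:R : C) ^+ 12 != 0 by rewrite expf_neq0 // pnatr_eq0 -lt0n.
pose X := u%:~R * (r + s%:~R); pose Y := u%:~R * (r + (- s)%:~R).
pose y := a * b / p%:R ^+ 12.
have iy : y \in @algint C.
  apply: (@algint_coprime_ideal _ y X Y (2 * u * s) p p0).
  - by apply: rpredM; [exact: algint_int | apply: rpredD => //; exact: algint_int].
  - by apply: rpredM; [exact: algint_int | apply: rpredD => //; exact: algint_int].
  - by rewrite /X /Y rmorphN !intrM /=; ring.
  - rewrite coprimezE coprime_sym prime_coprime //.
    have := pprime (2 * u) s; rewrite (pprime 2 u) (negbTE pn2) (negbTE pu) (negbTE pns).
    by rewrite dvdzE /= => ->.
  - have -> : y * X ^+ 12 = (X ^+ 12 * a / p%:R ^+ 12) * b.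
      by rewrite /y; move: (p%:R ^+ 12)^-1 (X ^+ 12) => k x; ring.
    by apply: rpredM ib; exact: hX.
  - have -> : y * Y ^+ 12 = (Y ^+ 12 * b / p%:R ^+ 12) * a.
      by rewrite /y; move: (p%:R ^+ 12)^-1 (Y ^+ 12) => k x; ring.
    by apply: rpredM ia; exact: hY.
  - by rewrite /y (divfK pC); apply: rpredM ib; exact: ia.
have [c uc hc] := prod_delta_quotient R pp.
have := hc z zu; rewrite (delta_ratioE p0 zu).
have jin : j \in iota 0 p by rewrite mem_iota.
have jin' : j' \in rem j (iota 0 p) by rewrite mem_rem_uniq ?iota_uniq // inE eq_sym jj mem_iota.
rewrite (big_rem j jin) (big_rem j' jin') /= -/a -/b.
set rest := \prod_(_ <- _) _ => h.
have irest : rest \in @algint C.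
  rewrite /rest big_seq; apply: rpred_prod => k /mem_rem/mem_rem; rewrite mem_iota /= => kp.
  by apply: delta_quotient_nat_algint => //; exact: mem_hermite_row.
have idr : delta_ratio p z \in @algint C.
  rewrite -(delta_ratioE p0 zu); apply: delta_quotient_nat_algint => //.
  by rewrite mem_hermite // dvdnn divnn p0.
have iyr : y * rest \in @algint C by apply: rpredM irest; exact: iy.
(* After division of the product formula by p^12, d_p(z) times [y] times the remaining quotients is
   the unit c. *)
apply: (is_aunit_factor idr iyr uc).
apply: (mulfI pC); rewrite -h /y; move: (delta_ratio p z) pC; move: (p%:R ^+ 12) => k x k0.
by field.
Qed.

(** At w = p z the matrix (1, 0) leads back to z, and its value Delta(z) / Delta(w) equals p^12 /
    d_p(z). The product formula at w therefore makes d_p(w) a divisor of the unit c d_p(z). *)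
Lemma delta_ratio_unit_mulp z p : prime p -> quadratic_point z ->
  is_aunit (delta_ratio p z) -> is_aunit (delta_ratio p (p%:R * z)).
Proof.
move=> pp qz uz; have p0 := prime_gt0 pp; have [zu _] := qz.
have qw := quadratic_pointM p0 qz; have [wu _] := qw.
have [c uc hc] := prod_delta_quotient R pp.
have := hc _ wu; rewrite (delta_ratioE p0 wu).
have in0 : 0%N \in iota 0 p by rewrite mem_iota.
rewrite (big_rem 0%N in0) /=; set rest := \prod_(_ <- _) _.
have hq : (1%N, 0%N) \in hermite_seq p by exact: mem_hermite_row.
rewrite (delta_quotient_hmat p0 hq wu) /= divn1 expr1n !mul1r addr0.
have pn0 : (p%:R : C) != 0 by rewrite pnatr_eq0 -lt0n.
have -> : p%:R * z / p%:R = z by rewrite mulrC mulKf.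
move=> h; have irest : rest \in @algint C.
  rewrite /rest big_seq; apply: rpred_prod => k /mem_rem; rewrite mem_iota /= => kp.
  by apply: delta_quotient_nat_algint => //; exact: mem_hermite_row.
have idr : delta_ratio p (p%:R * z) \in @algint C.
  rewrite -(delta_ratioE p0 wu); apply: delta_quotient_nat_algint => //.
  by rewrite mem_hermite // dvdnn divnn p0.
apply: (is_aunit_factor idr irest (is_aunitM uc uz)).
have D1 := Delta_neq0 zu; have D2 := Delta_neq0 wu.
have e : delta_ratio p z = p%:R ^+ 12 * (Delta (p%:R * z) / Delta z) by [].
rewrite e; move: h D1 D2; move: (delta_ratio p (p%:R * z)) => x.
move: (Delta z) (Delta (p%:R * z)) (p%:R ^+ 12) => y w k h y0 w0.
have -> : x * rest = x * (y / w * rest) * (w / y) by field; rewrite y0 w0.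
by rewrite h; ring.
Qed.

Lemma delta_ratioM m m' z : (0 < m)%N -> upper z ->
  delta_ratio (m' * m) z = delta_ratio m z * delta_ratio m' (m%:R * z).
Proof.
move=> m0 zu; have mu : upper (m%:R * z) by case: m m0 => // m _; exact: upper_natM.
have D2 := Delta_neq0 mu.
rewrite /delta_ratio natrM [(_ * _) ^+ 12]exprMn -[_ * _ * z]mulrA.
exact: ratio_chain.
Qed.

(** With m = p m', d_m(z) = d_m'(z) d_p(m' z). If p divides m', the discriminant attached to m' z is
    divisible by p, so the split case is applied at m'' z, where m'' is the part of m' prime to p,
    and [delta_ratio_unit_mulp] restores the powers of p. *)
Lemma delta_ratio_unit z (u v d : int) (m : nat) :
  upper z -> d < 0 -> (u%:~R * z + v%:~R) ^+ 2 = d%:~R -> (0 < m)%N -> odd m ->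
  (forall p, prime p -> (p %| m)%N -> [/\ ~~ (p%:Z %| u)%Z, ~~ (p%:Z %| d)%Z &
     exists s, (p%:Z %| d - s ^+ 2)%Z]) ->
  is_aunit (delta_ratio m z).
Proof.
move=> zu d0 r2 m0 modd hm.
have [k] := ubnP m; elim: k m m0 modd hm => // k IH m m0 modd hm mk.
have [m1|m1] := leqP m 1.
  have -> : m = 1%N by apply/eqP; rewrite eqn_leq m1.
  rewrite /delta_ratio mul1r divff ?Delta_neq0 // mulr1 expr1n.
  by split; rewrite ?invr1 ?rpred1 ?oner_neq0.
have pp := pdiv_prime m1; set p := pdiv m in pp.
have p0 := prime_gt0 pp; have pm : (p %| m)%N := pdiv_dvd m.
have mE : m = (p * (m %/ p))%N by rewrite mulnC divnK.
set m' := (m %/ p)%N in mE.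
have m'0 : (0 < m')%N by move: m0; rewrite mE muln_gt0 => /andP[].
have [podd m'odd] : odd p /\ odd m' by move: modd; rewrite mE oddM => /andP[].
have m'd q : (q %| m' -> q %| m)%N by move=> h; rewrite mE dvdn_mull.
have um' : is_aunit (delta_ratio m' z).
  apply: IH => // [q qp /m'd|]; first exact: hm.
  rewrite ltnS in mk; apply: leq_trans mk.
  by rewrite [X in (_ < X)%N]mE ltn_Pmull ?prime_gt1.
rewrite mE (delta_ratioM _ m'0 zu); apply: is_aunitM um' _.
have [m'' cop m''E] := pfactor_coprime pp m'0.
have m''0 : (0 < m'')%N by move: m'0; rewrite m''E muln_gt0 => /andP[].
have qz : quadratic_point z.
  have [pu _ _] := hm p pp pm; split=> //; exists u, v, d; split => //.
  by apply: contraNneq pu => ->; rewrite dvdz0.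
have start : is_aunit (delta_ratio p (m''%:R * z)).
  have [pu pd [s ps]] := hm p pp pm.
  have pm'' : ~~ (p%:Z %| m''%:Z)%Z by rewrite dvdzE /= -prime_coprime.
  apply: (@delta_ratio_unit_split _ u (m''%:Z * v) (m''%:Z ^+ 2 * d) (m''%:Z * s)) => //.
  - by case: m'' {cop m''E pm''} m''0 => // n _; exact: upper_natM.
  - by rewrite pmulr_rlt0 // exprn_gt0 // ltz_nat.
  - by rewrite [(m''%:Z * v)%:~R]intrM [(m''%:Z ^+ 2 * d)%:~R]intrM rmorphXn /= -!pmulrn -r2; ring.
  - rewrite !dvdzE in pm'' pd.
    by rewrite dvdzE abszM abszX Euclid_dvdM // Euclid_dvdX // negb_or negb_and pm'' pd.
  - by rewrite exprMn -mulrBr dvdz_mull.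
rewrite m''E natrM [_%:R * (p ^ _)%:R]mulrC -mulrA natrX.
elim: (logn p m') => [|i IHi]; first by rewrite expr0 mul1r.
rewrite exprS -mulrA; apply: delta_ratio_unit_mulp => //.
rewrite -natrX; apply: quadratic_pointM; first by rewrite expn_gt0 p0.
exact: quadratic_pointM.
Qed.

End DeltaRatioUnits.

(** * Quadratic number fields *)

Section RationalScalars.
Variable K : fieldExtType rat.

Definition qK (r : rat) : K := in_alg K r.

Lemma qKD r s : qK (r + s) = qK r + qK s. Proof. exact: rmorphD. Qed.
Lemma qKB r s : qK (r - s) = qK r - qK s. Proof. exact: rmorphB. Qed.
Lemma qKM r s : qK (r * s) = qK r * qK s. Proof. exact: rmorphM. Qed.
Lemma qKX r n : qK (r ^+ n) = qK r ^+ n. Proof. exact: rmorphXn. Qed.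
Lemma qKN r : qK (- r) = - qK r. Proof. exact: rmorphN. Qed.
Lemma qK0 : qK 0 = 0. Proof. exact: rmorph0. Qed.
Lemma qK1 : qK 1 = 1. Proof. exact: rmorph1. Qed.
Lemma qK_int (k : int) : qK k%:~R = k%:~R. Proof. exact: rmorph_int. Qed.
Lemma qK_inj : injective qK. Proof. exact: fmorph_inj. Qed.

Lemma algint_rat (r : rat) : qK r \in @algint K -> exists k : int, r = k%:~R.
Proof.
move=> /asboolP[p mp rp].
have rr : root (map_poly (intr : int -> algC) p) (ratr r).
  have : root (map_poly (intr : int -> rat) p) r.
    move: rp; have -> : map_poly (intr : int -> K) p = map_poly (in_alg K) (map_poly intr p).
      by rewrite -map_poly_comp; apply: eq_map_poly => k /=; rewrite -[RHS]/(qK _) qK_int.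
    by rewrite -[qK r]/(in_alg K r) fmorph_root.
  rewrite -(fmorph_root (ratr : rat -> algC)) -map_poly_comp; congr (root _ _).
  by apply: eq_map_poly => k /=; rewrite rmorph_int.
have : (ratr r : algC) \in Aint.
  apply: (root_monic_Aint rr); first exact: monic_map.
  by apply/polyOverP => i; rewrite coef_map /= intr_int.
move=> /(Cint_rat_Aint (Crat_rat r)) /intrP[k e]; exists k.
by apply: (fmorph_inj (ratr : rat -> algC)); rewrite /= e rmorph_int.
Qed.

(** Completes the square in the equation of an element outside Q; a and b are the coordinates with
    respect to 1 and [dl]. *)
Lemma quadratic_generator : \dim {:K} = 2%N -> exists (dl : K) (D : rat) (a b : K -> rat),
  [/\ dl ^+ 2 = qK D, forall y, y = qK (a y) + qK (b y) * dl
    & forall r s, a (qK r + qK s * dl) = r /\ b (qK r + qK s * dl) = s].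
Proof.
move=> dim2.
have [x xn] : exists x : K, x \notin 1%VS.
  apply: contrapT => h; have : ({:K} <= 1)%VS.
    by apply/subvP => y _; apply: contrapT => /negP hy; apply: h; exists y.
  by move=> /dimvS; rewrite dim2 dimv1.
have fr (y : K) : y \notin 1%VS -> free [:: y; 1].
  by move=> yn; rewrite free_cons span_seq1 yn seq1_free oner_neq0.
have dec (y : K) : y \notin 1%VS -> forall z, exists rs : rat * rat, z = qK rs.1 + qK rs.2 * y.
  move=> yn z; have : basis_of {:K} [:: y; 1].
    by rewrite basisEfree fr // subvf dim2.
  move=> /span_basis e; have : z \in span [:: y; 1] by rewrite e memvf.
  rewrite span_cons span_seq1 => /memv_addP[u /vlineP[s ->] [v /vlineP[r ->] ->]].
  by exists (r, s); rewrite /qK /= mulr_algl addrC.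
have [[al be] /= x2] := dec x xn (x ^+ 2).
pose dl := x - qK (be / 2).
have dln : dl \notin 1%VS.
  apply: contra xn => h; rewrite -(subrK (qK (be / 2)) x) -/dl rpredD //.
  by apply/vlineP; exists (be / 2).
exists dl, (al + (be / 2) ^+ 2).
have /choice[ab hab] := dec dl dln.
exists (fun y => (ab y).1), (fun y => (ab y).2); split => //.
  have hb : qK be = qK (be / 2) + qK (be / 2) by rewrite -qKD -splitr.
  by rewrite /dl sqrrB x2 qKD qKX hb; ring.
move=> r s; have e := hab (qK r + qK s * dl); move: (ab _) e => [r' s'] /= e.
have key : qK (r - r') = qK (s' - s) * dl.
  rewrite !qKB; apply/eqP; rewrite -subr_eq0.
  have -> : qK r - qK r' - (qK s' - qK s) * dl = (qK r + qK s * dl) - (qK r' + qK s' * dl) by ring.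
  by rewrite e subrr.
have ss : s' - s = 0.
  apply: contraNeq dln => n0; apply/vlineP; exists ((r - r') / (s' - s)).
  have n0' : qK (s' - s) != 0 by rewrite -qK0 (inj_eq qK_inj).
  apply: (mulfI n0'); rewrite -key -[_ *: 1]/(qK _) -qKM mulrC divfK //.
have rr : r - r' = 0 by apply: qK_inj; rewrite key ss qK0 mul0r.
by split; apply/esym/eqP; rewrite -subr_eq0 ?rr ?ss // -opprB ss oppr0.
Qed.

End RationalScalars.

(** * Conjugation, trace and norm; a generator of the ring of integers *)

Section QuadraticConjugation.
Variables (K : fieldExtType rat) (dl : K) (D : rat) (a b : K -> rat).
Hypotheses (dl2 : dl ^+ 2 = qK K D) (abE : forall y, y = qK K (a y) + qK K (b y) * dl)
  (ab_uniq : forall r s, a (qK K r + qK K s * dl) = r /\ b (qK K r + qK K s * dl) = s).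
Local Notation q := (qK K).
Implicit Types (y z : K).

Lemma coordD y z : a (y + z) = a y + a z /\ b (y + z) = b y + b z.
Proof.
have e : y + z = q (a y + a z) + q (b y + b z) * dl.
  by rewrite {1}(abE y) {1}(abE z) !qKD mulrDl addrACA.
by rewrite e; exact: ab_uniq.
Qed.

Lemma coordM y z : a (y * z) = a y * a z + b y * b z * D /\ b (y * z) = a y * b z + b y * a z.
Proof.
have e : y * z = q (a y * a z + b y * b z * D) + q (a y * b z + b y * a z) * dl.
  by rewrite {1}(abE y) {1}(abE z) !(qKD, qKM) -dl2; ring.
by rewrite e; exact: ab_uniq.
Qed.

Lemma coord_q r : a (q r) = r /\ b (q r) = 0.
Proof. by have := ab_uniq r 0; rewrite qK0 mul0r addr0. Qed.

Lemma coordN y : a (- y) = - a y /\ b (- y) = - b y.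
Proof.
have [h1 h2] := coordD y (- y); move: h1 h2; rewrite subrr -qK0; have [-> ->] := coord_q 0.
by move=> h1 h2; split; apply/eqP; rewrite -addr_eq0 addrC -?h1 -?h2.
Qed.

Lemma coord_dl : a dl = 0 /\ b dl = 1.
Proof. by have := ab_uniq 0 1; rewrite qK0 qK1 mul1r add0r. Qed.

Definition quad_conj y := q (a y) - q (b y) * dl.
Definition quad_tr y := 2 * a y.
Definition quad_norm y := a y ^+ 2 - b y ^+ 2 * D.

Lemma quad_conjD y z : quad_conj (y + z) = quad_conj y + quad_conj z.
Proof. by rewrite /quad_conj; have [-> ->] := coordD y z; rewrite !qKD; ring. Qed.

Lemma quad_conjM y z : quad_conj (y * z) = quad_conj y * quad_conj z.
Proof.
by rewrite /quad_conj; have [-> ->] := coordM y z; rewrite !(qKD, qKM) -dl2; ring.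
Qed.

Lemma quad_conj_q r : quad_conj (q r) = q r.
Proof. by rewrite /quad_conj; have [-> ->] := coord_q r; rewrite qK0 mul0r subr0. Qed.

Lemma quad_conj_int (k : int) : quad_conj k%:~R = k%:~R.
Proof. by rewrite -qK_int quad_conj_q. Qed.

Lemma quad_conjK y : quad_conj (quad_conj y) = y.
Proof.
have [e1 e2] := ab_uniq (a y) (- b y).
have e : quad_conj y = q (a y) + q (- b y) * dl by rewrite qKN mulNr.
by rewrite /quad_conj -/(quad_conj y) e e1 e2 qKN mulNr opprK -abE.
Qed.

Lemma quad_conj_tr y : y + quad_conj y = q (quad_tr y).
Proof. by rewrite {1}(abE y) /quad_conj /quad_tr qKM (qK_int K 2); ring. Qed.

Lemma quad_conj_norm y : y * quad_conj y = q (quad_norm y).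
Proof. by rewrite {1}(abE y) /quad_conj /quad_norm qKB qKM !qKX -dl2; ring. Qed.

Lemma quad_conj_algint y : y \in @algint K -> quad_conj y \in @algint K.
Proof.
move=> /asboolP[p mp rp]; apply/asboolP; exists p => //.
have c0 : quad_conj 0 = 0 by rewrite -(qK0 K) quad_conj_q.
have c1 : quad_conj 1 = 1 by rewrite -(qK1 K) quad_conj_q.
have cX n : quad_conj (y ^+ n) = quad_conj y ^+ n.
  by elim: n => [|n IH]; rewrite ?expr0 // !exprS quad_conjM IH.
set P : {poly K} := map_poly _ p in rp *.
rewrite /root horner_coef.
have -> : \sum_(i < size P) P`_i * quad_conj y ^+ i = quad_conj P.[y].
  rewrite horner_coef (big_morph quad_conj quad_conjD c0); apply: eq_bigr => i _.
  by rewrite quad_conjM cX coef_map /= quad_conj_int.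
by rewrite (eqP rp) c0.
Qed.

Lemma quad_tr_int y : y \in @algint K -> exists t : int, quad_tr y = t%:~R.
Proof.
by move=> iy; apply: (@algint_rat K); rewrite -quad_conj_tr rpredD // quad_conj_algint.
Qed.

Lemma quad_norm_int y : y \in @algint K -> exists n : int, quad_norm y = n%:~R.
Proof.
move=> iy; apply: (@algint_rat K); rewrite -quad_conj_norm.
by apply: rpredM => //; exact: quad_conj_algint.
Qed.

Lemma D_neq0 : D != 0.
Proof.
apply/eqP => D0; have d0 : dl = 0 by apply/eqP; rewrite -sqrf_eq0 dl2 D0 qK0.
have [_] := coord_dl; rewrite d0 -(qK0 K); have [_ ->] := coord_q 0.
by move/eqP; rewrite eq_sym oner_eq0.
Qed.

Lemma nonrational_algint : exists y, y \in @algint K /\ b y != 0.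
Proof.
exists (q (denq D)%:~R * dl); split.
  apply: (@algint_exp _ _ 2) => //; rewrite exprMn dl2 -qKX -qKM.
  have -> : (denq D)%:~R ^+ 2 * D = (numq D * denq D)%:~R.
    rewrite intrM -{2}(divq_num_den D) expr2 mulrC mulrA divfK ?intr_eq0 ?denq_neq0 //.
  by rewrite qK_int algint_int.
have := ab_uniq 0 (denq D)%:~R; rewrite qK0 add0r => -[_ ->].
by rewrite intr_eq0 denq_neq0.
Qed.

(* A nonrational integer of least absolute discriminant generates the ring of integers. *)
Lemma integer_generator : exists x, [/\ x \in @algint K, b x != 0 &
  forall z, z \in @algint K -> exists k l : int, z = k%:~R + l%:~R * x].
Proof.
pose P k := `[< exists y, [/\ y \in @algint K, b y != 0 & `|quad_tr y ^+ 2 - 4 * quad_norm y| = k%:R] >].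
have discE y : quad_tr y ^+ 2 - 4 * quad_norm y = 4 * b y ^+ 2 * D.
  by rewrite /quad_tr /quad_norm; ring.
have exP : exists k, P k.
  have [y [iy by0]] := nonrational_algint.
  have [t et] := quad_tr_int iy; have [n en] := quad_norm_int iy.
  exists (absz (t ^+ 2 - 4 * n)%R); apply/asboolP; exists y; split=> //.
  rewrite et en.
  have -> : t%:~R ^+ 2 - 4 * n%:~R = (t ^+ 2 - 4 * n)%:~R :> rat by rewrite intrB rmorphXn intrM.
  by rewrite natr_absz intr_norm.
case: (ex_minnP exP) => k /asboolP[x [ix bx0 ek]] kmin.
exists x; split => // z iz.
(* The discriminant of an element is 4 b^2 D. Subtracting l x brings b y / b x into [0, 1), so
   minimality forces b y = 0. *)
pose be := b z / b x; pose l := Num.floor be.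
pose y := z - l%:~R * x.
have iy : y \in @algint K by rewrite rpredB // rpredM // algint_int.
have [_ bl] := coordM (l%:~R : K) x.
have [al0 bl0] : a (l%:~R : K) = l%:~R /\ b (l%:~R : K) = 0 by have := coord_q l%:~R; rewrite qK_int.
have byE : b y = (be - l%:~R) * b x.
  rewrite /y; have [_ ->] := coordD z (- (l%:~R * x)); have [_ ->] := coordN (l%:~R * x).
  by rewrite bl bl0 al0 mul0r addr0 /be mulrBl divfK.
have [by0|by0] := eqVneq (b y) 0.
  have e : y = q (a y) by rewrite {1}(abE y) by0 qK0 mul0r addr0.
  have [k' hk'] : exists k : int, a y = k%:~R by apply: (@algint_rat K); rewrite -e.
  by exists k', l; rewrite -(qK_int K k') -hk' -e /y subrK.
have [t et] := quad_tr_int iy; have [n en] := quad_norm_int iy.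
have Py : P (absz (t ^+ 2 - 4 * n)%R).
  apply/asboolP; exists y; split=> //; rewrite et en.
  have -> : t%:~R ^+ 2 - 4 * n%:~R = (t ^+ 2 - 4 * n)%:~R :> rat by rewrite intrB rmorphXn intrM.
  by rewrite natr_absz intr_norm.
have := kmin _ Py.
have e1 : (absz (t ^+ 2 - 4 * n)%R)%:R = `|quad_tr y ^+ 2 - 4 * quad_norm y| :> rat.
  rewrite et en.
  have -> : t%:~R ^+ 2 - 4 * n%:~R = (t ^+ 2 - 4 * n)%:~R :> rat by rewrite intrB rmorphXn intrM.
  by rewrite natr_absz intr_norm.
rewrite -(ler_nat rat) e1 -ek !discE byE.
have /andP[f0 f1] := floor_itv be; rewrite intrD in f1.
have D0 : 0 < `|D| by rewrite normr_gt0 D_neq0.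
have bx2 : 0 < b x ^+ 2 by rewrite lt_def sqrf_eq0 bx0 sqr_ge0.
have nE u : `|4 * u ^+ 2 * D| = 4 * u ^+ 2 * `|D|.
  by rewrite normrM ger0_norm // mulr_ge0 ?sqr_ge0.
rewrite !nE -/l in f0 f1 *.
have c0 : 0 <= be - l%:~R by rewrite subr_ge0.
have c1 : be - l%:~R < 1 by rewrite ltrBlDl.
have c2 : (be - l%:~R) ^+ 2 < 1 by rewrite expr2; nra.
rewrite ler_pM2r // ler_pM2l // exprMn -[X in X <= _]mul1r ler_pM2r //.
by rewrite leNgt c2.
Qed.

End QuadraticConjugation.

(** * The field trace in coordinates *)

Section QuadraticTrace.
Variables (K : fieldExtType rat) (dl : K) (D : rat) (a b : K -> rat).
Hypotheses (dl2 : dl ^+ 2 = qK K D) (abE : forall y, y = qK K (a y) + qK K (b y) * dl)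
  (ab_uniq : forall r s, a (qK K r + qK K s * dl) = r /\ b (qK K r + qK K s * dl) = s).
Hypothesis dim2 : \dim {:K} = 2%N.
Local Notation q := (qK K).
Local Notation vb := (vbasis {:K}).
Local Notation sigma := (quad_conj dl a b).
Implicit Types (y z : K).

Lemma field_trace_scale r y z : field_trace (q r * y + z) = r * field_trace y + field_trace z.
Proof.
rewrite /field_trace; have -> : q r * y = r *: y by rewrite /qK /= mulr_algl.
by rewrite (amull_is_linear r y z) passmx.mxof_linear mxtraceD mxtraceZ.
Qed.

Lemma field_trace0 : field_trace (0 : K) = 0.
Proof.
have := field_trace_scale 1 0 0; rewrite mulr0 addr0 mul1r => /eqP.
by rewrite -subr_eq0 opprD addNKr oppr_eq0 => /eqP.
Qed.

Lemma field_trace1 : field_trace (1 : K) = 2.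
Proof.
rewrite /field_trace amull1 passmx.mxof1 ?mxtrace1 ?dim2 //.
by apply: basis_free; exact: vbasisP.
Qed.

Lemma quad_conj_linear : linear sigma.
Proof.
move=> r y z; have E (v : K) : r *: v = q r * v by rewrite /qK /= mulr_algl.
by rewrite !E (quad_conjD abE ab_uniq) (quad_conjM dl2 abE ab_uniq) (quad_conj_q ab_uniq).
Qed.

(* Conjugation by sigma turns multiplication by dl into its opposite, which has the same trace. *)
Lemma field_trace_dl : field_trace dl = 0.
Proof.
pose S' : {linear K -> K} := HB.pack sigma
  (GRing.isSemilinear.Build rat K K *:%R sigma (GRing.semilinear_linear quad_conj_linear)).
pose S := linfun S'.
have SE y : S y = sigma y by rewrite lfunE.
have eS : (S \o (amull dl \o S))%VF = - amull dl.
  apply/lfunP => y; rewrite opp_lfunE !comp_lfunE !SE [amull dl (sigma y)]lfunE [amull dl y]lfunE /=.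
  rewrite (quad_conjM dl2 abE ab_uniq) (quad_conjK abE ab_uniq).
  have [a0 b1] := coord_dl ab_uniq.
  by rewrite {1}/quad_conj a0 b1 qK0 qK1 mul1r sub0r mulNr.
have SS : (S \o S)%VF = \1%VF.
  by apply/lfunP => y; rewrite id_lfunE comp_lfunE !SE (quad_conjK abE ab_uniq).
have bv : basis_of {:K} vb by exact: vbasisP.
have mc (f g : 'End(K)) : passmx.mxof vb vb (g \o f)%VF = passmx.mxof vb vb f *m passmx.mxof vb vb g.
  by apply: passmx.mxof_comp.
have : field_trace (- dl) = field_trace dl.
  rewrite /field_trace; have -> : amull (- dl) = - amull dl.
    by apply/lfunP => y; rewrite opp_lfunE !lfunE /= mulNr.
  rewrite -eS !mc mxtrace_mulC mulmxA -mc SS.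
  by rewrite passmx.mxof1 ?mul1mx //; exact: basis_free bv.
have -> : - dl = q (-1) * dl + 0 by rewrite qKN qK1 mulN1r addr0.
rewrite field_trace_scale field_trace0 mulN1r addr0 => /esym/eqP.
rewrite -subr_eq0 opprK -mulr2n mulrn_eq0 /=.
by move/eqP.
Qed.

Lemma field_traceE y : field_trace y = quad_tr a y.
Proof.
have -> : y = q (b y) * dl + (q (a y) * 1 + 0) by rewrite {1}(abE y); ring.
rewrite !field_trace_scale field_trace_dl field_trace1 field_trace0.
have -> : q (b y) * dl + (q (a y) * 1 + 0) = q (a y) + q (b y) * dl by ring.
by rewrite /quad_tr; have [-> _] := ab_uniq (a y) (b y); ring.
Qed.

End QuadraticTrace.

(** * Independence of the discriminant from the basis *)

Section Discriminant.
Variable K : fieldExtType rat.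
Implicit Types (u v w : integers K).

Lemma algint_val0 : algint_val (0 : integers K) = 0. Proof. exact: (rmorph0 (val : integers K -> K)). Qed.
Lemma algint_val1 : algint_val (1 : integers K) = 1. Proof. exact: (rmorph1 (val : integers K -> K)). Qed.
Lemma algint_valD u v : algint_val (u + v) = algint_val u + algint_val v.
Proof. exact: (rmorphD (val : integers K -> K)). Qed.
Lemma algint_valB u v : algint_val (u - v) = algint_val u - algint_val v.
Proof. exact: (rmorphB (val : integers K -> K)). Qed.
Lemma algint_valM u v : algint_val (u * v) = algint_val u * algint_val v.
Proof. exact: (rmorphM (val : integers K -> K)). Qed.
Lemma algint_valZ u (k : int) : algint_val (u *~ k) = qK K k%:~R * algint_val u.
Proof. by rewrite qK_int mulrzl; exact: (raddfMz (val : integers K -> K)). Qed.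
Lemma algint_val_sum n (F : 'I_n -> integers K) :
  algint_val (\sum_i F i) = \sum_i algint_val (F i).
Proof. exact: (rmorph_sum (val : integers K -> K)). Qed.

Lemma field_trace_sum n (r : 'I_n -> rat) (y : 'I_n -> K) :
  field_trace (\sum_i qK K (r i) * y i) = \sum_i r i * field_trace (y i).
Proof.
elim: n r y => [|n IH] r y; first by rewrite !big_ord0 field_trace0.
by rewrite !big_ord_recl field_trace_scale IH.
Qed.

Definition trace_form n (w : 'I_n -> integers K) : 'M[rat]_n :=
  \matrix_(i, j) field_trace (algint_val (w i * w j)).

Lemma trace_form_base_change n (w v : 'I_n -> integers K) : integral_basis v ->
  exists k : int, \det (trace_form w) = (k ^+ 2)%:~R * \det (trace_form v).
Proof.
move=> bv; have /choice[c hc] : forall i, exists c : {ffun 'I_n -> int}, w i = \sum_j v j *~ c j.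
  by move=> i; have [c [e _]] := bv (w i); exists c.
pose A : 'M[int]_n := \matrix_(i, j) c i j.
pose B : 'M[rat]_n := map_mx intr A.
have e : trace_form w = B *m trace_form v *m B^T.
  apply/matrixP => i j; rewrite mxE.
  have -> : algint_val (w i * w j) =
      \sum_k qK K (c j k)%:~R * \sum_l qK K (c i l)%:~R * algint_val (v l * v k).
    rewrite algint_valM {1}(hc i) (hc j) !algint_val_sum mulr_sumr; apply: eq_bigr => k _.
    rewrite algint_valZ mulrCA mulr_suml; congr (_ * _); apply: eq_bigr => l _.
    by rewrite algint_valZ algint_valM mulrA.
  rewrite field_trace_sum mxE; apply: eq_bigr => k _.
  rewrite field_trace_sum !mxE mulrC; congr (_ * _); apply: eq_bigr => l _.
  by rewrite !mxE.
exists (\det A).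
by rewrite e !det_mulmx det_tr /B det_map_mx /= rmorphXn /= expr2; ring.
Qed.

(** Discriminants of two integral bases are multiples of each other by squares of integers; when
    they are nonzero, both squares are 1. This identifies the value selected by [xget]. *)
Lemma discriminant_eq d : d != 0 -> is_discriminant K d -> discriminant K = d.
Proof.
move=> d0 hd; have hd' : is_discriminant K (discriminant K).
  by rewrite /discriminant; case: xgetP => // /(_ d).
have [w bw ew] := hd; have [v bv ev] := hd'.
have [k ek] := trace_form_base_change w bv; have [l el] := trace_form_base_change v bw.
rewrite -ew -ev -intrM in ek; rewrite -ew -ev -intrM in el.
move/intr_inj: ek; move/intr_inj: el; move: (discriminant K) => d' -> e.
have : (k * l) ^+ 2 * d = 1 * d by rewrite mul1r {2}e exprMn mulrA.
move/(mulIf d0); rewrite expr2 => h.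
have : (l ^+ 2) = 1; last by move=> ->; rewrite mul1r.
have : (l %| 1)%Z by apply/dvdzP; exists (k * k * l); apply: etrans (esym h) _; ring.
rewrite dvdz1 => /eqP l1; have [->|->] : l = 1 \/ l = -1 by lia.
  by rewrite expr1n.
by rewrite sqrrN expr1n.
Qed.

Lemma pair_integral_basis n (x : integers K) : n = 2%N ->
  (forall z, exists k l : int, z = 1 *~ k + x *~ l) ->
  (forall k l : int, 1 *~ k + x *~ l = 0 -> k = 0 /\ l = 0) ->
  integral_basis (fun i : 'I_n => if i == 0%N :> nat then 1 else x).
Proof.
move=> -> gen free z; have [k [l e]] := gen z.
exists [ffun i : 'I_2 => if i == 0%N :> nat then k else l]; split.
  by rewrite !big_ord_recl big_ord0 !ffunE /= addr0.
move=> c; rewrite !big_ord_recl big_ord0 /= addr0 e => h.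
have [h1 h2] : k - c ord0 = 0 /\ l - c (lift ord0 ord0) = 0.
  apply: free; rewrite !mulrzBr -(subrr (1 *~ k + x *~ l)) {2}h opprD.
  by rewrite addrACA.
apply/ffunP => i; rewrite ffunE; have [i0|i0] := eqVneq (i : nat) 0%N.
  have -> : i = ord0 by exact: val_inj.
  by apply/eqP; rewrite -subr_eq0 h1.
have -> : i = lift ord0 ord0 by apply: val_inj; case: i i0 => [[|[|]]].
by apply/eqP; rewrite -subr_eq0 h2.
Qed.

Lemma det_pair (R : comNzRingType) n (g : bool -> bool -> R) : n = 2%N ->
  \det (\matrix_(i < n, j < n) g (i == 0%N :> nat) (j == 0%N :> nat)) =
  g true true * g false false - g true false * g false true.
Proof.
move=> ->; rewrite (expand_det_row _ ord0) !big_ord_recl big_ord0 /cofactor.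
rewrite !det_mx11 !mxE /= expr0 expr1 mul1r addr0 mulN1r mulrN.
by [].
Qed.

End Discriminant.

(** * Split primes and squares modulo p *)

Section SplitPrimes.
Variables (K : fieldExtType rat) (x : integers K) (t n : int).
Hypotheses (x_root : x * (t%:~R - x) = n%:~R)
  (x_gen : forall z, exists k l : int, z = 1 *~ k + x *~ l).
Local Notation d := (t ^+ 2 - 4 * n).

Section PrimeIdeal.
Variable P : {pred integers K}.
Hypothesis primeP : prime_ideal P.

Lemma prime_ideal0 : 0 \in P. Proof. by have [[]] := primeP. Qed.

Lemma prime_ideal1 : 1 \notin P. Proof. by have [[]] := primeP. Qed.

Lemma prime_idealD u v : u \in P -> v \in P -> u + v \in P.
Proof. by have [[_ _ h] _] := primeP => Pu Pv; have := h 1 u v Pu Pv; rewrite mul1r. Qed.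

Lemma prime_idealMl a u : u \in P -> a * u \in P.
Proof.
by have [[h0 _ h] _] := primeP => Pu; have := h a u 0 Pu h0; rewrite addr0.
Qed.

Lemma prime_idealMr a u : u \in P -> u * a \in P.
Proof. by rewrite mulrC; exact: prime_idealMl. Qed.

Lemma prime_ideal_sum m (F : 'I_m -> integers K) :
  (forall i, F i \in P) -> \sum_i F i \in P.
Proof.
move=> h; elim: m F h => [|m IH] F h; first by rewrite big_ord0 prime_ideal0.
by rewrite big_ord_recl prime_idealD // IH.
Qed.

Lemma prime_ideal_int (p : nat) (k : int) : p%:R \in P -> (p%:Z %| k)%Z -> k%:~R \in P.
Proof. by move=> Pp /dvdzP[c ->]; rewrite intrM prime_idealMl. Qed.

Lemma prime_ideal_dvd (p : nat) (k : int) :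
  prime p -> p%:R \in P -> k%:~R \in P -> (p%:Z %| k)%Z.
Proof.
move=> pp Pp Pk; apply: contraNT prime_ideal1 => ndvd.
have : coprimez k p by rewrite coprimezE coprime_sym prime_coprime.
move=> /coprimezP[[u v] /= e].
have -> : 1 = u%:~R * k%:~R + v%:~R * p%:R :> integers K.
  by rewrite -[p%:R]/((p%:Z)%:~R) -!intrM -intrD e.
by rewrite prime_idealD ?prime_idealMl.
Qed.

(** The norm is z times its conjugate, so p | N(z) puts z or its conjugate into P; their sum, the
    trace, is then divisible by p, and z lies in P in either case. Conversely P contains no integers
    other than multiples of p. *)
Lemma mem_prime_ideal (p : nat) (k l : int) : prime p -> p%:R \in P ->
  ((p%:Z %| k ^+ 2 + k * l * t + l ^+ 2 * n)%Z -> (p%:Z %| 2 * k + l * t)%Z) ->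
  (1 *~ k + x *~ l \in P) = (p%:Z %| k ^+ 2 + k * l * t + l ^+ 2 * n)%Z.
Proof.
move=> pp Pp hN.
have e : (1 *~ k + x *~ l) * ((k + l * t)%:~R - x *~ l) = (k ^+ 2 + k * l * t + l ^+ 2 * n)%:~R.
  rewrite -[x *~ l]mulrzr !(intrD, intrM) -x_root; ring.
apply/idP/idP => [Pz|dN].
  by apply: (prime_ideal_dvd pp Pp); rewrite -e prime_idealMr.
have : (1 *~ k + x *~ l) * ((k + l * t)%:~R - x *~ l) \in P by rewrite e (prime_ideal_int Pp).
have [_ h] := primeP; move=> /h /orP[//|Pz].
have -> : 1 *~ k + x *~ l = (2 * k + l * t)%:~R + (- 1) * ((k + l * t)%:~R - x *~ l).
  by rewrite -[x *~ l]mulrzr !(intrD, intrM); ring.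
by rewrite prime_idealD ?prime_idealMl // (prime_ideal_int Pp) ?hN.
Qed.

End PrimeIdeal.

Lemma prime_dvdz_mul (p : nat) (k l : int) : prime p -> (p%:Z %| k * l)%Z ->
  (p%:Z %| k)%Z \/ (p%:Z %| l)%Z.
Proof. by move=> pp; rewrite !dvdzE abszM /= Euclid_dvdM // => /orP. Qed.

(* Otherwise p | N(z) forces p | tr(z), so that z belongs to a prime ideal above p if and only
   if p | N(z), and there is only one such ideal. *)
Lemma splits_square (p : nat) : prime p -> odd p -> splits K p ->
  ~~ (p%:Z %| d)%Z /\ exists s, (p%:Z %| d - s ^+ 2)%Z.
Proof.
move=> pp podd [P1 [P2 [hP1 hP2 nP e]]]; apply: contrapT => H; apply: nP.
have tr (k l : int) :
    (p%:Z %| k ^+ 2 + k * l * t + l ^+ 2 * n)%Z -> (p%:Z %| 2 * k + l * t)%Z.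
  move=> dN; set T := 2 * k + l * t.
  have dT : (p%:Z %| T ^+ 2 - l ^+ 2 * d)%Z.
    have -> : T ^+ 2 - l ^+ 2 * d = 4 * (k ^+ 2 + k * l * t + l ^+ 2 * n) by rewrite /T; ring.
    exact: dvdz_mull.
  have [dd|dl] : (p%:Z %| d)%Z \/ (p%:Z %| l)%Z.
  - have [|nd] := boolP (p%:Z %| d)%Z; first by left.
    have [|nl] := boolP (p%:Z %| l)%Z; first by right.
    case: H; split => //.
    have : coprimez l p by rewrite coprimezE coprime_sym prime_coprime.
    (* u inverts l modulo p, so T^2 = l^2 d becomes d = (T u)^2 modulo p. *)
    move=> /coprimezP[[u v] /= uv]; exists (T * u).
    have -> : d - (T * u) ^+ 2 = (v * p) * (1 + u * l) * d - u ^+ 2 * (T ^+ 2 - l ^+ 2 * d).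
      have -> : v * p = 1 - u * l by rewrite -uv; ring.
      ring.
    apply: rpredB; last exact: dvdz_mull.
    by rewrite -!mulrA mulrCA; exact: dvdz_mulr.
  - have : (p%:Z %| T * T)%Z.
      have -> : T * T = (T ^+ 2 - l ^+ 2 * d) + l ^+ 2 * d by ring.
      by rewrite rpredD // dvdz_mull.
    by move=> /(prime_dvdz_mul pp)[].
  - have : (p%:Z %| T * T)%Z.
      have -> : T * T = (T ^+ 2 - l ^+ 2 * d) + l * (l * d) by ring.
      by rewrite rpredD // dvdz_mulr.
    by move=> /(prime_dvdz_mul pp)[].
have : principal_ideal (p%:R : integers K) p%:R by exists 1; rewrite ?mulr1.
rewrite e => -[m [al [be [hal hbe epp]]]].
have Pp1 : p%:R \in P1 by rewrite epp prime_ideal_sum // => i; rewrite prime_idealMr.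
have Pp2 : p%:R \in P2 by rewrite epp prime_ideal_sum // => i; rewrite prime_idealMl.
move=> z; have [k [l ->]] := x_gen z.
by rewrite !(mem_prime_ideal _ pp) //; exact: tr.
Qed.

End SplitPrimes.

Section ImaginaryQuadratic.
Variables (R : realType) (K : fieldExtType rat).
Hypothesis hK : imaginary_quadratic K R.

Lemma quadratic_integers : exists (x : integers K) (t n : int),
  [/\ x * (t%:~R - x) = n%:~R, forall z, exists k l : int, z = 1 *~ k + x *~ l,
      discriminant K = t ^+ 2 - 4 * n & t ^+ 2 - 4 * n < 0].
Proof.
have [dim2 noreal] := hK.
have [dl [D [a [b [dl2 abE ab_uniq]]]]] := quadratic_generator dim2.
have [x [ix bx0 gen]] := integer_generator dl2 abE ab_uniq.
have [t et] := quad_tr_int dl2 abE ab_uniq ix.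
have [n en] := quad_norm_int dl2 abE ab_uniq ix.
have D0 := D_neq0 dl2 ab_uniq.
have discE : (t ^+ 2 - 4 * n)%:~R = 4 * b x ^+ 2 * D.
  by rewrite intrB intrM rmorphXn /= -et -en /quad_tr /quad_norm; ring.
have d0 : t ^+ 2 - 4 * n != 0.
  by rewrite -(intr_eq0 rat) discE !mulf_neq0 ?sqrf_eq0.
have xE : x + quad_conj dl a b x = t%:~R.
  by rewrite (quad_conj_tr abE) et qK_int.
have valI : injective (@algint_val K) by exact: val_inj.
pose X := AlgInt ix.
have valZ1 (k : int) : algint_val (1 *~ k : integers K) = k%:~R.
  by rewrite algint_valZ algint_val1 mulr1 qK_int.
have Xroot : X * (t%:~R - X) = n%:~R.
  apply: valI; rewrite algint_valM algint_valB !valZ1 -xE.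
  by rewrite addrAC subrr add0r (quad_conj_norm dl2 abE) en qK_int.
have Xgen : forall z, exists k l : int, z = 1 *~ k + X *~ l.
  move=> z; have [k [l e]] := gen (algint_val z) (valP z); exists k, l.
  by apply: valI; rewrite algint_valD !algint_valZ algint_val1 !qK_int mulr1.
have Xfree : forall k l : int, 1 *~ k + X *~ l = 0 -> k = 0 /\ l = 0.
  move=> k l /(congr1 (@algint_val K)); rewrite algint_valD !algint_valZ algint_val1 mulr1 algint_val0 /= => h.
  have [_ bkl] := coordD abE ab_uniq (qK K k%:~R) (qK K l%:~R * x).
  have [_ bl] := coordM dl2 abE ab_uniq (qK K l%:~R) x.
  have [_ b0] := coord_q ab_uniq 0.
  have [_ bk0] := coord_q ab_uniq k%:~R; have [al bl0] := coord_q ab_uniq l%:~R.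
  move: bkl; rewrite h -(qK0 K) b0 bk0 bl al bl0 mul0r addr0 add0r => /esym/eqP.
  rewrite mulf_eq0 (negPf bx0) orbF intr_eq0 => /eqP l0; split=> //.
  move: h; rewrite l0 qK0 mul0r addr0 -(qK0 K) => /qK_inj/eqP.
  by rewrite intr_eq0 => /eqP.
exists X, t, n; split => //.
  apply: discriminant_eq d0 _.
  exists (fun i => if i == 0%N :> nat then 1 else X); first exact: pair_integral_basis.
  pose g (i j : bool) := field_trace (algint_val ((if i then 1 else X) * (if j then 1 else X))).
  rewrite (_ : matrix_of_fun _ _ = \matrix_(i, j) g (i == 0%N :> nat) (j == 0%N :> nat)) //.
  rewrite (det_pair _ dim2) /g !algint_valM algint_val1 mul1r !mulr1 mul1r /=.
  rewrite (field_trace1 dim2) !(field_traceE dl2 abE ab_uniq dim2) discE /quad_tr.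
  by have [-> _] := coordM dl2 abE ab_uniq x x; ring.
(* If the discriminant were nonnegative, D would have a real square root w, and sending [dl] to w
   would embed K into the reals. *)
rewrite -(ltrz0 rat) discE ltNge; apply/negP => h; apply: noreal.
have D_ge0 : 0 <= D.
  by move: h; rewrite pmulr_rge0 // mulr_gt0 // lt_def sqrf_eq0 bx0 sqr_ge0.
pose w : R := Num.sqrt (ratr D).
have w2 : w ^+ 2 = ratr D by rewrite sqr_sqrtr // ler0q.
pose f (y : K) : R := ratr (a y) + ratr (b y) * w.
have fB : zmod_morphism f.
  move=> y z; rewrite /f; have [-> ->] := coordD abE ab_uniq y (- z).
  by have [-> ->] := coordN abE ab_uniq z; rewrite !(rmorphD, rmorphN); ring.
have fM : monoid_morphism f.
  split; first by rewrite /f -(qK1 K); have [-> ->] := coord_q ab_uniq 1; rewrite rmorph1 rmorph0 mul0r addr0.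
  move=> y z; rewrite /f; have [-> ->] := coordM dl2 abE ab_uniq y z.
  by rewrite !(rmorphD, rmorphM) /= -w2; ring.
exact: (HB.pack f (GRing.isZmodMorphism.Build K R f fB) (GRing.isMonoidMorphism.Build K R f fM)).
Qed.

Lemma discriminant_lt0 : discriminant K < 0.
Proof. by have [x [t [n [_ _ -> ?]]]] := quadratic_integers. Qed.

Lemma splits_discriminant_square (p : nat) : prime p -> odd p -> splits K p ->
  ~~ (p%:Z %| discriminant K)%Z /\ exists s, (p%:Z %| discriminant K - s ^+ 2)%Z.
Proof.
have [x [t [n [xr xg -> _]]]] := quadratic_integers.
exact: splits_square xr xg p.
Qed.

End ImaginaryQuadratic.

(** * The quotient of values of phi *)

Section PowerIdentities.
Variable F : fieldType.

Lemma eta_quotient24 (y a b : F) : y != 0 ->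
  (a ^+ 2 / b) ^+ 24 = (y * a ^+ 24) ^+ 2 / (y ^+ 2 * b ^+ 24).
Proof.
move=> y0; rewrite expr_div_n (exprMn 2 y) -!exprM (invfM (y ^+ 2)) [RHS]mulrACA divff ?mul1r //.
by rewrite expf_neq0.
Qed.

Lemma expr_mul_div (w p q : F) n : (w * p / q) ^+ n = w ^+ n * p ^+ n / q ^+ n.
Proof. by rewrite expr_div_n exprMn. Qed.

Lemma eta_ratio24 (M a b a' b' : F) : [/\ M != 0, a != 0, b != 0, a' != 0 & b' != 0] ->
  M ^+ 12 * (a' ^+ 2 / b') / (a ^+ 2 / b) = (M ^+ 12 * (a' / a)) ^+ 2 / (M ^+ 12 * (b' / b)).
Proof. by move=> [M0 a0 b0 a0' b0']; field; rewrite ?expf_neq0 ?b0 ?b0' ?a0 ?M0. Qed.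

End PowerIdentities.

Section ThetaQuotient.
Variable R : realType.
Local Notation C := R[i].
Implicit Types (tau z : C).

Lemma qpowE tau (r : R) : qpow tau r = ee (r%:C%C * tau).
Proof. by rewrite /qpow /ee twopiiE rmorphM /= !mulrA; congr (cexp (_ * _)); rewrite mulrAC. Qed.

(** With y = e((tau + 1)/2) = -q^(1/2) the factors of phi are (1 - y^(2n-1))^2 (1 - y^(2n));
    completing the odd exponents to all exponents gives the quotient of Euler products. *)
Lemma cv_phi tau : upper tau ->
  cv (fun N => \prod_(1 <= n < N.+1) ((1 + qpow tau (n%:R - 2^-1)) ^+ 2 * (1 - qpow tau n%:R)))
    (euler (ee ((tau + 1) / 2)) ^+ 2 / euler (ee ((tau + 1) / 2) ^+ 2)).
Proof.
move=> tu; set s := (tau + 1) / 2; set y := ee s; set h := ee (tau / 2).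
have su : upper s.
  rewrite /s; apply: (@upper_divn _ _ 1); exact: (etrans (upperDn tau 1) tu).
have y1 : cmod y < 1 by exact: cmod_ee_upper.
have y21 : cmod (y ^+ 2) < 1 by rewrite cmodX expr_lt1 // cmod_ge0.
have yh : y = - h by rewrite /y /s mulrDl mul1r eeD ee_half mulrN1.
have qodd j : qpow tau (j.+1%:R - 2^-1) = h ^+ j.*2.+1.
  rewrite qpowE /h -ee_natl; congr ee.
  by rewrite rmorphB /= fmorphV !rmorph_nat -mul2n; field.
have qeven j : qpow tau j.+1%:R = h ^+ j.*2.+2.
  rewrite qpowE /h -ee_natl rmorph_nat; congr ee.
  by rewrite -doubleS -mul2n; field.
apply: (eq_cv (u := fun N => (\prod_(0 <= j < N.*2) (1 - y ^+ j.+1)) ^+ 2 /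
    \prod_(0 <= j < N) (1 - (y ^+ 2) ^+ j.+1))).
  move=> N; have P0 : \prod_(0 <= j < N) (1 - (y ^+ 2) ^+ j.+1) != 0.
    by rewrite prodf_seq_neq0; apply/allP => j _; rewrite disc_1BX_neq0.
  apply: (mulIf P0); rewrite divfK // big_add1 /= -big_split /=.
  elim: {P0} N => [|N IH]; first by rewrite !big_geq // expr1n.
  rewrite doubleS !big_nat_recr //= -IH qodd qeven -[(y ^+ 2) ^+ _]exprM yh.
  have -> : (- h) ^+ N.*2.+1 = - h ^+ N.*2.+1 by rewrite exprNn -signr_odd /= odd_double expr1 mulN1r.
  have -> : (- h) ^+ N.*2.+2 = h ^+ N.*2.+2 by rewrite exprNn -signr_odd /= odd_double expr0 mul1r.
  have -> : (- h) ^+ (2 * N.+1) = h ^+ N.*2.+2.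
    by rewrite mul2n doubleS exprNn -signr_odd /= odd_double expr0 mul1r.
  by move: (\prod_(0 <= j < N.*2) _) (h ^+ N.*2.+1) (h ^+ N.*2.+2) => P a b; ring.
apply: cv_div; first exact: euler_neq0.
  apply: cvX; apply: (cv_sub (k := double) (u := fun n => \prod_(0 <= j < n) (1 - y ^+ j.+1))).
    by move=> n; rewrite -addnn leq_addr.
  exact: cv_euler.
exact: cv_euler.
Qed.

Lemma phiE tau : upper tau ->
  phi tau = euler (ee ((tau + 1) / 2)) ^+ 2 / euler (ee ((tau + 1) / 2) ^+ 2).
Proof. by move=> tu; apply: cv_clim; exact: cv_phi. Qed.

Lemma upper_half tau : upper tau -> upper ((tau + 1) / 2).
Proof. by move=> tu; apply: (@upper_divn _ _ 1); exact: (etrans (upperDn tau 1) tu). Qed.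

Lemma upper_pnatM z (m : nat) : (0 < m)%N -> upper z -> upper (m%:R * z).
Proof. by case: m => // n _; exact: upper_natM. Qed.

Lemma phi24 tau : upper tau ->
  phi tau ^+ 24 = Delta ((tau + 1) / 2) ^+ 2 / Delta (2 * ((tau + 1) / 2)).
Proof.
move=> tu; rewrite phiE // /Delta (ee_natl _ 2).
have := ee_neq0 ((tau + 1) / 2); move: (ee _) => y y0.
exact: eta_quotient24.
Qed.

(** Both cases of the definition of theta in one form: 2 theta + e is the chosen square root of d,
    with e = 0 or e = 1. *)
Lemma theta_of_disc_sqr (d : int) : d < 0 ->
  upper (theta_of_disc R d) /\ exists e : int, (2 * theta_of_disc R d + e%:~R) ^+ 2 = d%:~R.
Proof.
move=> d0; rewrite /theta_of_disc; set w := Num.sqrt _.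
have w0 : 0 < w by rewrite sqrtr_gt0 oppr_gt0 ltrz0.
have w2 : ((0 +i* w)%C : C) ^+ 2 = d%:~R.
  have w2r : w ^+ 2 = - d%:~R by rewrite sqr_sqrtr // oppr_ge0 lerz0 ltW.
  rewrite intrC expr2; apply/eqP; rewrite eq_complex /=; apply/andP; split; apply/eqP.
    by rewrite mul0r sub0r -expr2 w2r opprK.
  by rewrite mul0r mulr0 addr0.
have wu : upper (0 +i* w)%C by [].
case: ifP => _; split.
- exact: (@upper_divn _ _ 1).
- by exists 0; rewrite addr0 mulrC divfK ?pnatr_eq0.
- apply: (@upper_divn _ _ 1); rewrite addrC; exact: (etrans (upperBn _ 1) wu).
- by exists 1; rewrite mulrC divfK ?pnatr_eq0 // addrAC addNr add0r.
Qed.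

Lemma phi_ratio24 tau (m : nat) : upper tau -> odd m -> (0 < m)%N ->
  ((Num.sqrt (m%:R : R))%:C%C * phi (m%:R * tau) / phi tau) ^+ 24 =
  delta_ratio m ((tau + 1) / 2) ^+ 2 / delta_ratio m (2 * ((tau + 1) / 2)).
Proof.
move=> tu mo m0; set s := (tau + 1) / 2.
have mu : upper (m%:R * tau) by exact: upper_pnatM.
have [h em] : exists h : nat, m = h.*2.+1.
  by exists m./2; rewrite -[LHS]odd_double_half mo.
(* As m = 2h + 1, (m tau + 1)/2 = m s - h, and its double is m (2 s) - 2h; both shifts are integral
   because m is odd. *)
have e1 : Delta ((m%:R * tau + 1) / 2) = Delta (m%:R * s).
  rewrite -[LHS](@Delta_period _ _ h); congr Delta.
  by rewrite /s em -pmulrn -addn1 -mul2n natrD natrM; field.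
have e2 : Delta (2 * ((m%:R * tau + 1) / 2)) = Delta (m%:R * (2 * s)).
  rewrite -[LHS](@Delta_period _ _ (h.*2)%N); congr Delta.
  by rewrite /s em -pmulrn -addn1 -mul2n natrD natrM; field.
have sq : ((Num.sqrt (m%:R : R))%:C%C : C) ^+ 24 = m%:R ^+ 12.
  have <- : ((Num.sqrt (m%:R : R))%:C%C : C) ^+ 2 = m%:R.
    have := sqr_sqrtr (ler0n R m); move: (Num.sqrt _) => w w2.
    by rewrite natrC -w2 !expr2 rmorphM.
  by move: (_%:C%C) => w; rewrite -exprM.
rewrite expr_mul_div sq (phi24 mu) (phi24 tu) e1 e2 /delta_ratio -/s.
have su := upper_half tu.
have s2u : upper (2 * s) by exact: (@upper_pnatM s 2).
apply: eta_ratio24; split.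
- by rewrite pnatr_eq0 -lt0n.
- exact: Delta_neq0 su.
- exact: Delta_neq0 s2u.
- exact: Delta_neq0 (upper_pnatM m0 su).
- exact: Delta_neq0 (upper_pnatM m0 s2u).
Qed.

Lemma is_aunit_algint_unit z n : (0 < n)%N -> is_aunit (z ^+ n) -> algint_unit z.
Proof.
move=> n0 [iz z0 iv].
have zn0 : z != 0 by apply: contraNneq z0 => ->; rewrite expr0n gtn_eqF.
have jz : z \in @algint C by apply: algint_exp iz.
have jv : z^-1 \in @algint C by apply: algint_exp n0 _; rewrite exprVn.
exists (AlgInt jz), (AlgInt jv); split => //.
by apply: val_inj; rewrite /= divff.
Qed.

Lemma phi_ratio_unit (d : int) (m : nat) : d < 0 -> odd m -> (0 < m)%N ->
  (forall p, prime p -> (p %| m)%N -> ~~ (p%:Z %| d)%Z /\ exists s, (p%:Z %| d - s ^+ 2)%Z) ->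
  algint_unit ((Num.sqrt (m%:R : R))%:C%C * phi (m%:R * theta_of_disc R d)
    / phi (theta_of_disc R d)).
Proof.
move=> d0 mo m0 hp; have [tu [e he]] := theta_of_disc_sqr d0.
move: (theta_of_disc R d) tu he => tau tu he.
apply: (@is_aunit_algint_unit _ 24) => //.
rewrite (phi_ratio24 tu mo m0).
have su := upper_half tu.
have s2u : upper (2 * ((tau + 1) / 2)) by exact: (@upper_pnatM _ 2).
have ndvd2n k p : prime p -> (p %| m)%N -> ~~ (p%:Z %| (2 ^ k)%:Z)%Z.
  move=> pp pm; rewrite dvdzE /= Euclid_dvdX //; apply/negP => /andP[p2 _].
  have := dvdn_odd pm mo; have := dvdn_leq (isT : (0 < 2)%N) p2.
  by case: p pp p2 {pm} => [|[|[|p]]].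
(* 4 s + e - 2 and 2 (2 s) + e - 2 both equal 2 tau + e, whose square is d; the coefficients 4 and 2
   are prime to the odd number m. *)
have u1 : is_aunit (delta_ratio m ((tau + 1) / 2)).
  apply: (@delta_ratio_unit _ _ 4 (e - 2) d) => //.
    by rewrite -he intrB; congr (_ ^+ 2); field.
  by move=> p pp pm; have [h1 h2] := hp p pp pm; split=> //; exact: (ndvd2n 2%N).
have u2 : is_aunit (delta_ratio m (2 * ((tau + 1) / 2))).
  apply: (@delta_ratio_unit _ _ 2 (e - 2) d) => //.
    by rewrite -he intrB; congr (_ ^+ 2); field.
  by move=> p pp pm; have [h1 h2] := hp p pp pm; split=> //; exact: (ndvd2n 1%N).
by apply: is_aunitM; [exact: (is_aunitM u1 u1) | exact: is_aunitV].
Qed.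

End ThetaQuotient.

Theorem theorem1p3 (R : realType) (K : fieldExtType rat)
    (hK : imaginary_quadratic K R) (m : nat) (m_ge3 : (3 <= m)%N)
    (m_odd : odd m)
    (m_split : forall p : nat, prime p -> (p %| m)%N -> splits K p) :
  algint_unit
    ((Num.sqrt (m%:R : R))%:C%C * phi (m%:R * theta R K) / phi (theta R K)).
Proof.
have m_gt0 : (0 < m)%N by apply: leq_trans m_ge3.
apply: phi_ratio_unit (discriminant_lt0 hK) (m_odd) m_gt0 _ => p pp pm.
exact: (splits_discriminant_square hK pp (dvdn_odd pm m_odd) (m_split p pp pm)).
Qed.
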